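(* Let $M$ be an orientable smooth manifold of dimension $2n+1$. The following assertions are equivalent: (1) $M$ admits an almost cosymplectic structure (equivalently, an almost contact structure); (2) the gauge equation of dual connections on $M$ admits a skew-symmetric solution of rank $2n$; that is, there exist a Riemannian metric $g$ on $M$, an affine connection $\nabla$ on $M$ with $g$-dual connection $\nabla^*$, and a $(1,1)$-tensor field $\theta$ on $M$ which is skew-symmetric with respect to $g$, has rank $2n$ at every point, and satisfies $\nabla^*_X(\theta Y)=\theta(\nabla_X Y)$ for all vector fields $X,Y$.
   Context: An almost cosymplectic structure on a $(2n+1)$-dimensional manifold $M$ is a pair $(\omega,\eta)$ of a 2-form $\omega$ and a 1-form $\eta$ such that $\omega^n\wedge\eta$ vanishes nowhere. An almost contact structure on $M$ is a triple $(\phi,\xi,\eta)$ of a $(1,1)$-tensor field $\phi$, a vector field $\xi$ and a 1-form $\eta$ with $\eta(\xi)=1$ and $\phi^2=-\mathrm{Id}+\eta\otimes\xi$. Given a Riemannian metric $g$ and an affine connection $\nabla$ on $TM$ (torsion allowed), the dual connection $\nabla^*$ is defined by $Z(g(X,Y))=g(\nabla_Z X,Y)+g(X,\nabla^*_Z Y)$ for all vector fields $X,Y,Z$. The gauge equation of the pair $(\nabla,\nabla^* )$ is the equation $\nabla^*_X(\theta Y)=\theta(\nabla_X Y)$ for all $X,Y$, for a $(1,1)$-tensor field $\theta$. Skew-symmetric means $g(\theta X,Y)=-g(X,\theta Y)$. *)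

(* Defs.v *)
From HB Require Import structures.
From mathcomp Require Import all_boot all_order all_algebra all_fingroup.
From mathcomp Require Import all_classical all_reals all_analysis.

Set Implicit Arguments.
Unset Strict Implicit.
Unset Printing Implicit Defensive.

Import Order.TTheory GRing.Theory Num.Theory.
Import numFieldNormedType.Exports.

Local Open Scope classical_set_scope.
Local Open Scope ring_scope.

(** Class C^k on [U]. This is meant for an open [U]: differentiability and
    continuity at the points of [U] are then local to [U], so that the values
    of [f] outside [U] are irrelevant. *)
Fixpoint class_C (R : realType) (V W : normedModType R) (k : nat)
    (U : set V) (f : V -> W) : Prop :=
  match k with
  | 0 => forall x, U x -> {for x, continuous f}
  | k'.+1 => (forall x, U x -> differentiable f x) /\
             (forall v : V, class_C k' U ('D_v f))
  end.

Definition smooth_on (R : realType) (V W : normedModType R)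
    (U : set V) (f : V -> W) : Prop :=
  forall k, class_C k U f.

(** A chart is a homeomorphism from the open set [chart_dom] onto an open
    subset of R^m; [chart_map] and [chart_inv] are total functions whose values matter
    only on [chart_dom] and on its image. *)
Record chart (R : realType) (m : nat) (T : topologicalType) := Chart {
  chart_dom : set T;
  chart_map :> T -> 'rV[R]_m;
  chart_inv : 'rV[R]_m -> T;
  chart_dom_open : open chart_dom;
  chart_cod_open : open (chart_map @` chart_dom);
  chart_mapK : forall p, chart_dom p -> chart_inv (chart_map p) = p;
  chart_map_continuous : forall p, chart_dom p -> {for p, continuous chart_map};
  chart_inv_continuous :
    forall x, (chart_map @` chart_dom) x -> {for x, continuous chart_inv} }.

Definition transition (R : realType) (m : nat) (T : topologicalType)
    (c c' : chart R m T) : 'rV[R]_m -> 'rV[R]_m :=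
  c' \o chart_inv c.

Definition compatible (R : realType) (m : nat) (T : topologicalType)
    (c c' : chart R m T) : Prop :=
  smooth_on (c @` (chart_dom c `&` chart_dom c')) (transition c c') /\
  smooth_on (c' @` (chart_dom c `&` chart_dom c')) (transition c' c).

Record smooth_manifold (R : realType) (m : nat) := SmoothManifold {
  carrier :> topologicalType;
  manifold_hausdorff : hausdorff_space carrier;
  manifold_second_countable : @second_countable carrier;
  atlas : set (chart R m carrier);
  atlas_cover : forall p : carrier, exists c, atlas c /\ chart_dom c p;
  atlas_compatible : forall c c', atlas c -> atlas c' -> compatible c c' }.

Arguments atlas {R m} M : rename.

Definition orientable (R : realType) (m : nat) (M : smooth_manifold R m) :=
  exists B : set (chart R m M),
    [/\ forall p : M, exists c, B c /\ chart_dom c p,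
        forall b c, B b -> atlas M c -> compatible b c &
        forall b b' p, B b -> B b' -> chart_dom b p -> chart_dom b' p ->
          0 < \det (jacobian (transition b b') (b p))].

Definition chart_at (R : realType) (m : nat) (M : smooth_manifold R m) (p : M) :
    chart R m M :=
  projT1 (cid (atlas_cover p)).

(** A tangent vector at [p] is represented by its coordinates in the chart
    [chart_at p]; its coordinates in any other chart [c] around [p] are given
    by [tcoord c] below. Hence [p] plays a role in the meaning of the type,
    although not in its value. *)
Definition tangent (R : realType) (m : nat) (M : smooth_manifold R m) (p : M) :
    normedModType R :=
  'rV[R]_m.

Definition tcoord (R : realType) (m : nat) (M : smooth_manifold R m)
    (c : chart R m M) (p : M) (v : tangent p) : 'rV[R]_m :=
  'd (transition (chart_at p) c) (chart_at p p) v.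

(** The coordinate vector d/dx_i of the chart [c] at [p]. *)
Definition frame (R : realType) (m : nat) (M : smooth_manifold R m)
    (c : chart R m M) (i : 'I_m) (p : M) : tangent p :=
  'd (transition c (chart_at p)) (c p) (delta_mx 0 i).

Definition smooth_map (R : realType) (m : nat) (M : smooth_manifold R m)
    (W : normedModType R) (f : M -> W) : Prop :=
  forall c, atlas M c -> smooth_on (c @` chart_dom c) (f \o chart_inv c).

Definition vector_field (R : realType) (m : nat) (M : smooth_manifold R m) :=
  forall p : M, tangent p.

Definition smooth_vector_field (R : realType) (m : nat)
    (M : smooth_manifold R m) (X : vector_field M) : Prop :=
  forall c, atlas M c ->
    smooth_on (c @` chart_dom c)
      (fun x : 'rV[R]_m => tcoord c (X (chart_inv c x))).

Definition lie_derivative (R : realType) (m : nat) (M : smooth_manifold R m)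
    (X : vector_field M) (f : M -> R) : M -> R :=
  fun p => 'd ((f : M -> R^o) \o chart_inv (chart_at p)) (chart_at p p) (X p).

(** (1,1)-tensor fields, seen as fields of endomorphisms. *)
Definition endo_field (R : realType) (m : nat) (M : smooth_manifold R m) :=
  forall p : M, {linear tangent p -> tangent p}.

Definition smooth_endo_field (R : realType) (m : nat)
    (M : smooth_manifold R m) (theta : endo_field M) : Prop :=
  forall c i, atlas M c ->
    smooth_on (c @` chart_dom c)
      (fun x : 'rV[R]_m => let p := chart_inv c x in
         tcoord c (theta p (frame c i p))).

Definition rank_at (R : realType) (m : nat) (M : smooth_manifold R m)
    (theta : endo_field M) (p : M) : nat :=
  \rank (lin1_mx (theta p : 'rV[R]_m -> 'rV[R]_m)).

Definition multilinear (R : realType) (V : lmodType R) (k : nat)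
    (w : ('I_k -> V) -> R) : Prop :=
  forall (v : 'I_k -> V) (i : 'I_k) (a : R) (x y : V),
    w [eta v with i |-> a *: x + y] =
    a * w [eta v with i |-> x] + w [eta v with i |-> y].

Definition alternate (R : realType) (V : lmodType R) (k : nat)
    (w : ('I_k -> V) -> R) : Prop :=
  forall (v : 'I_k -> V) (i j : 'I_k), i != j -> v i = v j -> w v = 0.

Definition wedge (R : realType) (V : lmodType R) (k l : nat)
    (a : ('I_k -> V) -> R) (b : ('I_l -> V) -> R) : ('I_(k + l) -> V) -> R :=
  fun v => (k`! * l`!)%:R^-1 *
    \sum_(s : 'S_(k + l)) (-1) ^+ s * a (fun i => v (s (lshift l i)))
                                    * b (fun j => v (s (rshift k j))).

Fixpoint wedge_pow (R : realType) (V : lmodType R) (k : nat)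
    (a : ('I_k -> V) -> R) (n : nat) : ('I_(n * k) -> V) -> R :=
  match n with
  | 0 => fun=> 1
  | n'.+1 => wedge a (@wedge_pow R V k a n')
  end.

Arguments wedge_pow {R V k} a n : rename.

Definition kform (R : realType) (m : nat) (M : smooth_manifold R m) (k : nat) :=
  forall p : M, ('I_k -> tangent p) -> R.

Record differential_form (R : realType) (m : nat) (M : smooth_manifold R m)
    (k : nat) (w : kform M k) : Prop := DifferentialForm {
  form_multilinear : forall p : M, multilinear (w p);
  form_alternate : forall p : M, alternate (w p);
  form_smooth : forall c (i : 'I_k -> 'I_m), atlas M c ->
    smooth_on (c @` chart_dom c)
      (fun x : 'rV[R]_m => let p := chart_inv c x in
         (w p (fun j => frame c (i j) p) : R^o)) }.

Definition metric_field (R : realType) (m : nat) (M : smooth_manifold R m) :=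
  forall p : M, tangent p -> tangent p -> R.

Record riemannian_metric (R : realType) (m : nat) (M : smooth_manifold R m)
    (g : metric_field M) : Prop := RiemannianMetric {
  metric_linear : forall (p : M) (a : R) (u v w : tangent p),
    g p (a *: u + v) w = a * g p u w + g p v w;
  metric_sym : forall (p : M) (u v : tangent p), g p u v = g p v u;
  metric_pos : forall (p : M) (u : tangent p), u != 0 -> 0 < g p u u;
  metric_smooth : forall c i j, atlas M c ->
    smooth_on (c @` chart_dom c)
      (fun x : 'rV[R]_m => let p := chart_inv c x in
         (g p (frame c i p) (frame c j p) : R^o)) }.

(** [nabla X Y] stands for the covariant derivative of Y along X; it is
    meaningful only for smooth fields [X] and [Y]. *)
Record affine_connection (R : realType) (m : nat) (M : smooth_manifold R m)
    (nabla : vector_field M -> vector_field M -> vector_field M) : Prop :=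
    AffineConnection {
  connection_smooth : forall X Y,
    smooth_vector_field X -> smooth_vector_field Y ->
    smooth_vector_field (nabla X Y);
  connection_linear : forall (f : M -> R) X X' Y,
    smooth_map (f : M -> R^o) -> smooth_vector_field X ->
    smooth_vector_field X' -> smooth_vector_field Y ->
    forall p, nabla (fun q => f q *: X q + X' q) Y p =
              f p *: nabla X Y p + nabla X' Y p;
  connection_additive : forall X Y Y',
    smooth_vector_field X -> smooth_vector_field Y -> smooth_vector_field Y' ->
    forall p, nabla X (fun q => Y q + Y' q) p = nabla X Y p + nabla X Y' p;
  connection_leibniz : forall (f : M -> R) X Y,
    smooth_map (f : M -> R^o) -> smooth_vector_field X ->
    smooth_vector_field Y ->
    forall p, nabla X (fun q => f q *: Y q) p =
              lie_derivative X f p *: Y p + f p *: nabla X Y p }.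

Definition dual_connections (R : realType) (m : nat) (M : smooth_manifold R m)
    (g : metric_field M)
    (nabla nabla' : vector_field M -> vector_field M -> vector_field M) : Prop :=
  forall X Y Z, smooth_vector_field X -> smooth_vector_field Y ->
    smooth_vector_field Z -> forall p,
    lie_derivative Z (fun q => g q (X q) (Y q)) p =
    g p (nabla Z X p) (Y p) + g p (X p) (nabla' Z Y p).

Definition gauge_equation (R : realType) (m : nat) (M : smooth_manifold R m)
    (nabla nabla' : vector_field M -> vector_field M -> vector_field M)
    (theta : endo_field M) : Prop :=
  forall X Y, smooth_vector_field X -> smooth_vector_field Y -> forall p,
    nabla' X (fun q => theta q (Y q)) p = theta p (nabla X Y p).

Definition skew_symmetric (R : realType) (m : nat) (M : smooth_manifold R m)
    (g : metric_field M) (theta : endo_field M) : Prop :=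
  forall (p : M) (u v : tangent p), g p (theta p u) v = - g p u (theta p v).

Record almost_cosymplectic (R : realType) (n : nat)
    (M : smooth_manifold R (2 * n).+1) (omega : kform M 2) (eta : kform M 1) :
    Prop := AlmostCosymplectic {
  acos_omega : differential_form omega;
  acos_eta : differential_form eta;
  acos_volume : forall p : M, exists v,
    wedge (wedge_pow (omega p) n) (eta p) v != 0 }.

Record almost_contact (R : realType) (n : nat)
    (M : smooth_manifold R (2 * n).+1) (phi : endo_field M)
    (xi : vector_field M) (eta : kform M 1) : Prop := AlmostContact {
  acontact_phi : smooth_endo_field phi;
  acontact_xi : smooth_vector_field xi;
  acontact_eta : differential_form eta;
  acontact_reeb : forall p : M, eta p (fun=> xi p) = 1;
  acontact_sqr : forall (p : M) (u : tangent p),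
    phi p (phi p u) = - u + eta p (fun=> u) *: xi p }.

(* Main.v *)
(* At each point omega is a skew matrix A and eta a row vector a. Writing omega as a
   sum of products x_k /\ y_k, the form omega^n /\ eta is a positive multiple of the
   determinant of (x_1, y_1, ..., x_n, y_n, a); so it is nonzero if and only if
   ker omega and ker eta meet in 0.

   Global objects are obtained from local ones by interpolating with bump functions:
   metrics, covectors and connections affinely, structures phi tamed by omega (that is,
   with omega(u, phi u) > 0 on ker eta) along Cayley paths. An almost contact structure
   conversely yields the 2-form g(u, phi v) - g(phi u, v).

   Given (omega, eta) and a metric g, let theta be defined by omega = g(theta ., .). For
   dual connections the gauge equation says that omega is parallel for nabla, an affine
   condition on nabla. It has local solutions: if xi is the Reeb vector and
   A^+ = (A + a^T a)^-1 - xi^T xi, then A^+ A = 1 - xi^T a and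
   gamma = (dA A^+ - a^T dxi) / 2 solves dA = gamma A + A gamma^T. Conversely a skew
   theta of rank 2n gives a 2-form of rank 2n, and on an oriented manifold the covectors
   eta with omega^n /\ eta > 0 form a convex set, so that they can be glued. *)

(* Coordinates are the main obstacle. A tangent vector at p is recorded in the chart [chart_at p],
   picked without any regularity in p, so the matrix of a smooth tensor need not be a smooth
   function of p. Smoothness is therefore always tested on components in one chart kept fixed near
   the point.

   The gauge equation can be solved whatever d omega is, because connections may have torsion: in a
   chart, parallelism of omega is a separate linear equation on the connection matrix for each
   direction, involving only omega and its first derivatives, and constant rank makes a solution
   formula smooth.

   All gluing goes through one theorem, which asks for a path between any two valid values over a
   point. Affine conditions offer segments. The equation phi^2 = - Id + eta (x) xi is not affine,
   and for n > 0 its solutions form a disconnected set, split by the orientation that phi induces on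
   ker eta; taming by omega selects a part in which any two solutions are joined by a path depending
   smoothly on its ends. *)
Require Import Defs.
From HB Require Import structures.
From mathcomp Require Import all_boot all_order all_algebra all_fingroup.
From mathcomp Require Import all_classical all_reals all_analysis.
From mathcomp Require Import ring lra.

Set Implicit Arguments.
Unset Strict Implicit.
Unset Printing Implicit Defensive.

Import Order.TTheory GRing.Theory Num.Theory.
Import numFieldNormedType.Exports.

Local Open Scope classical_set_scope.
Local Open Scope ring_scope.

(** * Maps of class C^k *)

Section ClassC.
Context {R : realType}.
Implicit Types V W : normedModType R.

(** [g - f] vanishes near [x], hence is negligible against the increment and has differential 0
    there; adding it to [f] keeps differentiability. *)
Lemma near_eq_differentiable V W (f g : V -> W) (x : V) :
  (\forall y \near x, f y = g y) -> differentiable f x -> differentiable g x.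
Proof.
move=> fg df; have gx := nbhs_singleton fg.
have -> : g = f + (g - f) by apply/funext => y /=; rewrite !fctE addrC subrK.
apply: differentiableD => //.
pose k : V -> W := g - f.
have k0 : k \o shift x =o_ 0 id.
  apply/eqoP => e e0; rewrite near_simpl.
  have : \forall h \near 0, f (h + x) = g (h + x).
    rewrite (near_shift x) /=; near=> y; rewrite /= sub0r addrNK.
    by near: y.
  apply: filterS => h /= fgh.
  by rewrite /k !fctE fgh subrr normr0 mulr_ge0 // ltW.
have c0 : continuous (\0 : V -> W) by exact: cst_continuous.
have e0 : k \o shift x = cst (k x) + \0%R +o_ 0 id.
  apply/eqaddoP; have -> : cst (k x) + \0%R = 0 :> (V -> W).
    by apply/funext => ?; rewrite /k !fctE gx subrr addr0.
  by rewrite subr0; exact/eqoP.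
have dk := diff_unique c0 e0.
by apply/(@diff_locallyP R V W x (g - f)); split; rewrite dk.
Unshelve. all: by end_near. Qed.

Lemma class_C_sub V W k (U O : set V) (f : V -> W) :
  U `<=` O -> class_C k O f -> class_C k U f.
Proof.
move=> UO; elim: k f => [|k IHk] f /=; first by move=> fc x /UO/fc.
by move=> [fd fD]; split=> [x /UO/fd//|v]; exact/IHk/fD.
Qed.

Lemma class_C_union V W k (U : set V) (f : V -> W) :
  (forall x, U x -> exists O : set V, O x /\ class_C k O f) -> class_C k U f.
Proof.
elim: k f => [|k IHk] f /= Uf.
  by move=> x /Uf[D [Ox fO]]; exact: fO.
split=> [x /Uf[D [Ox [fd _]]]|v]; first exact: fd.
by apply: IHk => x /Uf[D [Ox [_ fD]]]; exists D.
Qed.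

(** Openness turns equality on [U] into equality near each point, which the directional derivatives
    inherit. The lemmas below use this to replace a derivative by a formula valid on [U] only. *)
Lemma class_C_eq V W k (U : set V) (f g : V -> W) : open U ->
  (forall x, U x -> f x = g x) -> class_C k U f -> class_C k U g.
Proof.
move=> oU; elim: k f g => [|k IHk] f g fg /=.
  move=> fc x Ux; suff : g @ x --> g x by []; rewrite -(fg _ Ux).
  apply: cvg_trans (fc x Ux); apply: near_eq_cvg.
  by near=> y; apply: fg; near: y; exact: open_nbhs_nbhs.
have nfg x : U x -> \forall y \near x, f y = g y.
  by move=> Ux; near=> y; apply: fg; near: y; exact: open_nbhs_nbhs.
move=> [fd fD]; split=> [x Ux|v].
  exact: near_eq_differentiable (nfg x Ux) (fd x Ux).
apply: IHk (fD v) => x Ux; exact/near_eq_derive/nfg.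
Unshelve. all: by end_near. Qed.

Lemma class_CW V W k (U : set V) (f : V -> W) :
  class_C k.+1 U f -> class_C k U f.
Proof.
elim: k f => [|k IHk] f; first by move=> [fd _] x /fd/differentiable_continuous.
by move=> [fd fD]; split=> // v; exact/IHk/fD.
Qed.

Lemma class_C_cst V W k (U : set V) (a : W) : class_C k U (fun=> a : W).
Proof.
elim: k a => [|k IHk] a /=; first by move=> x _; exact: cst_continuous.
split=> [x _|v]; first exact: differentiable_cst.
rewrite (_ : 'D_v _ = fun=> 0)//; apply/funext => x.
by rewrite derive_cst.
Qed.

Lemma class_CD V W k (U : set V) (f g : V -> W) : open U ->
  class_C k U f -> class_C k U g -> class_C k U (fun x => f x + g x).
Proof.
move=> oU; elim: k f g => [|k IHk] f g.
  by move=> fc gc x Ux; apply: cvgD; [exact: fc|exact: gc].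
move=> [fd fD] [gd gD]; split=> [x Ux|v]; first exact: differentiableD (fd x Ux) (gd x Ux).
apply: class_C_eq (IHk _ _ (fD v) (gD v)) => // x Ux.
by rewrite deriveD//; apply: diff_derivable; [exact: fd|exact: gd].
Qed.

(** By the product rule the derivative is built from [f] and [g], of class [k] by [class_CW], and
    from their derivatives, so the induction hypothesis applies to both products. Inverses and
    composites follow the same pattern. *)
Lemma class_CM V k (U : set V) (f g : V -> R^o) : open U ->
  class_C k U f -> class_C k U g -> class_C k U (fun x => f x * g x : R^o).
Proof.
move=> oU; elim: k f g => [|k IHk] f g.
  by move=> fc gc x Ux; apply: cvgM; [exact: fc|exact: gc].
move=> fk gk; have [fd fD] := fk; have [gd gD] := gk.
split=> [x Ux|v]; first exact: differentiableM (fd x Ux) (gd x Ux).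
have := class_CD oU (IHk _ _ (class_CW fk) (gD v)) (IHk _ _ (class_CW gk) (fD v)).
apply: class_C_eq => // x Ux.
by rewrite deriveM//; apply: diff_derivable; [exact: fd|exact: gd].
Qed.

Lemma class_CV V k (U : set V) (f : V -> R^o) : open U ->
  (forall x, U x -> f x != 0) ->
  class_C k U f -> class_C k U (fun x => (f x)^-1 : R^o).
Proof.
move=> oU f0; elim: k => [|k IHk].
  by move=> fc x Ux; apply: cvgV; [exact: f0|exact: fc].
move=> fk; have [fd fD] := fk.
split=> [x Ux|v]; first exact: differentiableV (fd x Ux) (f0 x Ux).
have fV := IHk (class_CW fk).
have := class_CM oU (class_C_cst k U (-1 : R^o)) (class_CM oU (class_CM oU fV fV) (fD v)).
apply: class_C_eq => // x Ux.
rewrite deriveV//; [|exact: f0|exact/diff_derivable/fd].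
by rewrite mulN1r -invfM -expr2 scaleNr.
Qed.

Lemma class_C_sum V W k (U : set V) (I : Type) (r : seq I) (F : I -> V -> W) :
  open U -> (forall i, class_C k U (F i)) ->
  class_C k U (fun x => \sum_(i <- r) F i x).
Proof.
move=> oU FC; elim: r => [|i r IHr].
  rewrite (_ : (fun x => _) = fun=> 0); first exact: class_C_cst.
  by apply/funext => x; rewrite big_nil.
rewrite (_ : (fun x => _) = fun x => F i x + \sum_(j <- r) F j x).
  exact: class_CD.
by apply/funext => x; rewrite big_cons.
Qed.

Lemma class_C_coord a b V k (U : set V) (f : V -> 'M[R]_(a, b)) i j : open U ->
  class_C k U f -> class_C k U (fun x => f x i j : R^o).
Proof.
move=> oU; elim: k f => [|k IHk] f.
  move=> fc x Ux.
  exact: (@continuous_comp _ _ _ f (fun M : 'M[R]_(a, b) => M i j : R^o) x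
    (fc x Ux) (@coord_continuous _ _ _ i j (f x))).
move=> [fd fD]; split=> [x Ux|v].
  exact: (differentiable_comp (fd x Ux) (differentiable_coord _ i j)).
apply: class_C_eq (IHk _ (fD v)) => // x Ux.
by rewrite derive_mx ?mxE//; exact/diff_derivable/fd.
Qed.

Lemma continuous_mxP a b (T : topologicalType) (f : T -> 'M[R]_(a, b)) x :
  (forall i j, {for x, continuous (fun y => f y i j)}) ->
  {for x, continuous f}.
Proof.
move=> fc; apply/cvgrPdist_lt => e e0; near=> y.
rewrite /Num.Def.normr/= mx_normrE (bigmax_lt _ e0)//= => i _.
rewrite !mxE/=; move: i; near: y; apply: filter_forall => /= i.
by move/cvgrPdist_lt : (fc i.1 i.2); apply.
Unshelve. all: by end_near. Qed.

Lemma class_C_mx a b V k (U : set V) (f : V -> 'M[R]_(a, b)) : open U ->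
  (forall i j, class_C k U (fun x => f x i j : R^o)) -> class_C k U f.
Proof.
move=> oU; elim: k f => [|k IHk] f fk.
  by move=> x Ux; apply: continuous_mxP => i j; exact: fk.
have fd x : U x -> differentiable f x.
  move=> Ux.
  have -> : f = \sum_(i < a) \sum_(j < b) (fun x => f x i j *: delta_mx i j).
    apply/funext => y; rewrite {1}(matrix_sum_delta (f y)) fct_sumE.
    by apply: eq_bigr => i _; rewrite fct_sumE.
  apply: differentiable_sum => i; apply: differentiable_sum => j.
  apply: differentiableZl; exact: (fk i j).1.
split=> // v; apply: IHk => i j; have [_ /(_ v)] := fk i j.
apply: class_C_eq => // x Ux.
by rewrite derive_mx ?mxE//; exact/diff_derivable/fd.
Qed.

(** The chain rule is written with the partial derivatives of [g]: they are again scalar functions,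
    of class one less, so the induction stays within the same statement. *)
Lemma class_C_comp n V k (U : set V) (O : set 'rV[R]_n) (g : 'rV[R]_n -> R^o)
    (f : V -> 'rV[R]_n) : open U -> open O -> (forall x, U x -> O (f x)) ->
  class_C k O g -> class_C k U f -> class_C k U (g \o f).
Proof.
move=> oU oO UO; elim: k g => [|k IHk] g.
  by move=> gc fc x Ux; apply: continuous_comp; [exact: fc|exact/gc/UO].
move=> [gd gD] fk; have [fd fD] := fk.
split=> [x Ux|v].
  by apply: differentiable_comp; [exact: fd|exact/gd/UO].
have H i : class_C k U (fun x => ('D_(delta_mx 0 i) g \o f) x * 'D_v f x 0 i : R^o).
  apply: class_CM => //; first exact: (IHk _ (gD _) (class_CW fk)).
  exact: (class_C_coord 0 i oU (fD v)).
have := class_C_sum (index_enum _) oU H.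
apply: class_C_eq => // x Ux.
have dfx := fd x Ux; have dgx := gd _ (UO _ Ux).
rewrite [RHS]deriveE; last exact: differentiable_comp.
rewrite diff_comp//= deriveE//; set w := 'd f x v.
rewrite [in RHS](row_sum_delta w) linear_sum/=.
by apply: eq_bigr => i _; rewrite linearZ/= -(deriveE _ dgx) mulrC.
Qed.

Lemma class_C_comp1 V k (U : set V) (D : set R^o) (g : R^o -> R^o)
    (f : V -> R^o) : open U -> open D -> (forall x, U x -> D (f x)) ->
  class_C k D g -> class_C k U f -> class_C k U (g \o f).
Proof.
move=> oU oD UD; elim: k g => [|k IHk] g.
  by move=> gc fc x Ux; apply: continuous_comp; [exact: fc|exact/gc/UD].
move=> [gd gD] fk; have [fd fD] := fk.
split=> [x Ux|v].
  by apply: differentiable_comp; [exact: fd|exact/gd/UD].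
have := class_CM oU (IHk _ (gD 1) (class_CW fk)) (fD v).
apply: class_C_eq => // x Ux.
have dfx := fd x Ux; have dgx := gd _ (UD _ Ux).
rewrite [RHS]deriveE; last exact: differentiable_comp.
rewrite diff_comp//= !deriveE//; set w := 'd f x v.
by rewrite -[X in _ = 'd _ _ X]mulr1 linearZ/= mulrC.
Qed.

End ClassC.

(** * A smooth step function *)

Section SmoothStep.
Context {R : realType}.

(** The function exp(-1/t) extended by 0, multiplied by powers of 1/t. Derivatives of members of
    this family are linear combinations of members, which reduces smoothness at all orders to one
    derivative formula. *)
Definition flat (n : nat) (t : R^o) : R^o :=
  if 0 < t then t^-1 ^+ n * expR (- t^-1) else 0.

(** With s = 1/t, the exponential of s exceeds s^(n+2) / (n+2)!, which absorbs s^n and leaves t^2. A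
    quadratic bound is what gives derivative 0 at the origin. *)
Lemma flat_bound n (t : R) : `|flat n t| <= n.+2`!%:R * t ^+ 2.
Proof.
rewrite /flat; case: ifPn => [t0|_]; last by rewrite normr0 mulr_ge0 ?sqr_ge0.
have s0 : 0 < t^-1 by rewrite invr_gt0.
rewrite ger0_norm; last by rewrite mulr_ge0 ?expR_ge0// exprn_ge0 ?ltW.
have := expR_ge1Dxn n.+1 (ltW s0).
have F0 : 0 < n.+2`!%:R :> R by rewrite ltr0n fact_gt0.
move=> H; rewrite expRN ler_pdivrMr ?expR_gt0//.
have -> : t^-1 ^+ n = t ^+ 2 * t^-1 ^+ n.+2.
  by rewrite -(addn2 n) exprD mulrCA -exprMn divff ?gt_eqF// expr1n mulr1.
rewrite [leRHS]mulrAC [leRHS]mulrC ler_pM2l ?exprn_gt0// -ler_pdivrMl//.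
by rewrite mulrC; apply: le_trans H; rewrite lerDr.
Qed.

Lemma is_derive_flat n (t : R^o) :
  is_derive t 1 (flat n) (flat n.+2 t - n%:R * flat n.+1 t).
Proof.
have [t0|t0|t0] := ltgtP 0 t.
- pose g : R^o -> R^o := fun t => t^-1 ^+ n * expR (- t^-1).
  apply: (@near_eq_is_derive _ _ _ g).
    near=> y; rewrite /g /flat ifT//; near: y; exact: lt_nbhsr.
  have dV : is_derive (t : R^o) 1 (fun y : R^o => y^-1) (- t ^- 2).
    have dVt := @derivableV _ _ id (t : R^o) 1 (lt0r_neq0 t0) (@derivable_id R R^o t 1).
    apply: DeriveDef => //.
    by rewrite deriveV ?gt_eqF// derive_id scaleNr [_ *: _]mulr1.
  rewrite /flat t0.
  have dX : is_derive (t : R^o) 1 (fun y : R^o => y^-1 ^+ n) (- n%:R * t^-1 ^+ n.+1).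
    case: n {g} => [|n].
      by rewrite oppr0 mul0r; exact: is_derive_cst.
    have := is_deriveX n.+1 dV; rewrite exprfctE => H; apply: (is_derive_eq H).
    rewrite [_ *: _]mulrN /= !exprS expr0 mulr1 invfM.
    by ring.
  have dE : is_derive (t : R^o) 1 (fun y : R^o => expR (- y^-1)) (expR (- t^-1) * t ^- 2).
    have dN := is_deriveN dV.
    apply: DeriveDef.
      apply/derivable1_diffP.
      apply: (@differentiable_comp _ _ _ _ (fun y : R^o => - y^-1 : R^o)).
        exact/derivable1_diffP.
      exact/derivable1_diffP/derivable_expR.
    rewrite -derive1E (@derive1_comp _ (fun y : R^o => - y^-1) expR)//.
    rewrite !derive1E; have [_ ->] := dN; have [_ ->] := is_derive_expR (- t^-1).
    by rewrite opprK.
  apply: (is_derive_eq (is_deriveM dX dE)).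
  rewrite /GRing.scale/= !exprS expr0 mulr1 invfM.
  by ring.
- apply: (@near_eq_is_derive _ _ _ (cst 0)).
    near=> y; rewrite /flat ifF//; apply/negbTE; rewrite -leNgt ltW//.
    near: y; exact: lt_nbhsl.
  rewrite /flat ltNge ltW//= mulr0 subr0; exact: is_derive_cst.
- have f0 m : flat m (0 : R) = 0 by rewrite /flat ltxx.
  rewrite -t0 !f0 mulr0 subr0.
  (* By [flat_bound] the difference quotient at 0 is at most (n+2)! |h|. *)
  have H : h^-1 *: (flat n (h *: (1 : R^o) + 0) - flat n (0 : R^o)) @[h --> (0 : R)^'] --> (0 : R^o).
    apply/cvgrPdist_le => e e0; near=> h.
    rewrite addr0 [h *: 1]mulr1 f0 subr0 sub0r normrN normrM.
    have h0 : h != 0 by near: h; exact: nbhs_dnbhs_neq.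
    rewrite normrV ?unitfE// mulrC ler_pdivrMr ?normr_gt0//.
    apply: le_trans (flat_bound _ _) _.
    rewrite -real_normK ?num_real// expr2 mulrA; apply: ler_wpM2r => //.
    rewrite mulrC -ler_pdivlMr ?ltr0n ?fact_gt0//.
    near: h; apply: dnbhs0_le.
    by rewrite divr_gt0// ltr0n fact_gt0.
  by apply: DeriveDef; [apply/cvg_ex; exists 0|exact/cvg_lim].
Unshelve. all: by end_near. Qed.

Lemma class_C_flat k n : class_C k setT (flat n).
Proof.
elim: k n => [|k IHk] n.
  move=> t _; apply/differentiable_continuous/derivable1_diffP.
  by have [] := is_derive_flat n t.
split=> [t _|v]; first by apply/derivable1_diffP; have [] := is_derive_flat n t.
have C c : class_C k (setT : set R^o) (fun=> c : R^o) := class_C_cst k setT (c : R^o).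
have := class_CM openT (C v)
  (class_CD openT (IHk n.+2) (class_CM openT (C (- n%:R)) (IHk n.+1))).
apply: class_C_eq openT _ => t _.
have [d1 d2] := is_derive_flat n t.
have df : differentiable (flat n) t by exact/derivable1_diffP.
rewrite deriveE// -[X in 'd _ _ X]mulr1 linearZ/= -deriveE// d2.
by rewrite mulNr.
Qed.

Lemma class_C_id (V : normedModType R) k (U : set V) : class_C k U (id : V -> V).
Proof.
case: k => [|k]; first by move=> x _; exact: cvg_id.
split=> [x _|v]; first exact: ex_diff.
rewrite (_ : 'D_v id = fun=> v); first exact: class_C_cst.
by apply/funext => x; rewrite derive_id.
Qed.

Definition smooth_step (t : R^o) : R^o := flat 0 t / (flat 0 t + flat 0 (1 - t)).

Lemma flat_ge0 n (t : R) : 0 <= flat n t.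
Proof.
by rewrite /flat; case: ifPn => // t0; rewrite mulr_ge0 ?expR_ge0// exprn_ge0// invr_ge0 ltW.
Qed.

Lemma smooth_step_den (t : R) : 0 < flat 0 t + flat 0 (1 - t).
Proof.
have P (s : R) : 0 < s -> 0 < flat 0 s.
  by move=> s0; rewrite /flat s0 expr0 mul1r expR_gt0.
have [t0|t0] := ltP 0 t.
  by apply: ltr_pwDl; [exact: P|exact: flat_ge0].
by apply: ltr_wpDl; [exact: flat_ge0|apply: P; lra].
Qed.

Lemma class_C_smooth_step k : class_C k setT smooth_step.
Proof.
have C c : class_C k (setT : set R^o) (fun=> c : R^o) := class_C_cst k setT (c : R^o).
have F := class_C_flat k 0.
have L : class_C k setT (fun t : R^o => 1 - t : R^o).
  have := class_CD openT (C 1) (class_CM openT (C (-1)) (class_C_id k setT)).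
  by apply: class_C_eq openT _ => t _; rewrite mulN1r.
apply: (class_CM openT F); apply: (class_CV openT) => [t _|].
  exact/lt0r_neq0/smooth_step_den.
apply: (class_CD openT F).
exact: (class_C_comp1 openT openT _ F L).
Qed.

Lemma smooth_step_itv (t : R) : 0 <= smooth_step t <= 1.
Proof.
have d0 := smooth_step_den t; have := flat_ge0 0 t; have := flat_ge0 0 (1 - t).
rewrite /smooth_step => f1 f2.
by rewrite divr_ge0 ?(ltW d0)// ler_pdivrMr// mul1r lerDl.
Qed.

Lemma smooth_step0 (t : R) : t <= 0 -> smooth_step t = 0.
Proof. by move=> t0; rewrite /smooth_step {1}/flat ltNge t0 mul0r. Qed.

Lemma smooth_step1 (t : R) : 1 <= t -> smooth_step t = 1.
Proof.
move=> t1; have := smooth_step_den t; rewrite /smooth_step.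
have -> : flat 0 (1 - t) = 0 by rewrite /flat subr_gt0 ltNge t1.
rewrite addr0 => f0.
by rewrite divff// gt_eqF.
Qed.

End SmoothStep.

(** * Powers of 2-forms as determinants *)

Section BlockPerm.
Variables k l : nat.
Implicit Types (s : 'S_k) (t : 'S_l).

Definition block_perm_fun s t (x : 'I_(k + l)) : 'I_(k + l) :=
  match fintype.split x with inl i => lshift l (s i) | inr j => rshift k (t j) end.

Lemma block_perm_inj s t : injective (block_perm_fun s t).
Proof.
move=> x y; rewrite /block_perm_fun.
case: (fintype.split_ordP x) => i ->; case: (fintype.split_ordP y) => j ->.
- by move=> /lshift_inj/perm_inj ->.
- by move=> /eqP; rewrite eq_lrshift.
- by move=> /eqP; rewrite eq_rlshift.
- by move=> /rshift_inj/perm_inj ->.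
Qed.

Definition block_perm s t : 'S_(k + l) := perm (@block_perm_inj s t).

Lemma block_perml s t i : block_perm s t (lshift l i) = lshift l (s i).
Proof.
by rewrite permE /block_perm_fun; case: fintype.split_ordP => j /eqP;
  rewrite ?eq_lrshift// => /eqP/lshift_inj ->.
Qed.

Lemma block_permr s t i : block_perm s t (rshift k i) = rshift k (t i).
Proof.
by rewrite permE /block_perm_fun; case: fintype.split_ordP => j /eqP;
  rewrite ?eq_rlshift// => /eqP/rshift_inj ->.
Qed.

(** Signs are determinants of permutation matrices, and the matrix of [block_perm s t] is block
    diagonal. *)
Lemma sign_block_perm (R : comNzRingType) s t :
  (-1) ^+ block_perm s t = (-1) ^+ s * (-1) ^+ t :> R.
Proof.
rewrite -!det_perm -(det_ublock _ 0); congr (\det _).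
apply/matrixP => x y; rewrite [LHS]mxE [LHS]mxE.
case: (fintype.split_ordP x) => i ->; rewrite ?block_perml ?block_permr;
  case: (fintype.split_ordP y) => j ->; rewrite ?block_mxEul ?block_mxEur ?block_mxEdl
  ?block_mxEdr !mxE ?eq_lshift ?eq_rshift ?eq_lrshift ?eq_rlshift //.
Qed.

End BlockPerm.

(* Laplace expansion along the first k rows, summed over all permutations
   instead of over k-subsets, whence the factor k! l!. *)
Lemma laplace_perm (R : comNzRingType) k l (Z : 'M[R]_(k + l)) :
  \sum_(s : 'S_(k + l)) (-1) ^+ s
    * \det (\matrix_(i, j) Z (lshift l i) (s (lshift l j)))
    * \det (\matrix_(i, j) Z (rshift k i) (s (rshift k j)))
  = (k`! * l`!)%:R * \det Z.
Proof.
have E (s : 'S_(k + l)) (u : 'S_k) (t : 'S_l) :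
    (-1) ^+ s * (((-1) ^+ u * \prod_i Z (lshift l i) (s (lshift l (u i)))) *
      ((-1) ^+ t * \prod_i Z (rshift k i) (s (rshift k (t i))))) =
    (-1) ^+ (block_perm u t * s)%g * \prod_i Z i ((block_perm u t * s)%g i).
  rewrite big_split_ord/= odd_permM signr_addb sign_block_perm.
  under [X in _ = _ * (X * _)]eq_bigr => i _ do rewrite permM block_perml.
  under [X in _ = _ * (_ * X)]eq_bigr => i _ do rewrite permM block_permr.
  move: (\prod_(i < k) _) (\prod_(i < l) _) ((-1) ^+ s) ((-1) ^+ u) ((-1) ^+ t).
  by move=> a b c d e; ring.
transitivity (\sum_(s : 'S_(k + l)) \sum_(u : 'S_k) \sum_(t : 'S_l)
    (-1) ^+ (block_perm u t * s)%g * \prod_i Z i ((block_perm u t * s)%g i)).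
  apply: eq_bigr => s _; rewrite -mulrA /determinant big_distrlr/= big_distrr/=.
  apply: eq_bigr => u _; rewrite big_distrr/=; apply: eq_bigr => t _; rewrite -E.
  by congr (_ * (_ * _ * (_ * _))); apply: eq_bigr => i _; rewrite mxE.
rewrite exchange_big/=; under eq_bigr => u _.
  rewrite exchange_big/=; under eq_bigr => t _.
    rewrite (reindex_inj (mulgI (block_perm u t)^-1%g))/=.
    under eq_bigr => s _ do rewrite mulKVg.
    rewrite -/(determinant Z).
    over.
  over.
rewrite !sumr_const !card_Sn -mulrnA mulr_natl.
by rewrite mulnC.
Qed.

Section WedgeForms.
Context {R : realType}.

Definition rows (k m : nat) (v : 'I_k -> 'rV[R]_m) : 'M[R]_(k, m) := \matrix_(i < k) v i.

(** The decomposable form z_1 /\ ... /\ z_k, with z_i the rows of [Z], evaluated as the determinant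
    of the numbers z_i(v_j). *)
Definition det_form (k m : nat) (Z : 'M[R]_(k, m)) (v : 'I_k -> 'rV[R]_m) : R :=
  \det (Z *m (rows v)^T).

Definition form1 (m : nat) (a : 'rV[R]_m) (v : 'I_1 -> 'rV[R]_m) : R :=
  (v ord0 *m a^T) 0 0.

Definition form2 (m : nat) (A : 'M[R]_m) (v : 'I_2 -> 'rV[R]_m) : R :=
  (v ord0 *m A *m (v ord_max)^T) 0 0.

(** The sum over permutations in the wedge product is the Laplace expansion of the stacked
    determinant, and its multiplicity k! l! cancels the normalisation of [wedge]. *)
Lemma wedge_det_form k l m (Z : 'M[R]_(k, m)) (W : 'M[R]_(l, m)) v :
  wedge (det_form Z) (det_form W) v = det_form (col_mx Z W) v.
Proof.
rewrite /wedge /det_form; set M := col_mx Z W *m _.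
transitivity ((k`! * l`!)%:R^-1 * ((k`! * l`!)%:R * \det M)); last first.
  by rewrite mulKf// pnatr_eq0 muln_eq0 negb_or -!lt0n !fact_gt0.
rewrite -laplace_perm; congr (_ * _); apply: eq_bigr => s _.
congr (_ * _ * _); congr determinant; apply/matrixP => i j; rewrite !mxE;
  by apply: eq_bigr => x _; rewrite ?col_mxEu ?col_mxEd !mxE.
Qed.

Lemma wedge_suml (I J : finType) k l m (a : I -> ('I_k -> 'rV[R]_m) -> R)
    (b : J -> ('I_l -> 'rV[R]_m) -> R) v :
  wedge (fun w => \sum_i a i w) (fun w => \sum_j b j w) v =
  \sum_(p : I * J) wedge (a p.1) (b p.2) v.
Proof.
rewrite -(pair_bigA _ (fun i j => wedge (a i) (b j) v))/= /wedge.
under [RHS]eq_bigr => i _ do rewrite -mulr_sumr.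
rewrite -mulr_sumr; congr (_ * _).
under [RHS]eq_bigr => i _ do rewrite exchange_big/=.
rewrite exchange_big/=; apply: eq_bigr => s _.
rewrite -mulrA big_distrlr/= mulr_sumr; apply: eq_bigr => i _.
by rewrite mulr_sumr; apply: eq_bigr => j _; rewrite mulrA.
Qed.

Lemma half_ord_subproof n (i : 'I_(n * 2)) : (i./2 < n)%N.
Proof. by rewrite ltn_half_double -muln2. Qed.

Definition half_ord n (i : 'I_(n * 2)) : 'I_n := Ordinal (half_ord_subproof i).

(** The rows a_1, b_1, a_2, b_2, ...: the order in which the factors x_k /\ y_k occur in the n-th
    power. *)
Definition interleave n m (A B : 'M[R]_(n, m)) : 'M[R]_(n * 2, m) :=
  \matrix_(i, j) (if odd i then B (half_ord i) j else A (half_ord i) j).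

Lemma interleave_col n m (a b : 'rV[R]_m) (A B : 'M[R]_(n, m)) :
  interleave (col_mx a A : 'M[R]_(n.+1, m)) (col_mx b B : 'M[R]_(n.+1, m)) =
  col_mx (col_mx a b : 'M[R]_(2, m)) (interleave A B).
Proof.
have h0 (k : 'I_2) : @half_ord n.+1 (lshift (n * 2) k) = lshift n (ord0 : 'I_1).
  by apply: val_inj => /=; case: k => [[|[|]]].
have h1 (k : 'I_(n * 2)) : @half_ord n.+1 (rshift 2 k) = rshift 1 (half_ord k).
  exact: val_inj.
apply/matrixP => i j; rewrite [LHS]mxE.
case: (fintype.split_ordP (i : 'I_(2 + n * 2))) => k ->; last first.
  rewrite h1 (@col_mxEd _ 1 n _ b B) (@col_mxEd _ 1 n _ a A).
  by rewrite (@col_mxEd _ 2 (n * 2)) !mxE /= negbK.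
rewrite h0 (@col_mxEu _ 1 n _ b B) (@col_mxEu _ 1 n _ a A) (@col_mxEu _ 2 (n * 2)).
case: (fintype.split_ordP (k : 'I_(1 + 1))) => q ->.
  by rewrite ord1 (@col_mxEu _ 1 1).
by rewrite ord1 (@col_mxEd _ 1 1).
Qed.

Lemma interleave_mulr n m p (A B : 'M[R]_(n, m)) (M : 'M[R]_(m, p)) :
  interleave (A *m M) (B *m M) = interleave A B *m M.
Proof.
apply/matrixP => i j; rewrite !mxE; case: ifPn => oi; apply: eq_bigr => x _;
  by rewrite !mxE ?oi// (negbTE oi).
Qed.

Definition interleave_mx n : 'M[R]_(n * 2, n + n) :=
  interleave (row_mx 1%:M 0) (row_mx 0 1%:M).

Lemma interleaveE n m (A B : 'M[R]_(n, m)) :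
  interleave A B = interleave_mx n *m col_mx A B.
Proof.
by rewrite -interleave_mulr !mul_row_col !mul1mx !mul0mx addr0 add0r.
Qed.

Lemma interleave_mx_orth n : interleave_mx n *m (interleave_mx n)^T = 1%:M.
Proof.
pose g (i : 'I_(n * 2)) : 'I_(n + n) :=
  if odd i then rshift n (half_ord i) else lshift n (half_ord i).
have gE i c : interleave_mx n i c = (g i == c)%:R.
  rewrite mxE /g; case: (fintype.split_ordP c) => x ->; case: ifPn => oi;
  rewrite ?row_mxEl ?row_mxEr !mxE ?eq_lshift ?eq_rshift ?eq_lrshift ?eq_rlshift//.
have gI : injective g.
  move=> i j; rewrite /g; case: ifPn => oi; case: ifPn => oj => /eqP;
  rewrite ?eq_lshift ?eq_rshift ?eq_lrshift ?eq_rlshift// => /eqP[] hij;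
  by apply: val_inj; rewrite /= -(odd_double_half i) -(odd_double_half j)
    ?oi ?oj ?(negbTE oi) ?(negbTE oj) hij.
apply/matrixP => i j; rewrite !mxE.
rewrite (bigD1 (g i))//= big1 ?addr0 => [|c /negbTE gc].
  by rewrite gE mxE gE eqxx mul1r eq_sym (inj_eq gI).
by rewrite gE [g i == c]eq_sym gc mul0r.
Qed.

(** [p] and [q] stand for [n * 2] and [n + n], which are equal but not convertible; hence the
    reordering matrices stay rectangular and the equality is substituted inside this proof. *)
Lemma det_conj_rect p q (e : p = q) (L : 'M[R]_(p, q)) (L' : 'M[R]_(q, p)) (D : 'M[R]_q) :
  L *m L' = 1%:M -> \det (L *m D *m L') = \det D /\ L' *m L = 1%:M.
Proof.
subst q => LL; split; last exact: mulmx1C.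
by rewrite !det_mulmx mulrAC -det_mulmx LL det1 mul1r.
Qed.

Section Pow.
Variables (K m : nat) (X Y : 'M[R]_(K, m)).

Let A := X^T *m Y - Y^T *m X.

(** Words of length [n] in the indices of the pairs (x_k, y_k): they index the monomials in the
    expansion of the n-th power. [pow_sel] turns a word into the 0/1 matrix extracting the
    corresponding rows. *)
Fixpoint pow_idx (n : nat) : finType :=
  if n is n'.+1 then ('I_K * pow_idx n')%type else unit.

Fixpoint pow_sel (n : nat) : pow_idx n -> 'M[R]_(n, K) :=
  match n return pow_idx n -> 'M[R]_(n, K) with
  | 0 => fun=> 0
  | n'.+1 => fun p => col_mx (delta_mx 0 p.1 : 'rV[R]_K) (@pow_sel n' p.2)
  end.

Lemma form2_det v : form2 A v =
  \sum_(k < K) det_form (col_mx (row k X) (row k Y)) v.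
Proof.
rewrite /form2 /A mulmxBr mulmxBl !mxE.
have E (B : 'M[R]_(K, m)) (C : 'M[R]_(K, m)) : (v ord0 *m (B^T *m C) *m (v ord_max)^T) 0 0 =
    \sum_k (v ord0 *m (row k B)^T) 0 0 * (v ord_max *m (row k C)^T) 0 0.
  rewrite mulmxA -mulmxA mxE; apply: eq_bigr => k _.
  congr (_ * _); rewrite !mxE; apply: eq_bigr => x _; rewrite !mxE//.
  by rewrite mulrC.
have := E X Y; have := E Y X; rewrite !mxE => -> ->; rewrite -sumrB.
apply: eq_bigr => k _; rewrite /det_form (expand_det_row _ ord0) !big_ord_recl big_ord0 addr0.
rewrite /cofactor !det_mx11 !mxE /= /bump/= !addn0 expr0 mul1r expr1.
rewrite mulN1r mulrN.
have c0 x : col_mx (row k X) (row k Y) 0 x = X k x.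
  by rewrite (_ : 0 = lshift 1 (0 : 'I_1)) ?(@col_mxEu _ 1 1) ?mxE//; exact: val_inj.
have c1 (i : 'I_2) x : (0 < i)%N -> col_mx (row k X) (row k Y) i x = Y k x.
  move=> i0; rewrite (_ : i = rshift 1 (0 : 'I_1)) ?(@col_mxEd _ 1 1) ?mxE//.
  by apply: val_inj; case: i i0 => [[|[|]]].
have L1 (j : 'I_1) : lift ord0 j = ord_max :> 'I_2 by apply: val_inj; case: j => [[]].
have L2 (j : 'I_1) : lift ord_max j = ord0 :> 'I_2 by apply: val_inj; case: j => [[]].
rewrite [X in _ - X]mulrC !L1 L2; congr (_ * _ - _ * _); apply: eq_bigr => x _;
  by rewrite ?c0 ?c1// !mxE mulrC.
Qed.

Lemma interleave_wedge n v :
  wedge_pow (form2 A) n v =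
  \sum_(p : pow_idx n) det_form (interleave (pow_sel p *m X) (pow_sel p *m Y)) v.
Proof.
elim: n v => [|n IHn] v.
  rewrite (bigD1 tt)//= big1 ?addr0 => [|[]//].
  by rewrite /det_form [X in determinant X](_ : _ = 0) ?det_mx00//; apply/matrixP => -[].
rewrite /=.
rewrite (_ : form2 A = fun w => \sum_(k < K) det_form (col_mx (row k X) (row k Y)) w); last first.
  by apply/funext => w; exact: form2_det.
rewrite (_ : wedge_pow _ n = fun w => \sum_(p : pow_idx n)
   det_form (interleave (pow_sel p *m X) (pow_sel p *m Y)) w); last first.
  apply/funext => w; rewrite -IHn; congr (wedge_pow _ n w).
  by apply/funext => u; rewrite form2_det.
rewrite wedge_suml; apply: eq_bigr => -[k p] _ /=.
rewrite wedge_det_form; congr (det_form _ v).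
by rewrite !(@mul_col_mx _ 1 n) -!rowE interleave_col.
Qed.

(** Serves for the identity word, whose term in the sum of squares below is 1 and makes the constant
    positive. *)
Lemma pow_sel_surj n (g : 'I_n -> 'I_K) :
  exists p : pow_idx n, pow_sel p = \matrix_i delta_mx 0 (g i).
Proof.
elim: n g => [|n IHn] g.
  by exists tt; apply/matrixP => -[].
have [p pE] := IHn (fun i => g (lift ord0 i)).
exists (g ord0, p) => /=; rewrite pE; apply/matrixP => i j.
have [->|[k ->]] : i = ord0 \/ exists k, i = lift ord0 k.
- by case: (unliftP ord0 i) => [k|] ->; [right; exists k|left].
- rewrite (_ : ord0 = lshift n (0 : 'I_1)); last exact: val_inj.
  by rewrite (@col_mxEu _ 1 n) !mxE; congr (_ && (_ == g _))%:R; exact: val_inj.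
rewrite (_ : lift _ _ = rshift 1 k); last exact: val_inj.
by rewrite (@col_mxEd _ 1 n) !mxE; congr (_ && (_ == g _))%:R; exact: val_inj.
Qed.

End Pow.

(** For a word with selection matrix S, interleaving S X and S Y amounts to multiplying
    [interleave X Y] by a conjugate of diag(S, S), so each monomial contributes det(S)^2 times one
    fixed determinant. [C] is the sum of these squares, in fact n!. *)
Lemma wedge_pow_form1 n m (X Y : 'M[R]_(n, m)) : exists2 C : R, 0 < C &
  forall a v, wedge (wedge_pow (form2 (X^T *m Y - Y^T *m X)) n) (form1 a) v =
    C * det_form (col_mx (interleave X Y) a) v.
Proof.
pose C := \sum_(p : pow_idx n n) \det (pow_sel p) ^+ 2.
exists C => [|a v].
  have [p pE] := @pow_sel_surj n n id.
  rewrite /C (bigD1 p)//= pE ltr_wpDr//.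
    by apply: sumr_ge0 => i _; rewrite sqr_ge0.
  rewrite (_ : \matrix_i _ = 1%:M) ?det1 ?expr1n//.
  by apply/matrixP => i j; rewrite !mxE eq_sym.
have -> : wedge_pow (form2 (X^T *m Y - Y^T *m X)) n = fun w =>
    \sum_(p : pow_idx n n) det_form (interleave (pow_sel p *m X) (pow_sel p *m Y)) w.
  by apply/funext => w; exact: interleave_wedge.
have -> : form1 a = fun w => \sum_(i : unit) det_form a w.
  apply/funext => w; rewrite (bigD1 tt)//= big1 ?addr0 => [|[]//].
  rewrite /det_form det_mx11 /form1 !mxE; apply: eq_bigr => x _.
  by rewrite !mxE mulrC.
rewrite wedge_suml; transitivity (\sum_(p : pow_idx n n) \sum_(u : unit)
    wedge (det_form (interleave (pow_sel p *m X) (pow_sel p *m Y))) (det_form a) v).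
  by rewrite pair_bigA.
rewrite /C mulr_suml; apply: eq_bigr => p _.
rewrite (bigD1 tt)//= big1 ?addr0 => [|[]//].
rewrite wedge_det_form /det_form.
set L := interleave_mx n.
have nn : (n * 2 = n + n)%N by rewrite muln2 addnn.
have LL := @interleave_mx_orth n.
pose D := block_mx (pow_sel p) 0 0 (pow_sel p).
have [dD L'L] := det_conj_rect nn D LL.
have -> : interleave (pow_sel p *m X) (pow_sel p *m Y) =
    (L *m D *m L^T) *m interleave X Y.
  rewrite !interleaveE -/L -!mulmxA (mulmxA L^T) L'L mul1mx; congr (_ *m _).
  by rewrite /D mul_block_col !mul0mx addr0 add0r.
have -> : col_mx (L *m D *m L^T *m interleave X Y) a =
    block_mx (L *m D *m L^T) 0 0 1%:M *m col_mx (interleave X Y) a.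
  by rewrite mul_block_col !mul0mx addr0 add0r mul1mx.
by rewrite -mulmxA det_mulmx det_ublock dD det_ublock det1 mulr1 expr2.
Qed.

End WedgeForms.

(** * Nondegenerate pairs in odd dimension *)

Section Skew.
Context {R : realType}.

Lemma skew_quad m (A : 'M[R]_m) (u : 'rV[R]_m) : A^T = - A -> u *m A *m u^T = 0.
Proof.
move=> As; have : (u *m A *m u^T)^T = - (u *m A *m u^T).
  by rewrite !trmx_mul trmxK As mulNmx mulmxN mulmxA.
move=> /matrixP /(_ 0 0); rewrite !mxE => H.
apply/matrixP => i j; rewrite !ord1 [in RHS]mxE; move: H; rewrite mxE.
by lra.
Qed.

(** One pair (x, y) is split off at each step: a nonzero entry at (i, j) yields a nondegenerate
    block of size 2, and removing it lowers the rank by two. *)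
Lemma skew_decomp n m (A : 'M[R]_m) : A^T = - A -> (\rank A <= n * 2)%N ->
  exists X Y : 'M[R]_(n, m), A = X^T *m Y - Y^T *m X.
Proof.
elim: n A => [|n IHn] A As rA.
  exists 0, 0; rewrite !mulmx0 subr0; apply/eqP.
  by rewrite -mxrank_eq0 -leqn0.
have [A0|[i [j Aij]]] : A = 0 \/ exists i j, A i j != 0.
- have [/existsP[i /existsP[j Aij]]|H] := boolP [exists i, [exists j, A i j != 0]].
    by right; exists i, j.
  left; apply/matrixP => i j; rewrite mxE; apply/eqP/negPn.
  by move: H; rewrite negb_exists => /forallP/(_ i); rewrite negb_exists => /forallP/(_ j).
- by exists 0, 0; rewrite !mulmx0 subr0.
set a := A i j in Aij.
have Asw k l : A k l = - A l k by move/matrixP : As => /(_ l k); rewrite !mxE.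
have Add k : A k k = 0 by have := Asw k k; lra.
(* With this scaling x^T y - y^T x has the same rows [i] and [j] as [A]. *)
pose x := row j A; pose y := - a^-1 *: row i A.
pose A' := A - (x^T *m y - y^T *m x).
have A's : A'^T = - A'.
  rewrite /A' !linearB/= !trmx_mul !trmxK As.
  move: (x^T *m y) (y^T *m x) => P Q.
  by apply/matrixP => k l; rewrite !mxE; ring.
pose B : 'M[R]_(2, m) := col_mx (delta_mx 0 i : 'rV_m) (delta_mx 0 j : 'rV_m).
have BA' : A' *m B^T = 0.
  rewrite -[LHS]trmxK trmx_mul trmxK A's mulmxN; apply/eqP; rewrite trmx_eq0 oppr_eq0.
  rewrite /B (@mul_col_mx _ 1 1) -!rowE; apply/eqP/matrixP => k l; rewrite [RHS]mxE.
  have E k' : (k' == i) || (k' == j) -> row k' A' = 0.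
    move=> kE; apply/rowP => l'; rewrite !mxE !big_ord1 !mxE.
    case/orP : kE => /eqP ->; rewrite Add.
      by rewrite mulr0 mul0r subr0 (Asw j i) -/a; field.
    by rewrite !mul0r sub0r -/a; field.
  case: (fintype.split_ordP (k : 'I_(1 + 1))) => q ->; rewrite ord1.
    by rewrite (@col_mxEu _ 1 1) E ?eqxx// mxE.
  by rewrite (@col_mxEd _ 1 1) E ?eqxx ?orbT// mxE.
have A'A : (A' <= A)%MS.
  rewrite /A' addmx_sub ?submx_refl// opprB addmx_sub//.
    by rewrite (submx_trans (submxMl _ _))// row_sub.
  rewrite -mulmxN (submx_trans (submxMl _ _))// /y scaleNr opprK.
  by rewrite scalemx_sub// row_sub.
(* The minor of [A] on the indices i, j is a^2. The row space of [A'] lies in that of [A] and is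
   killed by [B^T], so it is smaller by at least two dimensions. *)
have rAB : (2 <= \rank (A *m B^T))%N.
  have E : \rank (B *m (A *m B^T)) = 2%N.
    apply: mxrank_unit; rewrite unitmxE (expand_det_row _ ord0) !big_ord_recl big_ord0 addr0.
    rewrite /cofactor !det_mx11.
    have BE k l : (B *m (A *m B^T)) k l =
        A (if k == 0 then i else j) (if l == 0 then i else j).
      rewrite mulmxA.
      have Brow (q : 'I_2) : row q B = delta_mx 0 (if q == 0 then i else j).
        apply/rowP => z; rewrite mxE /B.
        case: (fintype.split_ordP (q : 'I_(1 + 1))) => s ->; rewrite ord1.
          by rewrite (@col_mxEu _ 1 1).
        by rewrite (@col_mxEd _ 1 1).
      transitivity ((row k B *m A *m (row l B)^T) 0 0).
        by rewrite -!row_mul !mxE; apply: eq_bigr => z _; rewrite !mxE.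
      by rewrite !Brow trmx_delta -rowE -colE !mxE.
    move: (B *m _) BE => M BE; rewrite !mxE !BE /= Add mul0r add0r /bump/= addn0 expr1.
    rewrite (Asw j i) -/a mulN1r opprK unitfE.
    by rewrite mulf_neq0.
  by have := mxrankM_maxr B (A *m B^T); rewrite E.
have rA' : (\rank A' <= n * 2)%N.
  have := mxrank_mul_ker A B^T.
  have : (A' <= A :&: kermx B^T)%MS by rewrite sub_capmx A'A; apply/sub_kermxP.
  move=> /mxrankS h1 h2.
  rewrite -(leq_add2l 2); apply: leq_trans rA; rewrite -h2.
  exact: leq_add.
have [X [Y XY]] := IHn _ A's rA'.
exists (col_mx x X), (col_mx y Y).
rewrite !(@tr_col_mx _ 1 n) !(@mul_row_col _ _ 1 n) opprD addrACA -XY /A'.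
by rewrite addrC subrK.
Qed.

(** Transposition gives det A = (-1)^(2n+1) det A, so the determinant vanishes. *)
Lemma skew_odd_rank n (A : 'M[R]_(n * 2 + 1)) : A^T = - A -> (\rank A <= n * 2)%N.
Proof.
move=> As; have : ~~ (A \in unitmx).
  rewrite unitmxE unitfE negbK; have /eqP := congr1 determinant As.
  rewrite det_tr -scaleN1r detZ -signr_odd oddD oddM andbF/= expr1 mulN1r.
  by rewrite -subr_eq0 opprK -mulr2n mulrn_eq0.
rewrite -row_free_unit /row_free => rA.
have := rank_leq_row A; rewrite leq_eqVlt (negbTE rA)/=.
by move: (\rank A) => r; rewrite addn1 ltnS.
Qed.

Definition nondeg m (A : 'M[R]_m) (a : 'rV[R]_m) :=
  forall u : 'rV[R]_m, u *m A = 0 -> u *m a^T = 0 -> u = 0.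

Lemma rows_delta m : rows (fun i : 'I_m => delta_mx 0 i : 'rV[R]_m) = 1%:M.
Proof. by apply/row_matrixP => i; rewrite rowK row1. Qed.

Definition volume n m (A : 'M[R]_m) (a : 'rV[R]_m) (v : 'I_(n * 2 + 1) -> 'rV[R]_m) :=
  wedge (wedge_pow (form2 A) n) (form1 a) v.

Section OddDim.
Variables (n m : nat) (e : (n * 2 + 1)%N = m) (A : 'M[R]_m).
Hypothesis As : A^T = - A.

(** The rows of [Z] are x_1, y_1, ..., x_n, y_n; [J] is the standard symplectic matrix in that order
    and [J'] its inverse. The kernel of [A] and the volume can then both be studied through [Z]. *)
Lemma volumeE : exists (Z : 'M[R]_(n * 2, m)) (J J' : 'M[R]_(n * 2)) (C : R),
  [/\ 0 < C, A = Z^T *m J *m Z, J *m J' = 1%:M &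
   forall a v, volume (n := n) A a v = C * det_form (col_mx Z a) v].
Proof.
have rA : (\rank A <= n * 2)%N by subst m; exact: skew_odd_rank.
have [X [Y AE]] := skew_decomp As rA.
have [C C0 CE] := wedge_pow_form1 X Y.
pose L := interleave_mx n : 'M[R]_(n * 2, n + n).
have nn : (n * 2 = n + n)%N by rewrite muln2 addnn.
have LL := @interleave_mx_orth R n.
have [_ L'L] := det_conj_rect nn (1%:M : 'M[R]_(n + n)) LL.
pose J0 : 'M[R]_(n + n) := block_mx 0 1%:M (- 1%:M) 0.
have J0J : J0 *m - J0 = 1%:M.
  rewrite mulmxN /J0 mulmx_block !mul0mx !mulmx0 !add0r !addr0 mul1mx mulmx1.
  by rewrite opp_block_mx !oppr0 opprK -scalar_mx_block.
have XY : col_mx X Y = L^T *m interleave X Y.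
  by rewrite interleaveE mulmxA L'L mul1mx.
exists (interleave X Y), (L *m J0 *m L^T), (L *m - J0 *m L^T), C; split=> //.
- rewrite {1}AE; transitivity ((col_mx X Y)^T *m J0 *m col_mx X Y).
    rewrite tr_col_mx mul_row_block !mulmx0 mulmx1 mulmxN mulmx1 add0r addr0.
    by rewrite mul_row_col addrC mulNmx.
  by rewrite XY trmx_mul trmxK !mulmxA.
- rewrite -!mulmxA (mulmxA L^T) L'L mul1mx (mulmxA J0) J0J mul1mx.
  exact: LL.
- by move=> a v; rewrite /volume AE CE.
Qed.

Lemma det_formM m' k (Z : 'M[R]_(k, m')) (D : 'M[R]_k) (v w : 'I_k -> 'rV[R]_m') :
  rows w = D *m rows v -> det_form Z w = \det D * det_form Z v.
Proof.
by move=> wE; rewrite /det_form wE trmx_mul mulmxA det_mulmx mulrC det_tr.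
Qed.

(** A nonzero value makes (Z; a) invertible; then [u *m A = 0] forces [u *m Z^T = 0], and [u] is
    killed by the whole transposed matrix. Conversely, a vector killed by (Z; a)^T lies in both
    kernels. *)
Lemma volume_nondeg (a : 'rV[R]_m) : (exists v, volume (n := n) A a v != 0) <-> nondeg A a.
Proof.
have [Z [J [J' [C [C0 AE JJ VE]]]]] := volumeE.
subst m.
have dE v : volume (n := n) A a v = C * (\det (col_mx Z a) * \det (rows v)^T).
  by rewrite VE /det_form det_mulmx.
split=> [[v]|nd].
  rewrite dE mulf_eq0 negb_or mulf_eq0 negb_or => /andP[_ /andP[M0 _]] u uA ua.
  have Mu : col_mx Z a \in unitmx by rewrite unitmxE unitfE.
  have Zf : row_free Z.
    have /row_freeP[B MB] : row_free (col_mx Z a) by rewrite row_free_unit.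
    apply/row_freeP; exists (lsubmx B).
    have : ulsubmx (col_mx Z a *m B) = 1%:M by rewrite MB scalar_mx_block block_mxKul.
    by rewrite -{1}[B]hsubmxK mul_col_row block_mxKul.
  have uZ : u *m Z^T = 0.
    have uJ : u *m Z^T *m J = 0.
      by apply: (row_free_inj Zf); rewrite mul0mx -!mulmxA (mulmxA Z^T) -AE.
    by rewrite -[LHS]mulmx1 -JJ mulmxA uJ mul0mx.
  have uM : u *m (col_mx Z a)^T = 0 by rewrite tr_col_mx mul_mx_row uZ ua row_mx0.
  have MTu : (col_mx Z a)^T \in unitmx by rewrite unitmx_tr.
  by rewrite -[u](mulmxK MTu) uM mul0mx.
exists (fun i => delta_mx 0 i); rewrite dE rows_delta trmx1 det1 mulr1.
apply: mulf_neq0; first by rewrite gt_eqF.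
rewrite -unitfE -unitmxE -unitmx_tr -row_free_unit.
apply/row_freeP.
have := mulmx_ker (col_mx Z a)^T; set Kr := kermx _ => Kr0.
suff: Kr = 0.
  move/eqP; rewrite kermx_eq0 => /row_freeP[B H]; by exists B.
apply/row_matrixP => i; rewrite row0; apply: nd.
  have : row i Kr *m (col_mx Z a)^T = 0 by rewrite -row_mul Kr0 row0.
  rewrite tr_col_mx mul_mx_row => /(congr1 lsubmx); rewrite row_mxKl linear0 => H.
  by rewrite AE !mulmxA H !mul0mx.
have : row i Kr *m (col_mx Z a)^T = 0 by rewrite -row_mul Kr0 row0.
by rewrite tr_col_mx mul_mx_row => /(congr1 rsubmx); rewrite row_mxKr linear0.
Qed.

(** The n-th power followed by [eta] takes [n * 2 + 1] vectors, while the manifold has dimension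
    [(2 * n).+1]; indices are cast along [e]. *)
Definition row_cast (P : 'M[R]_m) (i : 'I_(n * 2 + 1)) := row (cast_ord e i) P.

Lemma volume_frame (a : 'rV[R]_m) (P V : 'M[R]_m) :
  volume A a (row_cast (P *m V)) = \det P * volume A a (row_cast V).
Proof.
have [Z [J [J' [C [C0 AE JJ VE]]]]] := volumeE.
rewrite !VE mulrCA; congr (_ * _).
clear - e; rewrite /row_cast; subst m.
apply: det_formM; apply/row_matrixP => i.
by rewrite rowK cast_ord_id !row_mul; congr (_ *m _); apply/row_matrixP => j; rewrite rowK cast_ord_id.
Qed.

Lemma volume_pos (V : 'M[R]_m) : V \in unitmx -> \rank A = (n * 2)%N ->
  exists a, 0 < volume A a (row_cast V).
Proof.
have [Z [J [J' [C [C0 AE JJ VE]]]]] := volumeE.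
move=> Vu rA.
have rZ : \rank Z = (n * 2)%N.
  apply/eqP; rewrite eqn_leq rank_leq_row -{1}rA AE.
  exact: mxrankM_maxr.
(* The rank of [Z] is one less than the dimension, so some coordinate covector lies outside its row
   space. *)
have [i Zi] : exists i, ~~ (row i 1%:M <= Z)%MS.
  apply/row_subPn; apply/negP => /mxrankS; rewrite mxrank1 rZ -e addn1.
  by rewrite ltnn.
pose a : 'rV[R]_m := row i 1%:M.
have rM : \rank (col_mx Z a) = (n * 2 + 1)%N.
  apply/eqP; rewrite eqn_leq rank_leq_row/= [leqLHS]addn1 -[X in (X < _)%N]rZ.
  rewrite -addsmxE; apply: rank_ltmx; rewrite ltmxE addsmxSl/=.
  by apply: contra Zi => /(submx_trans (addsmxSr _ _)).
have d0 : det_form (col_mx Z a) (row_cast V) != 0.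
  move: rM; rewrite /row_cast /det_form; move: a => {rZ Zi VE AE} a.
  clear As rA; move: A Z V Vu a i; subst m => _ Z V Vu a _ rM.
  rewrite det_mulmx; apply: mulf_neq0; rewrite -unitfE -unitmxE; first by rewrite -row_free_unit /row_free rM.
  rewrite unitmx_tr (_ : rows _ = V)//; apply/row_matrixP => j.
  by rewrite rowK cast_ord_id.
(* Scaling [a] by the nonzero determinant it gives turns that determinant into a square. *)
exists (det_form (col_mx Z a) (row_cast V) *: a); rewrite VE pmulr_rgt0//.
set s := det_form _ _ in d0 *.
suff -> : det_form (col_mx Z (s *: a)) (row_cast V) = s * s.
  by rewrite -expr2 exprn_even_gt0.
rewrite {3}/s /det_form.
have -> : col_mx Z (s *: a) = block_mx 1%:M 0 0 s%:M *m col_mx Z a.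
  by rewrite mul_block_col !mul0mx addr0 add0r mul1mx mul_scalar_mx.
by rewrite -mulmxA det_mulmx det_ublock det1 mul1r det_scalar1.
Qed.

End OddDim.

End Skew.

(** * Reeb vectors and tame structures *)

Section Reeb.
Context {R : realType} (n m : nat) (e : (n * 2 + 1)%N = m).
Variables (A : 'M[R]_m) (a : 'rV[R]_m).
Hypotheses (As : A^T = - A) (nd : nondeg A a).

Lemma unit_of_inj (S : 'M[R]_m) :
  (forall u : 'rV[R]_m, u *m S = 0 -> u = 0) -> S \in unitmx.
Proof.
move=> Si; rewrite -row_free_unit -kermx_eq0; apply/eqP/row_matrixP => i.
by rewrite row0; apply: Si; rewrite -row_mul mulmx_ker row0.
Qed.

(** Matrix of v |-> omega(v, .) + eta(v) eta. Defining the Reeb vector as the preimage of [eta]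
    under this isomorphism makes it a rational expression in the entries, hence smooth. *)
Definition reeb_mx : 'M[R]_m := A + a^T *m a.
Definition reeb : 'rV[R]_m := a *m invmx reeb_mx.

Lemma mx11_eq0 (B : 'M[R]_1) : B 0 0 = 0 -> B = 0.
Proof. by move=> B0; apply/matrixP => i j; rewrite !ord1 B0 mxE. Qed.

(** Pairing [u *m reeb_mx = 0] with [u] kills the skew part and leaves eta(u)^2 = 0; then [u] is in
    both kernels. *)
Lemma reeb_mx_unit : reeb_mx \in unitmx.
Proof.
apply: unit_of_inj => u uS.
have ua : u *m a^T = 0.
  have : u *m reeb_mx *m u^T = 0 by rewrite uS mul0mx.
  rewrite mulmxDr mulmxDl skew_quad// add0r !mulmxA -mulmxA.
  rewrite (_ : a *m u^T = (u *m a^T)^T); last by rewrite trmx_mul trmxK.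
  move=> /matrixP/(_ 0 0); rewrite mxE big_ord1 !mxE => /eqP.
  rewrite mulf_eq0 orbb => /eqP ua; apply: mx11_eq0.
  by rewrite -[RHS]ua !mxE.
by apply: nd => //; move: uS; rewrite mulmxDr mulmxA ua mul0mx addr0.
Qed.

Lemma skew_odd_ker : exists2 u : 'rV[R]_m, u != 0 & u *m A = 0.
Proof.
have rA : (\rank A < m)%N.
  by clear nd; subst m; rewrite [ltnRHS]addn1 ltnS; exact: skew_odd_rank.
have : kermx A != 0 by rewrite kermx_eq0 /row_free neq_ltn rA.
move=> /rowV0Pn[u /sub_kermxP uA u0]; by exists u.
Qed.

(** The dimension being odd, [A] kills some nonzero [u]. Nondegeneracy makes [u *m a^T] nonzero, and
    the normalised [u] is sent to [a] by [reeb_mx], so it is the Reeb vector. *)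
Lemma reeb_spec : [/\ a *m reeb^T = 1%:M, reeb *m A = 0, A *m reeb^T = 0,
  reeb *m reeb_mx = a & reeb_mx *m reeb^T = a^T].
Proof.
have Su := reeb_mx_unit.
have [u u0 uA] := skew_odd_ker.
have ua : (u *m a^T) 0 0 != 0.
  by apply: contra u0 => /eqP ua; apply/eqP/nd => //; exact: mx11_eq0.
set c := (u *m a^T) 0 0 in ua.
have uac : u *m a^T = c%:M by rewrite [LHS]mx11_scalar.
have uE : reeb = c^-1 *: u.
  have uS : u *m reeb_mx = c *: a by rewrite mulmxDr uA add0r mulmxA uac mul_scalar_mx.
  by rewrite /reeb -[u](mulmxK Su) uS -scalemxAl scalerA mulVf ?scale1r.
have rA : reeb *m A = 0 by rewrite uE -scalemxAl uA scaler0.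
have ra : reeb *m a^T = 1%:M.
  by rewrite uE -scalemxAl uac scale_scalar_mx mulVf.
have ar : a *m reeb^T = 1%:M by rewrite -[LHS]trmxK trmx_mul trmxK ra trmx1.
have Ar : A *m reeb^T = 0.
  by apply/eqP; rewrite -oppr_eq0 -mulNmx -As -trmx_mul rA trmx0.
split=> //; first by rewrite /reeb mulmxKV.
by rewrite mulmxDl Ar add0r -mulmxA ar mulmx1.
Qed.

Lemma reeb_unique (u : 'rV[R]_m) : u *m A = 0 -> u *m a^T = 1%:M -> u = reeb.
Proof.
move=> uA ua; have [ar rA _ _ _] := reeb_spec.
apply/eqP; rewrite -subr_eq0; apply/eqP/nd; rewrite mulmxBl ?uA ?rA ?subrr//.
by rewrite ua -[X in _ - X]trmxK trmx_mul trmxK ar trmx1 subrr.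
Qed.

(** [reeb_mx] has full rank and differs from [A] by a matrix of rank at most 1. *)
Lemma nondeg_rank : \rank A = (n * 2)%N.
Proof.
apply/eqP; rewrite eqn_leq; apply/andP; split.
  by clear nd; subst m; exact: skew_odd_rank.
have : \rank (reeb_mx) = m by exact/mxrank_unit/reeb_mx_unit.
move=> H; rewrite -(leq_add2r 1) e -[leqLHS]H.
apply: leq_trans (mxrank_add _ _) _; rewrite leq_add2l.
by apply: leq_trans (mxrankM_maxr _ _) _; rewrite rank_leq_row.
Qed.

Definition skew_pinv : 'M[R]_m := invmx reeb_mx - reeb^T *m reeb.

Lemma skew_pinvP : skew_pinv *m A = 1%:M - reeb^T *m a /\
  A *m skew_pinv^T = - (1%:M - a^T *m reeb).
Proof.
have [ar rA Ar rS Sr] := reeb_spec; have Su := reeb_mx_unit.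
have E : skew_pinv *m A = 1%:M - reeb^T *m a.
  rewrite mulmxBl -(mulmxA _ reeb) rA mulmx0 subr0.
  have -> : A = reeb_mx - a^T *m a by rewrite /reeb_mx addrK.
  rewrite mulmxBr mulVmx// mulmxA; congr (_ - _ *m _).
  by rewrite -Sr mulmxA mulVmx// mul1mx.
split=> //; rewrite -[LHS]trmxK trmx_mul trmxK As mulmxN E.
by rewrite linearN/= linearB/= trmx1 trmx_mul trmxK.
Qed.

(* Solving dA = G A + A G^T on a complement of the kernel gives the first term;
   the second one accounts for the motion of the kernel. *)
Definition parallel_gamma (dA : 'M[R]_m) (dr : 'rV[R]_m) : 'M[R]_m :=
  2^-1 *: (dA *m skew_pinv - a^T *m dr).

(** The hypotheses are the derivatives of [A^T = - A] and [reeb *m A = 0]. Each of the two products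
    gives half of [dA] up to multiples of [A *m dr^T *m a] and [a^T *m dr *m A], which have opposite
    signs in the two products. *)
Lemma parallel_gammaP (dA : 'M[R]_m) (dr : 'rV[R]_m) : dA^T = - dA ->
  dr *m A + reeb *m dA = 0 ->
  parallel_gamma dA dr *m A + A *m (parallel_gamma dA dr)^T = dA.
Proof.
move=> dAs dr0; have [E1 E2] := skew_pinvP.
have rdA : reeb *m dA = - (dr *m A) by apply/eqP; rewrite -addr_eq0 addrC dr0.
have dAr : dA *m reeb^T = - (A *m dr^T).
  rewrite -[LHS]trmxK trmx_mul trmxK dAs mulmxN rdA opprK trmx_mul As.
  by rewrite mulNmx.
rewrite /parallel_gamma; move: skew_pinv E1 E2 => P E1 E2.
rewrite linearZ/= -scalemxAl -scalemxAr -scalerDr.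
have -> : (dA *m P - a^T *m dr)^T = P^T *m dA^T - dr^T *m a.
  by rewrite linearB/= !trmx_mul trmxK.
rewrite mulmxBl mulmxBr dAs !mulmxN -(mulmxA dA) E1 (mulmxA A P^T) E2.
rewrite mulNmx opprK mulmxBr mulmxBl mulmx1 mul1mx (mulmxA dA) dAr.
rewrite -(mulmxA a^T dr) -(mulmxA a^T reeb) rdA mulmxN mulNmx !opprK -(mulmxA A).
move: (A *m (_ *m _)) (a^T *m _) => M N.
by apply/matrixP => i j; rewrite !mxE; field.
Qed.

End Reeb.

Section Tame.
Context {R : realType} (m : nat).
Implicit Types (A f : 'M[R]_m) (a x u : 'rV[R]_m).

(* Endomorphisms act on row vectors from the right: u |-> u *m f. *)
Definition tame A a x f := [/\ f *m f = - 1%:M + a^T *m x, f *m a^T = 0,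
  x *m f = 0 & forall u, u != 0 -> u *m a^T = 0 -> 0 < (u *m A *m (u *m f)^T) 0 0].

(** In the basis where [A] is the standard symplectic block bordered by zeros, [f] is the standard
    complex structure extended by 0 on the Reeb line; [K] is the change of basis. The last equation
    identifies the metric omega(., f .) + eta^2 with [K *m K^T], which gives tameness together with
    a margin for perturbing [f]. *)
Lemma tame_exists n (e : (n * 2 + 1)%N = m) A a : A^T = - A -> nondeg A a ->
  exists (f K : 'M[R]_m), [/\ K \in unitmx, f *m f = - 1%:M + a^T *m reeb A a,
    f *m a^T = 0, reeb A a *m f = 0 & A *m f^T + a^T *m a = K *m K^T].
Proof.
move=> As nd; have rU := reeb_unique e As nd.
have rA := nondeg_rank e As nd.
have [X [Y AE]] := skew_decomp As (eq_leq rA).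
have e' : (n + n + 1)%N = m by rewrite -e muln2 addnn.
clear e rA; subst m.
pose K := row_mx (row_mx X^T Y^T) a^T : 'M[R]_(n + n + 1).
pose J0 : 'M[R]_(n + n) := block_mx 0 1%:M (- 1%:M) 0.
pose J : 'M[R]_(n + n + 1) := block_mx J0 0 0 0.
pose E : 'M[R]_(n + n + 1) := block_mx 0 0 0 1%:M.
have EE : E = col_mx 0 1%:M *m row_mx 0 1%:M.
  by rewrite mul_col_row !mul0mx !mul1mx.
have J0J : J0 *m J0 = - 1%:M.
  rewrite mulmx_block !mul0mx !mulmx0 !add0r !addr0 mul1mx mulmx1.
  by rewrite -[X in block_mx _ X]oppr0 -[X in block_mx _ _ X]oppr0 -opp_block_mx -scalar_mx_block.
have J0T : J0^T = - J0.
  by rewrite tr_block_mx opp_block_mx !trmx0 linearN/= trmx1 !oppr0 opprK.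
have JJ : J *m J = - 1%:M + E.
  rewrite [in RHS]scalar_mx_block opp_block_mx !oppr0 add_block_mx !addr0 addNr.
  by rewrite mulmx_block !mul0mx !mulmx0 !addr0 J0J.
have JT : J^T = - J by rewrite tr_block_mx opp_block_mx !trmx0 J0T !oppr0.
have AK : A = K *m J *m K^T.
  rewrite AE /K tr_row_mx mul_row_block !mulmx0 !addr0 mul_row_col mul0mx addr0.
  rewrite tr_row_mx !trmxK mul_row_block !mulmx0 add0r addr0 mulmx1 mulmxN mulmx1.
  by rewrite mul_row_col addrC mulNmx.
have aK : a^T = K *m col_mx 0 1%:M by rewrite mul_row_col mulmx0 add0r mulmx1.
have Ku : K \in unitmx.
  rewrite -unitmx_tr; rewrite unitmx_tr -unitmx_tr; rewrite -unitmx_tr trmxK.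
  apply: unit_of_inj => u uK; apply: nd; first by rewrite AK !mulmxA uK !mul0mx.
  by rewrite aK mulmxA uK mul0mx.
have KTu : K^T \in unitmx by rewrite unitmx_tr.
pose f := K *m J *m invmx K.
pose x := row_mx 0 1%:M *m invmx K.
have xr : x = reeb A a.
  apply: rU.
    rewrite AK /x !mulmxA mulmxKV// mul_row_block !mulmx0 !mul0mx !addr0.
    by rewrite row_mx0 mul0mx.
  by rewrite aK /x mulmxA mulmxKV// mul_row_col mul0mx add0r mulmx1.
exists f, K; split=> //; rewrite -?xr.
- rewrite /f !mulmxA mulmxKV// -(mulmxA K J) JJ mulmxDr mulmxDl mulmxN mulmx1 mulNmx mulmxV//.
  by rewrite aK EE !mulmxA.
- rewrite /f aK !mulmxA mulmxKV// -!mulmxA /J mul_block_col !mulmx0 !mul0mx !addr0.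
  by rewrite col_mx0 mulmx0.
- rewrite /f /x !mulmxA mulmxKV// mul_row_block !mulmx0 !mul0mx !addr0.
  by rewrite row_mx0 mul0mx.
have KK : K^T *m (invmx K)^T = 1%:M by rewrite -trmx_mul mulVmx// trmx1.
rewrite {1}AK /f !trmx_mul !mulmxA -(mulmxA _ K^T) KK mulmx1 JT mulmxN -(mulmxA K) JJ.
have aa : a^T *m a = K *m E *m K^T.
  by rewrite -{2}[a]trmxK aK trmx_mul tr_col_mx trmx0 trmx1 EE !mulmxA.
by rewrite aa -mulmxDl -mulmxN -mulmxDr opprD opprK addrNK mulmx1.
Qed.

(** If [u] is killed, applying [a^T] puts [u] in ker eta, where both taming forms are positive off 0
    while their sum omega(u, u f0 + u f1) is 0. *)
Lemma cayley_det_half A a x f0 f1 : A^T = - A -> x *m a^T = 1%:M ->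
  tame A a x f0 -> tame A a x f1 -> f0 + f1 + a^T *m x \in unitmx.
Proof.
move=> As xa [ff0 fa0 xf0 p0] [ff1 fa1 xf1 p1]; apply: unit_of_inj => u uS.
have ua : u *m a^T = 0.
  have : u *m (f0 + f1 + a^T *m x) *m a^T = 0 by rewrite uS mul0mx.
  by rewrite -mulmxA !mulmxDl fa0 fa1 !add0r -mulmxA xa mulmx1.
move: uS; rewrite mulmxDr mulmxA ua mul0mx addr0 mulmxDr => uf.
have [//|u0] := eqVneq u 0.
have := addr_gt0 (p0 u u0 ua) (p1 u u0 ua).
have -> (M N : 'M[R]_1) : M 0 0 + N 0 0 = (M + N) 0 0 by rewrite mxE.
by rewrite -mulmxDr -linearD/= uf trmx0 mulmx0 mxE ltxx.
Qed.

(* W = cayley_mx Pi f0 f1 anticommutes with f0 and (1 + W) f0 = (1 - W) f1, so that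
   conjugating f0 by 1 - t W is a path from f0 to f1. *)
Definition cayley_mx (Pi f0 f1 : 'M[R]_m) : 'M[R]_m := (f1 - f0) *m invmx (f0 + f1 + Pi).

Definition cayley (Pi f0 f1 : 'M[R]_m) (t : R) : 'M[R]_m :=
  invmx (1%:M - t *: cayley_mx Pi f0 f1) *m f0 *m (1%:M - t *: cayley_mx Pi f0 f1).

Section Cayley.
Variables (A : 'M[R]_m) (a x : 'rV[R]_m) (f0 f1 : 'M[R]_m).
Hypotheses (As : A^T = - A) (xa : x *m a^T = 1%:M).
Hypotheses (tf0 : tame A a x f0) (tf1 : tame A a x f1).

Let Pi := a^T *m x.
Let S := f0 + f1 + Pi.
Let W := cayley_mx Pi f0 f1.

Let Su : S \in unitmx. Proof. exact: (cayley_det_half As). Qed.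

(** Both sides are f0 f1 - 1 + Pi: [S] exchanges the two structures. *)
Let f0S : f0 *m S = S *m f1.
Proof.
have [ff0 fa0 xf0 _] := tf0; have [ff1 fa1 xf1 _] := tf1.
rewrite /S /Pi !mulmxDr !mulmxDl ff0 ff1 (mulmxA f0) fa0 mul0mx -(mulmxA _ x) xf1 mulmx0.
by rewrite !addr0 addrC.
Qed.

Let f1S : f1 *m S = S *m f0.
Proof.
have [ff0 fa0 xf0 _] := tf0; have [ff1 fa1 xf1 _] := tf1.
rewrite /S /Pi !mulmxDr !mulmxDl ff0 ff1 (mulmxA f1) fa1 mul0mx -(mulmxA _ x) xf0 mulmx0.
by rewrite !addr0 addrC.
Qed.

Let SVf (g h : 'M[R]_m) : g *m S = S *m h -> invmx S *m g = h *m invmx S.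
Proof. by move=> gS; rewrite -[LHS](mulmxK Su) -(mulmxA _ g) gS mulKmx. Qed.

Let f0W : f0 *m W = - (W *m f0).
Proof.
have [ff0 fa0 xf0 _] := tf0; have [ff1 fa1 xf1 _] := tf1.
rewrite /W /cayley_mx -mulmxA (SVf f0S) !mulmxA -mulNmx; congr (_ *m _).
by rewrite mulmxBr mulmxBl ff0 ff1 opprB.
Qed.

Let Wa : W *m a^T = 0.
Proof.
have [ff0 fa0 xf0 _] := tf0; have [ff1 fa1 xf1 _] := tf1.
have Sa : S *m a^T = a^T.
  by rewrite !mulmxDl fa0 fa1 !add0r -mulmxA xa mulmx1.
have SVa : invmx S *m a^T = a^T by rewrite -{1}Sa mulmxA mulVmx// mul1mx.
by rewrite /W /cayley_mx -mulmxA SVa mulmxBl fa0 fa1 subrr.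
Qed.

Let xW : x *m W = 0.
Proof.
have [_ _ xf0 _] := tf0; have [_ _ xf1 _] := tf1.
by rewrite /W /cayley_mx mulmxA mulmxBr xf0 xf1 subrr mul0mx.
Qed.

Let f0W1 : (1%:M + W) *m f0 = (1%:M - W) *m f1.
Proof.
have [ff0 fa0 xf0 _] := tf0; have [ff1 fa1 xf1 _] := tf1.
have E1 : 1%:M + W = (f1 + f1 + Pi) *m invmx S.
  rewrite -[1%:M](mulmxV Su) /W /cayley_mx -mulmxDl; congr (_ *m _).
  by apply/matrixP => i j; rewrite !mxE; ring.
have E2 : 1%:M - W = (f0 + f0 + Pi) *m invmx S.
  rewrite -[1%:M](mulmxV Su) /W /cayley_mx -mulmxBl; congr (_ *m _).
  by apply/matrixP => i j; rewrite !mxE; ring.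
rewrite E1 E2 -!mulmxA (SVf f0S) (SVf f1S) !mulmxA !mulmxDl.
by rewrite ff0 ff1 /Pi -(mulmxA _ x f1) -(mulmxA _ x f0) xf0 xf1 !mulmx0.
Qed.

(** The taming form of the path at time t, evaluated at u (1 - t W): since f0 (1 - t W) = (1 + t W)
    f0, the inverse in [cayley] disappears. *)
Let quad (t : R) u := (u *m (1%:M - t *: W) *m A *m (u *m (1%:M + t *: W) *m f0)^T) 0 0.

(** The coefficient of t^2 is minus the taming form of [f0] at [u *m W], so [quad] is concave in t.
    At t = 0 and t = 1 it is a value of the taming form of [f0], respectively [f1], at a nonzero
    vector. *)
Let quad_gt0 (t : R) u : 0 <= t <= 1 -> u != 0 -> u *m a^T = 0 -> 0 < quad t u.
Proof.
move=> /andP[t0 t1] u0 ua.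
have [ff0 fa0 xf0 p0] := tf0; have [ff1 fa1 xf1 p1] := tf1.
have q0 : 0 < quad 0 u by rewrite /quad !scale0r subr0 addr0 !mulmx1; exact: p0.
have q1 : 0 < quad 1 u.
  rewrite /quad !scale1r -!mulmxA f0W1 !mulmxA; apply: p1; last first.
    by rewrite -mulmxA mulmxBl Wa subr0 mul1mx.
  apply: contra u0 => /eqP uW.
  have : u *m (1%:M + W) *m f0 = 0 by rewrite -mulmxA f0W1 mulmxA uW mul0mx.
  have uW' : u *m W = u.
    by apply/eqP; rewrite eq_sym -subr_eq0 -[X in X - _]mulmx1 -mulmxBr uW.
  rewrite mulmxDr mulmx1 uW' mulmxDl => w0.
  have uf : u *m f0 = 0.
    move: (u *m f0) w0 => w w0.
    by apply/matrixP => i j; move/matrixP/(_ i j) : w0; rewrite !mxE; lra.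
  apply/eqP.
  have : u *m f0 *m f0 = 0 by rewrite uf mul0mx.
  rewrite -mulmxA ff0 mulmxDr mulmxN mulmx1 mulmxA ua mul0mx addr0 => /eqP.
  by rewrite oppr_eq0 => /eqP.
have c0 : 0 <= (u *m W *m A *m (u *m W *m f0)^T) 0 0.
  have [->|uW0] := eqVneq (u *m W) 0; first by rewrite !mul0mx mxE.
  by apply/ltW/p0 => //; rewrite -mulmxA Wa mulmx0.
set c := (X in 0 <= X) in c0.
have E s : quad s u = (u *m A *m (u *m f0)^T) 0 0 + s * ((u *m A *m (u *m W *m f0)^T) 0 0
    - (u *m W *m A *m (u *m f0)^T) 0 0) - s ^+ 2 * c.
  rewrite /quad mulmxBr mulmxDr mulmx1 -!scalemxAr !mulmxBl !mulmxDl linearD/=.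
  rewrite !mulmxDr -!scalemxAl linearZ/= -!scalemxAr /c.
  move: (u *m A *m (u *m f0)^T) (u *m A *m (u *m W *m f0)^T) (u *m W *m A *m (u *m f0)^T)
    (u *m W *m A *m (u *m W *m f0)^T) => M1 M2 M3 M4.
  by rewrite !mxE; ring.
move: q0 q1; rewrite !E; move: c c0 {E} => c c0; move: ((u *m A *m (u *m W *m f0)^T) 0 0 - (u *m W *m A *m (u *m f0)^T) 0 0) ((u *m A *m (u *m f0)^T) 0 0) => L q q0 q1.
have t' : 0 <= 1 - t by rewrite subr_ge0.
have H1 := mulr_ge0 (mulr_ge0 t0 t') c0.
have [te|tn] := eqVneq t 0; first by rewrite te.
have tp : 0 < t by rewrite lt0r tn.
have H2 := mulr_ge0 t' (ltW q0); have H3 := mulr_gt0 tp q1.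
(* Concavity made explicit: t (1 - t) c plus the chord between the endpoint values. *)
have -> : q + t * L - t ^+ 2 * c = t * (1 - t) * c +
  ((1 - t) * (q + 0 * L - 0 ^+ 2 * c) + t * (q + 1 * L - 1 ^+ 2 * c)) by ring.
by rewrite ltr_wpDl// ltr_wpDl.
Qed.

(** A vector killed by 1 - t W lies in ker eta and would make [quad] vanish. *)
Lemma cayley_unit (t : R) : 0 <= t <= 1 -> 1%:M - t *: W \in unitmx.
Proof.
move=> t01; apply: unit_of_inj => u uW.
have ua : u *m a^T = 0.
  have : u *m (1%:M - t *: W) *m a^T = 0 by rewrite uW mul0mx.
  by rewrite -mulmxA mulmxBl -scalemxAl Wa scaler0 subr0 mul1mx.
have [//|u0] := eqVneq u 0; have := quad_gt0 t01 u0 ua.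
by rewrite /quad uW !mul0mx mxE ltxx.
Qed.

Lemma cayley_tame (t : R) : 0 <= t <= 1 -> tame A a x (cayley Pi f0 f1 t).
Proof.
move=> t01; have Tu := cayley_unit t01; set T := 1%:M - t *: W in Tu.
have [ff0 fa0 xf0 p0] := tf0; have [ff1 fa1 xf1 p1] := tf1.
have Ta : T *m a^T = a^T by rewrite mulmxBl -scalemxAl Wa scaler0 subr0 mul1mx.
have xT : x *m T = x by rewrite mulmxBr -scalemxAr xW scaler0 subr0 mulmx1.
have TVa : invmx T *m a^T = a^T by rewrite -{1}Ta mulmxA mulVmx// mul1mx.
have xTV : x *m invmx T = x by rewrite -{1}xT mulmxK.
have cE : cayley Pi f0 f1 t = invmx T *m f0 *m T by [].
have fT : f0 *m T = (1%:M + t *: W) *m f0.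
  by rewrite mulmxBr mulmxDl mulmx1 mul1mx -scalemxAl -scalemxAr f0W scalerN opprK.
have qT u : u != 0 -> u *m a^T = 0 -> 0 < (u *m T *m A *m (u *m (f0 *m T))^T) 0 0.
  by move=> u0 ua; have := quad_gt0 t01 u0 ua; rewrite fT /quad !mulmxA.
rewrite cE; clearbody T; split.
- rewrite !mulmxA mulmxK// -(mulmxA (invmx T)) ff0 mulmxDr mulmxDl mulmxN mulmx1 mulNmx mulVmx//.
  by rewrite !mulmxA TVa -mulmxA xT.
- by rewrite -!mulmxA Ta fa0 mulmx0.
- by rewrite !mulmxA xTV xf0 mul0mx.
move=> w w0 wa; pose u := w *m invmx T.
have wE : w = u *m T by rewrite mulmxKV.
have u0 : u != 0 by apply: contra w0 => /eqP u0; rewrite wE u0 mul0mx.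
have ua : u *m a^T = 0 by rewrite -mulmxA TVa.
have := qT u u0 ua; rewrite -wE.
by rewrite -(mulmxA (invmx T)) (mulmxA w (invmx T)).
Qed.

Lemma cayley0 : cayley Pi f0 f1 0 = f0.
Proof. by rewrite /cayley scale0r subr0 invmx1 mul1mx mulmx1. Qed.

Lemma cayley1 : cayley Pi f0 f1 1 = f1.
Proof.
have := @cayley_unit 1; rewrite lexx ler01 scale1r => /(_ isT) Wu.
rewrite /cayley scale1r -/W -mulmxA.
have -> : f0 *m (1%:M - W) = (1%:M + W) *m f0.
  by rewrite mulmxBr mulmx1 f0W opprK mulmxDl mul1mx.
by rewrite f0W1 mulKmx.
Qed.

End Cayley.

(* Sup-norm closeness to the identity is enough, since |u_i u_j| is at most
   (u_i^2 + u_j^2) / 2. *)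
Lemma near1_posdef (N : 'M[R]_m) (u : 'rV[R]_m) :
  (forall i j, `|N i j - (i == j)%:R| * m%:R < 1) -> u != 0 ->
  0 < (u *m N *m u^T) 0 0.
Proof.
move=> N1 u0.
have m0 : (0 < m)%N.
  rewrite lt0n; apply: contra u0 => /eqP m0; apply/eqP/rowP => -[j jm].
  by exfalso; rewrite m0 in jm.
have mR : 0 < m%:R :> R by rewrite ltr0n.
have [i ui] : exists i, u 0 i != 0.
  apply/existsP; apply: contraNT u0; rewrite negb_exists => /forallP ui.
  by apply/eqP/rowP => j; have := ui j; rewrite negbK => /eqP ->; rewrite mxE.
pose e := \big[Order.max/0]_(p : 'I_m * 'I_m) `|N p.1 p.2 - (p.1 == p.2)%:R|.
have e0 : 0 <= e by apply: bigmax_ge_id.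
have e1 : e * m%:R < 1.
  rewrite -ltr_pdivlMr// mul1r; apply: bigmax_lt; first by rewrite invr_gt0.
  by move=> p _; rewrite -[_^-1]mul1r ltr_pdivlMr.
have eN k l : `|N k l - (k == l)%:R| <= e by exact: (le_bigmax _ _ (k, l)).
pose q := \sum_j u 0 j ^+ 2.
have q0 : 0 < q.
  rewrite /q (bigD1 i)//= ltr_pwDl ?exprn_even_gt0 ?orbT//.
  by apply: sumr_ge0 => j _; rewrite sqr_ge0.
have -> : (u *m N *m u^T) 0 0 = q + \sum_j \sum_k u 0 k * (N k j - (k == j)%:R) * u 0 j.
  rewrite /q -big_split/= mxE; apply: eq_bigr => j _; rewrite !mxE mulr_suml.
  have -> : u 0 j ^+ 2 = \sum_k u 0 k * (k == j)%:R * u 0 j.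
    rewrite (bigD1 j)//= eqxx mulr1 expr2 big1 ?addr0// => k /negbTE ->.
    by rewrite mulr0 mul0r.
  by rewrite -big_split/=; apply: eq_bigr => k _; ring.
have H : `|\sum_j \sum_k u 0 k * (N k j - (k == j)%:R) * u 0 j| <= e * m%:R * q.
  apply: (@le_trans _ _ (\sum_j \sum_k (e / 2 * (u 0 k ^+ 2 + u 0 j ^+ 2)))).
    apply: le_trans (ler_norm_sum _ _ _) _; apply: ler_sum => j _.
    apply: le_trans (ler_norm_sum _ _ _) _; apply: ler_sum => k _.
    rewrite !normrM mulrAC mulrC.
    have h1 : `|u 0 k| * `|u 0 j| <= 2^-1 * (u 0 k ^+ 2 + u 0 j ^+ 2).
      rewrite -(real_normK (num_real (u 0 k))) -(real_normK (num_real (u 0 j))).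
      move: `|u 0 k| `|u 0 j| => s t; have := sqr_ge0 (s - t); rewrite sqrrB; lra.
    rewrite -mulrA; apply: ler_pM => //; exact: mulr_ge0.
  under eq_bigr => j _ do rewrite -mulr_sumr big_split/= sumr_const card_ord.
  rewrite -mulr_sumr big_split/= sumr_const card_ord -sumrMnl.
  have -> : \sum_(j < m) u 0 j ^+ 2 *+ m = q * m%:R.
    by rewrite /q mulr_suml; apply: eq_bigr => j _; rewrite mulr_natr.
  by rewrite le_eqVlt; apply/orP; left; apply/eqP; field.
have := ler_norm (- \sum_j \sum_k u 0 k * (N k j - (k == j)%:R) * u 0 j).
rewrite normrN => H'; have := le_trans H' H.
have : e * m%:R * q < q by rewrite gtr_pMl.
lra.
Qed.

End Tame.

(** * Germs of smooth maps between normed spaces *)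

Section SmoothAt.
Context {R : realType}.
Implicit Types V W : normedModType R.

(** One neighbourhood serves all orders of differentiability, so that smoothness at [x] persists at
    nearby points and finitely many germs share a neighbourhood. *)
Definition smooth_at V W (f : V -> W) (x : V) :=
  exists U : set V, [/\ open U, U x & smooth_on U f].

Lemma smooth_at_eq V W (f g : V -> W) x :
  (\forall y \near x, f y = g y) -> smooth_at f x -> smooth_at g x.
Proof.
move=> fg [U [oU Ux fU]].
exists (U `&` [set y | f y = g y]°); split.
- by apply: openI => //; exact: open_interior.
- by split=> //; rewrite /interior.
- move=> k; apply: (class_C_eq _ _ (class_C_sub _ (fU k))).
  + by apply: openI => //; exact: open_interior.
  + by move=> y [_ /interior_subset].
  + by move=> y [].
Qed.

Lemma smooth_at_near V W (f : V -> W) x :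
  smooth_at f x -> \forall y \near x, smooth_at f y.
Proof.
move=> [U [oU Ux fU]]; near=> y; exists U; split=> //.
near: y; exact: open_nbhs_nbhs.
Unshelve. all: by end_near. Qed.

Lemma smooth_at_differentiable V W (f : V -> W) x :
  smooth_at f x -> differentiable f x.
Proof. by move=> [U [oU Ux /(_ 1%N)[fd _]]]; exact: fd. Qed.

Lemma smooth_at_derive V W (f : V -> W) v x :
  smooth_at f x -> smooth_at ('D_v f) x.
Proof.
by move=> [U [oU Ux fU]]; exists U; split=> // k; have [_ /(_ v)] := fU k.+1.
Qed.

Lemma smooth_at_cst V W (a : W) (x : V) : smooth_at (fun=> a) x.
Proof. by exists setT; split=> //; [exact: openT|move=> k; exact: class_C_cst]. Qed.

Lemma smooth_at_op2 V W1 W2 W (op : (V -> W1) -> (V -> W2) -> (V -> W)) f g x :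
  (forall k (U : set V), open U -> class_C k U f -> class_C k U g -> class_C k U (op f g)) ->
  smooth_at f x -> smooth_at g x -> smooth_at (op f g) x.
Proof.
move=> H [U [oU Ux fU]] [D [oD Ox gO]]; exists (U `&` D).
have oUO : open (U `&` D) by exact: openI.
split=> // k; apply: H => //.
- by apply: class_C_sub (fU k) => y [].
- by apply: class_C_sub (gO k) => y [].
Qed.

Lemma smooth_atD V W (f g : V -> W) x : smooth_at f x -> smooth_at g x ->
  smooth_at (fun y => f y + g y) x.
Proof.
by apply: (@smooth_at_op2 _ _ _ _ (fun f g y => f y + g y)) => k U; exact: class_CD.
Qed.

Lemma smooth_atM V (f g : V -> R^o) x : smooth_at f x -> smooth_at g x ->
  smooth_at (fun y => f y * g y : R^o) x.
Proof.
by apply: (@smooth_at_op2 V R^o R^o R^o (fun f g y => f y * g y : R^o)) => k U; exact: class_CM.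
Qed.

Lemma smooth_atV V (f : V -> R^o) x : f x != 0 -> smooth_at f x ->
  smooth_at (fun y => (f y)^-1 : R^o) x.
Proof.
move=> fx0 fs; have fc := differentiable_continuous (smooth_at_differentiable fs).
have [U [oU Ux fU]] := fs.
have f0 : nbhs x [set y | f y != 0].
  have := fc [set r : R^o | r != 0]; apply.
  by apply: open_nbhs_nbhs; split=> //; exact: open_neq.
exists (U `&` [set y | f y != 0]°).
have oUO : open (U `&` [set y | f y != 0]°) by apply: openI => //; exact: open_interior.
split=> // k; apply: class_CV => //.
  by move=> y [_ /interior_subset].
by apply: class_C_sub (fU k) => y [].
Qed.

Lemma smooth_at_sum V W (I : Type) (r : seq I) (F : I -> V -> W) x :
  (forall i, smooth_at (F i) x) -> smooth_at (fun y => \sum_(i <- r) F i y) x.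
Proof.
move=> Fs; elim: r => [|i r IHr].
  by apply: smooth_at_eq (smooth_at_cst 0 x); near=> y; rewrite big_nil.
by apply: smooth_at_eq (smooth_atD (Fs i) IHr); near=> y; rewrite big_cons.
Unshelve. all: by end_near. Qed.

Lemma smooth_at_comp V n (g : 'rV[R]_n -> R^o) (f : V -> 'rV[R]_n) x :
  smooth_at g (f x) -> smooth_at f x -> smooth_at (g \o f) x.
Proof.
move=> [D [oD Ox gO]] fs; have fc := differentiable_continuous (smooth_at_differentiable fs).
have [U [oU Ux fU]] := fs.
have fO : nbhs x [set y | D (f y)] by have := fc D; apply; exact: open_nbhs_nbhs.
exists (U `&` [set y | D (f y)]°).
have oUO : open (U `&` [set y | D (f y)]°) by apply: openI => //; exact: open_interior.
split=> // k; apply: (class_C_comp _ oD _ (gO k)) => //.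
  by move=> y [_ /interior_subset].
by apply: class_C_sub (fU k) => y [].
Qed.

Lemma smooth_at_comp1 V (g : R^o -> R^o) (f : V -> R^o) x :
  (forall k, class_C k setT g) -> smooth_at f x -> smooth_at (g \o f) x.
Proof.
move=> gC [U [oU Ux fU]]; exists U; split=> // k.
exact: (class_C_comp1 oU openT _ (gC k)).
Qed.

Lemma smooth_at_mxP V a b (f : V -> 'M[R]_(a, b)) x :
  smooth_at f x <-> forall i j, smooth_at (fun y => f y i j : R^o) x.
Proof.
split=> [[U [oU Ux fU]] i j|fs].
  by exists U; split=> // k; exact: class_C_coord.
have [U HU] : {U : 'I_a -> 'I_b -> set V & forall i j,
    [/\ open (U i j), U i j x & smooth_on (U i j) (fun y => f y i j : R^o)]}.
  exists (fun i j => projT1 (cid (fs i j))) => i j.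
  exact: (projT2 (cid (fs i j))).
pose D : set V := [set y | forall i j, U i j y]°.
have oD : open D by exact: open_interior.
exists D; split=> //.
- rewrite /D /interior/=; apply: filter_forall => i; apply: filter_forall => j.
  by have [oU Ux _] := HU i j; exact: open_nbhs_nbhs.
- move=> k; apply: class_C_mx => // i j; have [_ _ /(_ k)] := HU i j.
  by apply: class_C_sub => y /interior_subset; apply.
Qed.

Lemma smooth_onP V W (U : set V) (f : V -> W) : open U ->
  smooth_on U f <-> forall x, U x -> smooth_at f x.
Proof.
move=> oU; split=> [fU x Ux|fs k]; first by exists U.
by apply: class_C_union => x /fs[D [oD Dx fD]]; exists D.
Qed.

End SmoothAt.

(** * Smooth germs and charts *)

Section ChartTopology.
Context {R : realType} {m : nat} {T : topologicalType}.
Implicit Types c : chart R m T.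

Lemma chart_mapVK c x : (c @` chart_dom c) x -> c (chart_inv c x) = x.
Proof. by move=> [p cp <-]; rewrite chart_mapK. Qed.

Lemma chart_dom_near c p : chart_dom c p -> \forall q \near p, chart_dom c q.
Proof. by move=> cp; apply: open_nbhs_nbhs; split=> //; exact: chart_dom_open. Qed.

Lemma chart_cod_near c p : chart_dom c p ->
  \forall x \near c p, (c @` chart_dom c) x.
Proof.
move=> cp; apply: open_nbhs_nbhs; split; first exact: chart_cod_open.
by exists p.
Qed.

Lemma chart_near_inv c p (P : T -> Prop) : chart_dom c p ->
  (\forall q \near p, P q) -> \forall x \near c p, P (chart_inv c x).
Proof.
move=> cp Pp; have /(@chart_inv_continuous _ _ _ c) : (c @` chart_dom c) (c p) by exists p.
by move=> /(_ P); apply; rewrite chart_mapK.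
Qed.

Lemma chart_near_inv_cod c p (P : T -> Prop) : chart_dom c p ->
  (\forall q \near p, P q) ->
  \forall x \near c p, P (chart_inv c x) /\ (c @` chart_dom c) x.
Proof.
move=> cp Pp; near=> x; split; near: x; first exact: (chart_near_inv cp Pp).
exact: chart_cod_near.
Unshelve. all: by end_near. Qed.

Lemma chart_near_map c p (P : 'rV[R]_m -> Prop) : chart_dom c p ->
  (\forall x \near c p, P x) -> \forall q \near p, P (c q).
Proof. by move=> cp Pp; have := chart_map_continuous cp => /(_ P); apply. Qed.

Lemma chart_near_map_dom c p (P : 'rV[R]_m -> Prop) : chart_dom c p ->
  (\forall x \near c p, P x) -> \forall q \near p, P (c q) /\ chart_dom c q.
Proof.
move=> cp Pp; near=> q; split; near: q; first exact: (chart_near_map cp Pp).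
exact: chart_dom_near.
Unshelve. all: by end_near. Qed.

End ChartTopology.

Section Germs.
Context {R : realType} {m : nat} {M : smooth_manifold R m}.
Implicit Types (c : chart R m M) (p q : M) (F G : M -> R).

(** Charts compatible with the atlas but possibly outside it. The charts of the oriented family in
    [orientable] are of this kind, and tensors have to be expressed in them. *)
Definition admissible c := forall c', atlas M c' -> compatible c c'.

Lemma admissible_atlas c : atlas M c -> admissible c.
Proof. by move=> Mc c' Mc'; exact: atlas_compatible. Qed.

Lemma chart_atP p : atlas M (chart_at p) /\ chart_dom (chart_at p) p.
Proof. exact: (projT2 (cid (atlas_cover p))). Qed.

Lemma chart_at_adm p : admissible (chart_at p).
Proof. by have [Mp _] := chart_atP p; exact: admissible_atlas. Qed.

Lemma chart_at_dom p : chart_dom (chart_at p) p. Proof. by have [] := chart_atP p. Qed.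

Variant smooth_fun p F : Prop := SmoothFun of
  forall c, atlas M c -> chart_dom c p -> smooth_at (F \o chart_inv c : _ -> R^o) (c p).

Lemma transition_open (c c' : chart R m M) : open (c @` (chart_dom c `&` chart_dom c')).
Proof.
rewrite openE => _ [p [cp c'p] <-].
have := chart_near_inv_cod cp (chart_dom_near c'p).
apply: filterS => x [c'x [q cq qx]]; exists q => //; split=> //.
by move: c'x; rewrite -qx chart_mapK.
Qed.

Lemma smooth_at_transition c c' p : admissible c -> atlas M c' ->
  chart_dom c p -> chart_dom c' p ->
  smooth_at (transition c c') (c p) /\ smooth_at (transition c' c) (c' p).
Proof.
move=> ac Mc' cp c'p; have [s1 s2] := ac _ Mc'; split.
- exists (c @` (chart_dom c `&` chart_dom c')); split=> //.
    exact: transition_open.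
  by exists p.
- exists (c' @` (chart_dom c `&` chart_dom c')); split=> //.
    by rewrite setIC; exact: transition_open.
  by exists p.
Qed.

Lemma smooth_funE c p F : admissible c -> chart_dom c p ->
  smooth_fun p F <-> smooth_at (F \o chart_inv c : _ -> R^o) (c p).
Proof.
move=> ac cp; split=> [[Fs]|Fs]; last split=> c' Mc' c'p.
- have [Mc' c'p] := chart_atP p; set c' := chart_at p in Mc' c'p.
  have [s1 _] := smooth_at_transition ac Mc' cp c'p.
  have := Fs c' Mc' c'p.
  rewrite -{1}(chart_mapK cp) => Fs'.
  apply: smooth_at_eq (smooth_at_comp Fs' s1).
  have := chart_near_inv_cod cp (chart_dom_near c'p).
  by apply: filterS => x [c'x _] /=; rewrite chart_mapK.
- have [_ s2] := smooth_at_transition ac Mc' cp c'p.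
  move: Fs; rewrite -{1}(chart_mapK c'p) => Fs'.
  apply: smooth_at_eq (smooth_at_comp Fs' s2).
  have := chart_near_inv c'p (chart_dom_near cp).
  by apply: filterS => x cx /=; rewrite chart_mapK.
Qed.

Lemma smooth_fun_eq p F G : (\forall q \near p, F q = G q) ->
  smooth_fun p F -> smooth_fun p G.
Proof.
move=> FG [Fs]; split=> c Mc cp; apply: smooth_at_eq (Fs c Mc cp).
exact: (chart_near_inv cp FG).
Qed.

Lemma smooth_fun_near p F : smooth_fun p F -> \forall q \near p, smooth_fun q F.
Proof.
have [Mc cp] := chart_atP p; move=> [/(_ _ Mc cp)] /smooth_at_near Fs.
have := chart_near_map_dom cp Fs.
by apply: filterS => q [Fq cq]; apply/(smooth_funE _ (admissible_atlas Mc) cq).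
Qed.

Lemma smooth_fun_continuous p F : smooth_fun p F -> {for p, continuous F}.
Proof.
have [Mc cp] := chart_atP p; set c := chart_at p in Mc cp.
move=> [/(_ _ Mc cp)] /smooth_at_differentiable/differentiable_continuous Fc P.
rewrite /= -[p in F p](chart_mapK cp) => /Fc FP.
have := chart_near_map_dom cp FP.
by apply: filterS => q [/= Pq cq]; rewrite chart_mapK in Pq.
Qed.

Lemma smooth_fun_cst p (a : R) : smooth_fun p (fun=> a).
Proof. by split=> c _ _; exact: smooth_at_cst. Qed.

Lemma smooth_funD p F G : smooth_fun p F -> smooth_fun p G ->
  smooth_fun p (fun q => F q + G q).
Proof. by move=> [Fs] [Gs]; split=> c Mc cp; exact: (smooth_atD (Fs c Mc cp) (Gs c Mc cp)). Qed.

Lemma smooth_funM p F G : smooth_fun p F -> smooth_fun p G ->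
  smooth_fun p (fun q => F q * G q).
Proof. by move=> [Fs] [Gs]; split=> c Mc cp; exact: (smooth_atM (Fs c Mc cp) (Gs c Mc cp)). Qed.

Lemma smooth_funN p F : smooth_fun p F -> smooth_fun p (fun q => - F q).
Proof.
move=> Fs; apply: (smooth_fun_eq _ (smooth_funM (smooth_fun_cst p (-1)) Fs)).
by near=> q; rewrite mulN1r.
Unshelve. all: by end_near. Qed.

Lemma smooth_funV p F : F p != 0 -> smooth_fun p F -> smooth_fun p (fun q => (F q)^-1).
Proof.
move=> Fp0 [Fs]; split=> c Mc cp; apply: (smooth_atV _ (Fs c Mc cp)).
by rewrite /= chart_mapK.
Qed.

Lemma smooth_fun_sum p (I : Type) (r : seq I) (F : I -> M -> R) :
  (forall i, smooth_fun p (F i)) -> smooth_fun p (fun q => \sum_(i <- r) F i q).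
Proof.
move=> Fs; split=> c Mc cp; apply: (@smooth_at_sum R _ R^o _ r (fun i => F i \o chart_inv c)) => i.
by have [Fi] := Fs i; exact: Fi.
Qed.

Lemma smooth_fun_prod p (I : Type) (r : seq I) (F : I -> M -> R) :
  (forall i, smooth_fun p (F i)) -> smooth_fun p (fun q => \prod_(i <- r) F i q).
Proof.
move=> Fs; elim: r => [|i r IHr].
  apply: (smooth_fun_eq _ (smooth_fun_cst p 1)).
  by near=> q; rewrite big_nil.
apply: (smooth_fun_eq _ (smooth_funM (Fs i) IHr)).
by near=> q; rewrite big_cons.
Unshelve. all: by end_near. Qed.

Lemma smooth_fun_comp1 p (g : R^o -> R^o) F :
  (forall k, class_C k setT g) -> smooth_fun p F -> smooth_fun p (g \o F).
Proof. by move=> gC [Fs]; split=> c Mc cp; exact: smooth_at_comp1 gC (Fs c Mc cp). Qed.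

Lemma smooth_fun_coord c p i : admissible c -> chart_dom c p ->
  smooth_fun p (fun q => c q 0 i).
Proof.
move=> ac cp; split=> c' Mc' c'p; have [_ s2] := smooth_at_transition ac Mc' cp c'p.
by have /smooth_at_mxP/(_ 0 i) := s2.
Qed.

(** Compatibility is known only against charts of the atlas, so the coordinates of [c'] are viewed
    as smooth functions on the manifold, and such functions are smooth in every admissible chart. *)
Lemma smooth_at_transition_adm c c' p : admissible c -> admissible c' ->
  chart_dom c p -> chart_dom c' p -> smooth_at (transition c c') (c p).
Proof.
move=> ac ac' cp c'p; apply/smooth_at_mxP => i j; rewrite ord1.
exact: ((smooth_funE _ ac cp).1 (smooth_fun_coord j ac' c'p)).
Qed.

Definition chart_derive c (u : 'rV[R]_m) F : M -> R :=
  fun q => 'D_u (F \o chart_inv c : _ -> R^o) (c q).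

Lemma smooth_fun_derive c p u F : admissible c -> chart_dom c p -> smooth_fun p F ->
  smooth_fun p (chart_derive c u F).
Proof.
move=> ac cp Fs; apply/(smooth_funE _ ac cp).
have := (smooth_funE F ac cp).1 Fs => /(@smooth_at_derive _ _ _ _ u).
apply: smooth_at_eq; have := chart_cod_near cp.
by apply: filterS => x cx; rewrite /chart_derive /= chart_mapVK.
Qed.

Section ChartDerive.
Variables (c : chart R m M) (p : M).
Hypotheses (ac : admissible c) (cp : chart_dom c p).

Let drv u F : smooth_fun p F -> derivable (F \o chart_inv c : _ -> R^o) (c p) u.
Proof.
by move=> /(smooth_funE F ac cp)/smooth_at_differentiable/diff_derivable; apply.
Qed.

Lemma chart_derive_eq u F G : (\forall q \near p, F q = G q) ->
  chart_derive c u F p = chart_derive c u G p.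
Proof. by move=> FG; apply: near_eq_derive; exact: (chart_near_inv cp FG). Qed.

Lemma chart_deriveD u F G : smooth_fun p F -> smooth_fun p G ->
  chart_derive c u (fun q => F q + G q) p = chart_derive c u F p + chart_derive c u G p.
Proof. by move=> Fs Gs; rewrite /chart_derive -deriveD//; exact: drv. Qed.

Lemma chart_deriveM u F G : smooth_fun p F -> smooth_fun p G ->
  chart_derive c u (fun q => F q * G q) p =
  chart_derive c u F p * G p + F p * chart_derive c u G p.
Proof.
move=> Fs Gs; have := @deriveM _ _ _ _ (c p) u (@drv u _ Fs) (@drv u _ Gs).
rewrite /chart_derive => ->; rewrite /= !chart_mapK// addrC /GRing.scale/=.
by rewrite mulrC.
Qed.

Lemma chart_derive_cst u (a : R) : chart_derive c u (fun=> a) p = 0.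
Proof. exact: derive_cst. Qed.

Lemma chart_derive_sum u (I : Type) (r : seq I) (F : I -> M -> R) :
  (forall i, smooth_fun p (F i)) ->
  chart_derive c u (fun q => \sum_(i <- r) F i q) p = \sum_(i <- r) chart_derive c u (F i) p.
Proof.
move=> Fs; elim: r => [|i r IHr].
  rewrite big_nil -[RHS](chart_derive_cst u 0); apply: chart_derive_eq.
  by near=> q; rewrite big_nil.
rewrite big_cons -IHr -chart_deriveD//; last exact: smooth_fun_sum.
by apply: chart_derive_eq; near=> q; rewrite big_cons.
Unshelve. all: by end_near. Qed.

Lemma chart_derive_linear (a : R) u v F : smooth_fun p F ->
  chart_derive c (a *: u + v) F p = a * chart_derive c u F p + chart_derive c v F p.
Proof.
move=> /(smooth_funE F ac cp)/smooth_at_differentiable Fd.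
by rewrite /chart_derive !deriveE// linearP.
Qed.

End ChartDerive.

End Germs.

(* Sealed, because comparing two Jacobians by unfolding does not terminate in practice. *)
HB.lock Definition jac (R : realType) (m : nat) (M : smooth_manifold R m)
    (c c' : chart R m M) (p : M) : 'M[R]_m :=
  jacobian (transition c c') (c p).

Section Jac.
Context {R : realType} {m : nat} {M : smooth_manifold R m}.
Implicit Types (c : chart R m M) (p q : M) (F G : M -> R).

Lemma jacobian_jac c c' p : jacobian (transition c c') (c p) = jac c c' p.
Proof. by rewrite jac.unlock. Qed.

Lemma jacE c c' p i j : admissible c -> admissible c' -> chart_dom c p -> chart_dom c' p ->
  jac c c' p i j = chart_derive c (delta_mx 0 i) (fun q => c' q 0 j) p.
Proof.
move=> ac ac' cp c'p; have s := smooth_at_transition_adm ac ac' cp c'p.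
have d := smooth_at_differentiable s.
transitivity (((delta_mx 0 i : 'rV[R]_m) *m jac c c' p) 0 j); first by rewrite -rowE [RHS]mxE.
rewrite -jacobian_jac -deriveEjacobian// derive_mx ?mxE//.
exact: diff_derivable.
Qed.

Lemma smooth_fun_jac c c' p i j : admissible c -> admissible c' ->
  chart_dom c p -> chart_dom c' p -> smooth_fun p (fun q => jac c c' q i j).
Proof.
move=> ac ac' cp c'p.
apply: (smooth_fun_eq _ (smooth_fun_derive (delta_mx 0 i) ac cp (smooth_fun_coord j ac' c'p))).
near=> q; rewrite jacE//; near: q; exact: chart_dom_near.
Unshelve. all: by end_near. Qed.

(** Chain rule; with row vectors the Jacobians multiply in the order in which the coordinates are
    changed. *)
Lemma jac_comp c c' c'' p : admissible c -> admissible c' -> admissible c'' ->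
  chart_dom c p -> chart_dom c' p -> chart_dom c'' p ->
  jac c c' p *m jac c' c'' p = jac c c'' p.
Proof.
move=> ac ac' ac'' cp c'p c''p.
have d1 := smooth_at_differentiable (smooth_at_transition_adm ac ac' cp c'p).
have d2 := smooth_at_differentiable (smooth_at_transition_adm ac' ac'' c'p c''p).
have d3 := smooth_at_differentiable (smooth_at_transition_adm ac ac'' cp c''p).
have tp : transition c c' (c p) = c' p by rewrite /transition /= chart_mapK.
apply/row_matrixP => i; rewrite row_mul [RHS]rowE [X in X *m _]rowE -!jacobian_jac.
have E1 := deriveEjacobian (delta_mx 0 i) d1.
have E2 := deriveEjacobian ('D_(delta_mx 0 i) (transition c c') (c p)) d2.
have E3 := deriveEjacobian (delta_mx 0 i) d3.
apply: (etrans (y := 'D_('D_(delta_mx 0 i) (transition c c') (c p)) (transition c' c'') (c' p))).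
  exact: (esym (etrans E2 (congr1 (fun v => v *m jacobian (transition c' c'') (c' p)) E1))).
apply: (etrans (y := 'D_(delta_mx 0 i) (transition c c'') (c p))); last exact: E3.
have d2' : differentiable (transition c' c'') (transition c c' (c p)) by rewrite tp.
rewrite (deriveE _ d1) -tp (deriveE _ d2').
transitivity ('d (transition c' c'' \o transition c c') (c p) (delta_mx 0 i)).
  exact: (esym (congr1 (fun f : 'rV[R]_m -> 'rV[R]_m => f (delta_mx 0 i)) (diff_comp d1 d2'))).
rewrite -deriveE; last exact: differentiable_comp.
apply: near_eq_derive; have := chart_near_inv cp (chart_dom_near c'p).
by apply: filterS => x c'x; rewrite /transition /= chart_mapK.
Qed.

Lemma jac_id c p : chart_dom c p -> jac c c p = 1%:M.
Proof.
move=> cp; have tid : \forall x \near c p, id x = transition c c x.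
  have := chart_cod_near cp.
  by apply: filterS => x cx; rewrite /transition /= chart_mapVK.
have d : differentiable (transition c c) (c p).
  by apply: (near_eq_differentiable tid); exact: ex_diff.
apply/row_matrixP => i; rewrite rowE row1 -jacobian_jac; apply: (etrans (esym (deriveEjacobian (delta_mx 0 i) d))).
rewrite -(near_eq_derive _ tid); exact: derive_id.
Qed.

Lemma mul_jac c c' p (v : 'rV[R]_m) : v *m jac c c' p = 'd (transition c c') (c p) v.
Proof. rewrite -jacobian_jac; exact: mul_rV_lin1. Qed.

End Jac.

(** * Matrix-valued germs *)

Section MatrixGerms.
Context {R : realType} {m : nat} {M : smooth_manifold R m}.
Implicit Types (c : chart R m M) (p q : M).

Variant smooth_mx a b p (F : M -> 'M[R]_(a, b)) : Prop := SmoothMx of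
  forall i j, smooth_fun p (fun q => F q i j).

Lemma smooth_mx_entry a b p (F : M -> 'M[R]_(a, b)) i j :
  smooth_mx p F -> smooth_fun p (fun q => F q i j).
Proof. by case. Qed.

Section Shapes.
Variables a b d : nat.
Implicit Types (F G : M -> 'M[R]_(a, b)).

Lemma smooth_mx_eq p F G : (\forall q \near p, F q = G q) ->
  smooth_mx p F -> smooth_mx p G.
Proof.
move=> FG [Fs]; split=> i j; apply: smooth_fun_eq (Fs i j).
by apply: filterS FG => q ->.
Qed.

Lemma smooth_mx_cst p (A : 'M[R]_(a, b)) : smooth_mx p (fun=> A).
Proof. by split=> i j; exact: smooth_fun_cst. Qed.

Lemma smooth_mxD p F G : smooth_mx p F -> smooth_mx p G -> smooth_mx p (fun q => F q + G q).
Proof.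
move=> [Fs] [Gs]; split=> i j; apply: (smooth_fun_eq _ (smooth_funD (Fs i j) (Gs i j))).
by near=> q; rewrite mxE.
Unshelve. all: by end_near. Qed.

Lemma smooth_mxZ p (f : M -> R) F : smooth_fun p f -> smooth_mx p F ->
  smooth_mx p (fun q => f q *: F q).
Proof.
move=> fs [Fs]; split=> i j; apply: (smooth_fun_eq _ (smooth_funM fs (Fs i j))).
by near=> q; rewrite mxE.
Unshelve. all: by end_near. Qed.

Lemma smooth_mxN p F : smooth_mx p F -> smooth_mx p (fun q => - F q).
Proof.
move=> [Fs]; split=> i j; apply: (smooth_fun_eq _ (smooth_funN (Fs i j))).
by near=> q; rewrite mxE.
Unshelve. all: by end_near. Qed.

Lemma smooth_mxT p F : smooth_mx p F -> smooth_mx p (fun q => (F q)^T).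
Proof.
move=> [Fs]; split=> i j; apply: (smooth_fun_eq _ (Fs j i)).
by near=> q; rewrite mxE.
Unshelve. all: by end_near. Qed.

Lemma smooth_mxM p F (H : M -> 'M[R]_(b, d)) : smooth_mx p F -> smooth_mx p H ->
  smooth_mx p (fun q => F q *m H q).
Proof.
move=> [Fs] [Hs]; split=> i j.
apply: (smooth_fun_eq _ (smooth_fun_sum _ (fun k => smooth_funM (Fs i k) (Hs k j)))).
by near=> q; rewrite mxE.
Unshelve. all: by end_near. Qed.

End Shapes.

Lemma smooth_mxB a b p (F G : M -> 'M[R]_(a, b)) :
  smooth_mx p F -> smooth_mx p G -> smooth_mx p (fun q => F q - G q).
Proof. by move=> Fs Gs; exact: smooth_mxD (smooth_mxN Gs). Qed.

Lemma smooth_mx_det n p (F : M -> 'M[R]_n) : smooth_mx p F ->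
  smooth_fun p (fun q => \det (F q)).
Proof.
move=> [Fs]; apply: smooth_fun_sum => s; apply: smooth_funM.
  exact: smooth_fun_cst.
by apply: smooth_fun_prod => i; exact: Fs.
Qed.

(** Cramer's rule: the entries are cofactors divided by the determinant. *)
Lemma smooth_mxV n p (F : M -> 'M[R]_n) : (\forall q \near p, F q \in unitmx) ->
  smooth_mx p F -> smooth_mx p (fun q => invmx (F q)).
Proof.
move=> Fu Fs; have Fp := nbhs_singleton Fu.
have dV : smooth_fun p (fun q => (\det (F q))^-1).
  by apply: smooth_funV (smooth_mx_det Fs); rewrite -unitfE -unitmxE.
split=> i j.
have cs : smooth_fun p (fun q => cofactor (F q) j i).
  apply: smooth_funM; first exact: smooth_fun_cst.
  apply: smooth_mx_det; split=> k l.
  by apply: smooth_fun_eq (smooth_mx_entry (lift j k) (lift i l) Fs); near=> q; rewrite !mxE.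
apply: (smooth_fun_eq _ (smooth_funM dV cs)).
by apply: filterS Fu => q Fq; rewrite /invmx Fq !mxE.
Unshelve. all: by end_near. Qed.

Lemma smooth_mx_unit_near n p (F : M -> 'M[R]_n) : smooth_mx p F -> F p \in unitmx ->
  \forall q \near p, F q \in unitmx.
Proof.
move=> /smooth_mx_det/smooth_fun_continuous dc; rewrite unitmxE unitfE => Fp.
have : nbhs p [set q | \det (F q) != 0].
  have := dc [set r : R | r != 0]; apply.
  by apply: open_nbhs_nbhs; split=> //; exact: open_neq.
by apply: filterS => q; rewrite unitmxE unitfE.
Qed.

End MatrixGerms.

(* Sealed for the same reason as jac. *)
HB.lock Definition mx_derive (R : realType) (m : nat) (M : smooth_manifold R m) a b
    (c : chart R m M) (u : 'rV[R]_m) (F : M -> 'M[R]_(a, b)) (p : M) : 'M[R]_(a, b) :=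
  \matrix_(i, j) chart_derive c u (fun q => F q i j) p.

Section MatrixDerive.
Context {R : realType} {m : nat} {M : smooth_manifold R m}.
Implicit Types (c : chart R m M) (p q : M).

Lemma mx_deriveE a b c u (F : M -> 'M[R]_(a, b)) p i j :
  mx_derive c u F p i j = chart_derive c u (fun q => F q i j) p.
Proof. by rewrite mx_derive.unlock mxE. Qed.

Lemma smooth_mx_derive a b c p u (F : M -> 'M[R]_(a, b)) :
  admissible c -> chart_dom c p -> smooth_mx p F -> smooth_mx p (mx_derive c u F).
Proof.
move=> ac cp [Fs]; split=> i j.
apply: (smooth_fun_eq _ (smooth_fun_derive u ac cp (Fs i j))).
by near=> q; rewrite mx_deriveE.
Unshelve. all: by end_near. Qed.

Section MxDerive.
Variables (c : chart R m M) (p : M).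
Hypotheses (ac : admissible c) (cp : chart_dom c p).

Lemma mx_derive_eq a b u (F G : M -> 'M[R]_(a, b)) : (\forall q \near p, F q = G q) ->
  mx_derive c u F p = mx_derive c u G p.
Proof.
move=> FG; apply/matrixP => i j; rewrite !(mxE, mx_deriveE); apply: chart_derive_eq => //.
by apply: filterS FG => q ->.
Qed.

Lemma mx_derive_cst a b u (A : 'M[R]_(a, b)) : mx_derive c u (fun=> A) p = 0.
Proof. by apply/matrixP => i j; rewrite !(mxE, mx_deriveE) chart_derive_cst. Qed.

Lemma mx_deriveD a b u (F G : M -> 'M[R]_(a, b)) : smooth_mx p F -> smooth_mx p G ->
  mx_derive c u (fun q => F q + G q) p = mx_derive c u F p + mx_derive c u G p.
Proof.
move=> [Fs] [Gs]; apply/matrixP => i j; rewrite !(mxE, mx_deriveE) -chart_deriveD//.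
by apply: chart_derive_eq => //; near=> q; rewrite mxE.
Unshelve. all: by end_near. Qed.

Lemma mx_deriveZ a b u (f : M -> R) (F : M -> 'M[R]_(a, b)) : smooth_fun p f -> smooth_mx p F ->
  mx_derive c u (fun q => f q *: F q) p = chart_derive c u f p *: F p + f p *: mx_derive c u F p.
Proof.
move=> fs [Fs]; apply/matrixP => i j; rewrite !(mxE, mx_deriveE) -chart_deriveM//.
by apply: chart_derive_eq => //; near=> q; rewrite mxE.
Unshelve. all: by end_near. Qed.

Lemma mx_deriveM a b d u (F : M -> 'M[R]_(a, b)) (G : M -> 'M[R]_(b, d)) :
  smooth_mx p F -> smooth_mx p G ->
  mx_derive c u (fun q => F q *m G q) p = mx_derive c u F p *m G p + F p *m mx_derive c u G p.
Proof.
move=> [Fs] [Gs]; apply/matrixP => i j; rewrite !(mxE, mx_deriveE) -big_split/=.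
transitivity (chart_derive c u (fun q => \sum_k F q i k * G q k j) p).
  by apply: chart_derive_eq => //; near=> q; rewrite mxE.
rewrite chart_derive_sum//; last by move=> k; exact: smooth_funM.
by apply: eq_bigr => k _; rewrite chart_deriveM// !mx_deriveE.
Unshelve. all: by end_near. Qed.

Lemma mx_deriveT a b u (F : M -> 'M[R]_(a, b)) :
  mx_derive c u (fun q => (F q)^T) p = (mx_derive c u F p)^T.
Proof.
apply/matrixP => i j; rewrite !(mxE, mx_deriveE); apply: chart_derive_eq => //.
by near=> q; rewrite mxE.
Unshelve. all: by end_near. Qed.

Lemma mx_derive_linear a b (t : R) u v (F : M -> 'M[R]_(a, b)) : smooth_mx p F ->
  mx_derive c (t *: u + v) F p = t *: mx_derive c u F p + mx_derive c v F p.
Proof. by move=> [Fs]; apply/matrixP => i j; rewrite !(mxE, mx_deriveE) chart_derive_linear. Qed.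

Lemma mx_derive0 a b (F : M -> 'M[R]_(a, b)) : smooth_mx p F -> mx_derive c 0 F p = 0.
Proof.
move=> Fs; have := mx_derive_linear (-1) 0 0 Fs.
by rewrite scaler0 add0r scaleN1r addNr.
Qed.

Lemma mx_derive_row a b u (F : M -> 'M[R]_(a, b)) : smooth_mx p F ->
  mx_derive c u F p = \sum_k u 0 k *: mx_derive c (delta_mx 0 k) F p.
Proof.
move=> Fs; rewrite [in LHS](row_sum_delta u).
elim: (index_enum _) => [|k r IHr]; first by rewrite !big_nil mx_derive0.
by rewrite !big_cons mx_derive_linear// IHr.
Qed.

End MxDerive.

(** A direction varying with the point is expanded along the coordinate directions, where the
    fixed-direction case applies. *)
Lemma smooth_mx_derive_var a b c p (U : M -> 'rV[R]_m) (F : M -> 'M[R]_(a, b)) :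
  admissible c -> chart_dom c p -> smooth_mx p U -> smooth_mx p F ->
  smooth_mx p (fun q => mx_derive c (U q) F q).
Proof.
move=> ac cp Us Fs.
have H : smooth_mx p (fun q => \sum_k U q 0 k *: mx_derive c (delta_mx 0 k) F q).
  split=> i j.
  have S k := smooth_mx_entry i j (smooth_mxZ (smooth_mx_entry 0 k Us) (smooth_mx_derive (delta_mx 0 k) ac cp Fs)).
  apply: (smooth_fun_eq _ (smooth_fun_sum (index_enum _) S)).
  by near=> q; rewrite summxE.
apply: smooth_mx_eq H.
have Fn : \forall q \near p, smooth_mx q F.
  have : \forall q \near p, forall i j, smooth_fun q (fun q => F q i j).
    apply: filter_forall => i; apply: filter_forall => j.
    exact: (smooth_fun_near (smooth_mx_entry i j Fs)).
  by apply: filterS => q; split.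
near=> q.
have Fq : smooth_mx q F by near: q.
have cq : chart_dom c q by near: q; exact: chart_dom_near.
by rewrite [RHS]mx_derive_row.
Unshelve. all: by end_near. Qed.

(** * Coordinate frames of a chart *)

Section Frames.
Implicit Types (X : vector_field M).

(** The rows are the coordinate vectors of [c] written in the reference chart at [p]. Since that
    chart may jump with [p], no smoothness in [p] can be expected; the quotients in [frame_mx_ratio]
    are smooth. *)
Definition frame_mx c p : 'M[R]_m := jac c (chart_at p) p.

Lemma frame_mx_jac c c' p : admissible c -> admissible c' ->
  chart_dom c p -> chart_dom c' p -> jac c c' p *m frame_mx c' p = frame_mx c p.
Proof.
move=> ac ac' cp c'p; have [Mp pp] := chart_atP p.
by apply: jac_comp => //; exact: admissible_atlas.
Qed.

Lemma jac_unit c c' p : admissible c -> admissible c' ->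
  chart_dom c p -> chart_dom c' p -> jac c c' p \in unitmx.
Proof.
move=> ac ac' cp c'p.
have E : jac c c' p *m jac c' c p = 1%:M by rewrite jac_comp// jac_id.
by have [] := mulmx1_unit E.
Qed.

Lemma frame_mx_unit c p : admissible c -> chart_dom c p -> frame_mx c p \in unitmx.
Proof.
move=> ac cp; have [Mp pp] := chart_atP p.
by apply: jac_unit => //; exact: admissible_atlas.
Qed.

Lemma frameE c i p : frame c i p = row i (frame_mx c p).
Proof. by rewrite rowE /frame_mx mul_jac. Qed.

Lemma tcoordE c p (v : tangent p) : admissible c -> chart_dom c p ->
  tcoord c v = (v : 'rV[R]_m) *m invmx (frame_mx c p).
Proof.
move=> ac cp; have [Mp pp] := chart_atP p; have ap := admissible_atlas Mp.
have -> : tcoord c v = (v : 'rV[R]_m) *m jac (chart_at p) c p.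
  by rewrite mul_jac.
congr (_ *m _); have E : frame_mx c p *m jac (chart_at p) c p = 1%:M.
  by rewrite jac_comp// jac_id.
by rewrite -[LHS](mulKmx (frame_mx_unit ac cp)) E mulmx1.
Qed.

Lemma frame_mx_ratio c c' p : admissible c -> admissible c' ->
  chart_dom c p -> chart_dom c' p ->
  frame_mx c p *m invmx (frame_mx c' p) = jac c c' p.
Proof.
move=> ac ac' cp c'p; rewrite -(frame_mx_jac ac ac' cp c'p) mulmxK//.
exact: frame_mx_unit.
Qed.

Lemma smooth_mx_jac c c' p : admissible c -> admissible c' ->
  chart_dom c p -> chart_dom c' p -> smooth_mx p (jac c c').
Proof. by move=> *; split=> i j; exact: smooth_fun_jac. Qed.

End Frames.
End MatrixDerive.

(** * Bump functions and gluing *)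

Section Bump.
Context {R : realType} {m : nat} {M : smooth_manifold R m}.
Implicit Types (c : chart R m M) (p q : M).

(** Euclidean on purpose: the norm of row vectors is the maximum norm, which is not smooth. *)
Definition sqdist (y x : 'rV[R]_m) : R := \sum_k (x 0 k - y 0 k) ^+ 2.

Lemma sqdist_ge (y x : 'rV[R]_m) k : (x 0 k - y 0 k) ^+ 2 <= sqdist y x.
Proof.
rewrite /sqdist (bigD1 k)//= lerDl; apply: sumr_ge0 => i _; exact: sqr_ge0.
Qed.

Lemma sqdist_continuous (y : 'rV[R]_m) : continuous (sqdist y : _ -> R^o).
Proof.
move=> x; apply: (@differentiable_continuous _ _ R^o); apply: smooth_at_differentiable.
apply: (@smooth_at_sum R _ R^o _ _ (fun k (x : 'rV[R]_m) => (x 0 k - y 0 k) ^+ 2)) => k.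
have s : smooth_at (fun x : 'rV[R]_m => x 0 k - y 0 k : R^o) x.
  apply: (smooth_atD _ (smooth_at_cst _ _)).
  apply: (smooth_at_mxP (id : 'rV[R]_m -> 'rV[R]_m) x).1.
  by exists setT; split=> // [|k']; [exact: openT|exact: class_C_id].
exact: (smooth_atM s s).
Qed.

Lemma sqdist_ball_compact (y : 'rV[R]_m) a : compact [set x | sqdist y x <= a].
Proof.
(* A number whose square is at most a has absolute value at most 1 + a; this spares a square
   root. *)
have B : compact [set x : 'rV[R]_m | forall i, x ord0 i \in `[y 0 i - (1 + a), y 0 i + (1 + a)]].
  apply: (@rV_compact R m (fun i => `[y 0 i - (1 + a), y 0 i + (1 + a)]%classic)).
  by move=> i; exact: segment_compact.
apply: subclosed_compact B _.
  have -> : [set x | sqdist y x <= a] = sqdist y @^-1` [set r | r <= a] by [].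
  apply: closed_comp; last exact: closed_le.
  by move=> x _; exact: sqdist_continuous.
move=> x /= xa i; rewrite in_itv/=.
have a0 : 0 <= a by apply: le_trans xa; apply: sumr_ge0 => k _; exact: sqr_ge0.
have := le_trans (sqdist_ge y x i) xa; nra.
Qed.

Lemma sqdist_ball_nbhs (y : 'rV[R]_m) (U : set 'rV[R]_m) : nbhs y U ->
  exists2 a, 0 < a & [set x | sqdist y x <= a] `<=` U.
Proof.
move=> /nbhs_ballP[e /= e0 eU]; exists ((e / 2) ^+ 2); first by rewrite exprn_gt0// divr_gt0.
move=> x /= xe; apply: eU; rewrite -ball_normE /ball_/=.
rewrite /Num.Def.normr/= mx_normrE (bigmax_lt _ e0)//= => -[i j] _; rewrite !mxE ord1/=.
have := le_trans (sqdist_ge y x j) xe.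
rewrite distrC -[_ ^+ 2 in X in X -> _]real_normK ?num_real//.
rewrite ler_pXn2r ?nnegrE//; last by rewrite ltW// divr_gt0.
by move=> /le_lt_trans; apply; rewrite ltr_pdivrMr// ltr_pMr// ltr1n.
Qed.

(** The image of a compact ball is compact, hence closed because the manifold is Hausdorff; this
    lets functions supported in it be extended by 0. *)
Lemma chart_ball_closed c (y : 'rV[R]_m) a :
  [set x | sqdist y x <= a] `<=` c @` chart_dom c ->
  closed (chart_inv c @` [set x | sqdist y x <= a]).
Proof.
move=> sub; apply: compact_closed; first exact: manifold_hausdorff.
apply: continuous_compact; last exact: sqdist_ball_compact.
apply: continuous_in_subspaceT => x /set_mem /= xa.
by apply: chart_inv_continuous; exact: sub.
Qed.

(** The argument of [smooth_step] is 1 at squared distance a / 2 and 0 at squared distance a, so the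
    bump is 1 up to the former and vanishes beyond the latter. *)
Definition bump c (y : 'rV[R]_m) (a : R) : M -> R := fun q =>
  if `[< chart_dom c q >] then smooth_step (2 - 2 / a * sqdist y (c q)) else 0.

Section BumpProps.
Variables (c : chart R m M) (y : 'rV[R]_m) (a : R).
Hypotheses (Mc : atlas M c) (a0 : 0 < a).
Hypothesis sub : [set x | sqdist y x <= a] `<=` c @` chart_dom c.

Lemma bump_itv q : 0 <= bump c y a q <= 1.
Proof.
by rewrite /bump; case: ifP => _; [exact: smooth_step_itv|rewrite lexx ler01].
Qed.

Lemma bump_support q :
  (chart_dom c q /\ sqdist y (c q) <= a) \/ (\forall z \near q, bump c y a z = 0).
Proof.
pose K := chart_inv c @` [set x | sqdist y x <= a].
have [Kq|nKq] := pselect (K q).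
  left; case: Kq => x /= xa <-; have [p cp px] := sub xa.
  by rewrite -px !chart_mapK//; split=> //; rewrite px.
right; have : nbhs q (~` K).
  apply: open_nbhs_nbhs; split=> //; apply: closed_openC; exact: chart_ball_closed.
apply: filterS => z nKz; rewrite /bump; case: asboolP => // cz.
apply: smooth_step0; rewrite subr_le0 mulrAC ler_pdivlMr// ler_pM2l//.
rewrite leNgt; apply/negP => za; apply: nKz; exists (c z); first exact: ltW.
exact: chart_mapK.
Qed.

Lemma bump1 q : chart_dom c q -> sqdist y (c q) < a / 2 ->
  \forall z \near q, bump c y a z = 1.
Proof.
move=> cq qa; have qa' : nbhs (c q) [set x | sqdist y x < a / 2].
  apply: (@sqdist_continuous y (c q) [set r | r < a / 2]).
  by apply: open_nbhs_nbhs; split=> //; exact: open_lt.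
have := chart_near_map_dom cq qa'; apply: filterS => z [/= za cz].
rewrite /bump asboolT//; apply: smooth_step1.
rewrite lerBrDr -lerBrDl mulrAC ler_pdivrMr//; lra.
Qed.

Lemma bump_smooth q : smooth_fun q (bump c y a).
Proof.
have [[cq _]|z0] := bump_support q; last first.
  apply: (smooth_fun_eq _ (smooth_fun_cst q 0)).
  by apply: filterS z0 => z ->.
have ac := admissible_atlas Mc.
have s : smooth_fun q (fun q => 2 + (- (2 / a) * \sum_k (c q 0 k - y 0 k) * (c q 0 k - y 0 k))).
  apply: (smooth_funD (smooth_fun_cst _ _)).
  apply: (smooth_funM (smooth_fun_cst _ _)).
  apply: smooth_fun_sum => k.
  have sk := smooth_funD (smooth_fun_coord k ac cq) (smooth_fun_cst q (- y 0 k)).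
  exact: smooth_funM.
apply: (smooth_fun_eq _ (smooth_fun_comp1 class_C_smooth_step s)).
have := chart_dom_near cq; apply: filterS => z cz.
by rewrite /bump asboolT//= mulNr.
Qed.

End BumpProps.

(** Two nested bumps, [f] being 1 around the support of [e]. Gluing inserts a local section with a
    weight bounded by [f], while [e] marks the points that are finished. *)
Lemma local_bumps p (P : set M) : (\forall q \near p, P q) -> exists e f : M -> R,
  [/\ forall q, smooth_fun q e /\ smooth_fun q f,
      forall q, 0 <= e q <= 1 /\ 0 <= f q <= 1,
      forall q, (\forall z \near q, f z = 0) \/ (\forall z \near q, P z),
      forall q, (\forall z \near q, f z = 1) \/ (\forall z \near q, e z = 0) &
      \forall q \near p, e q = 1].
Proof.
move=> Pp; have [Mc cp] := chart_atP p; set c := chart_at p in Mc cp.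
have Pn : \forall q \near p, \forall z \near q, P z by exact: nbhs_interior.
have [a a0 aP] := sqdist_ball_nbhs (chart_near_inv_cod cp Pn).
have sub : [set x | sqdist (c p) x <= a] `<=` c @` chart_dom c.
  by move=> x /aP[].
(* The support of the bump of parameter a / 4 stays below a / 2, where the bump of parameter a
   equals 1. *)
have a40 : 0 < a / 4 by rewrite divr_gt0.
have sub4 : [set x | sqdist (c p) x <= a / 4] `<=` c @` chart_dom c.
  move=> x /= xa; apply: sub => /=; apply: le_trans xa _.
  lra.
exists (bump c (c p) (a / 4)), (bump c (c p) a); split.
- by move=> q; split; apply: bump_smooth.
- by move=> q; split; exact: bump_itv.
- move=> q; have [[cq qa]|] := bump_support a0 sub q; last by left.
  right; have [Pq _] := aP _ qa; by rewrite chart_mapK in Pq.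
- move=> q; have [[cq qa]|] := bump_support a40 sub4 q; last by right.
  left; apply: bump1 => //; apply: le_lt_trans qa _; lra.
- apply: bump1 => //; rewrite /sqdist big1 ?divr_gt0// => k _.
  by rewrite subrr expr0n.
Qed.

(** Second countability makes the family countable: each basic open set on which some local datum
    has [e] equal to 1 keeps one such datum, numbered by an injection of the basis into [nat]. *)
Lemma cover_bumps (S : Type) (s0 : S) (P : S -> set M) :
  (forall p, exists s, \forall q \near p, P s q) ->
  exists (e f : nat -> M -> R) (s : nat -> S),
  [/\ forall i q, smooth_fun q (e i) /\ smooth_fun q (f i),
      forall i q, 0 <= e i q <= 1 /\ 0 <= f i q <= 1,
      forall i q, (\forall z \near q, f i z = 0) \/ (\forall z \near q, P (s i) z),
      forall i q, (\forall z \near q, f i z = 1) \/ (\forall z \near q, e i z = 0) &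
      forall p, exists i, \forall q \near p, e i q = 1].
Proof.
move=> loc.
pose good (D : (M -> R) * (M -> R) * S) :=
  [/\ forall q, smooth_fun q D.1.1 /\ smooth_fun q D.1.2,
      forall q, 0 <= D.1.1 q <= 1 /\ 0 <= D.1.2 q <= 1,
      forall q, (\forall z \near q, D.1.2 z = 0) \/ (\forall z \near q, P D.2 z) &
      forall q, (\forall z \near q, D.1.2 z = 1) \/ (\forall z \near q, D.1.1 z = 0)].
have locD p : exists D, good D /\ \forall q \near p, D.1.1 q = 1.
  have [s /local_bumps[e [f [h1 h2 h3 h4 h5]]]] := loc p.
  by exists (e, f, s); split.
(* Filler for the indices that number no suitable basic open set: both functions are 0. *)
have D0 : good (fun=> 0, fun=> 0, s0).
  split=> /= q.
  - by split; exact: smooth_fun_cst.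
  - by rewrite lexx ler01.
  - by left; near=> z.
  - by right; near=> z.
have [B cB [Bo Bb]] := manifold_second_countable M.
have [h hB] := countable_injP _ cB.
pose Q n (D : (M -> R) * (M -> R) * S) :=
  good D /\ exists b, [/\ B b, h b = n & b `<=` [set q | D.1.1 q = 1]].
have HD n : exists D, good D /\ ((exists D', Q n D') -> Q n D).
  have [[D QD]|nD] := pselect (exists D', Q n D').
    by exists D; split=> //; case: QD.
  by exists (fun=> 0, fun=> 0, s0); split.
pose D n := projT1 (cid (HD n)).
have gD n : good (D n) by exact: (projT2 (cid (HD n))).1.
have qD n : (exists D', Q n D') -> Q n (D n) by exact: (projT2 (cid (HD n))).2.
exists (fun n => (D n).1.1), (fun n => (D n).1.2), (fun n => (D n).2).
split=> [n|n|n|n|p]; try by have [] := gD n.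
have [D' [gD' D'p]] := locD p.
have [b [Bb' bp] bD] := Bb p _ D'p.
have [_ [b' [Bb'' hb b'D]]] : Q (h b) (D (h b)).
  by apply: qD; exists D'; split=> //; exists b.
exists (h b); have := hB _ _ (mem_set Bb'') (mem_set Bb') hb => bb.
have : nbhs p b by apply: open_nbhs_nbhs; split=> //; exact: Bo.
by apply: filterS; rewrite bb in b'D.
Unshelve. all: by end_near. Qed.

End Bump.

(* Sections are corrected one chart at a time: the i-th step interpolates with
   weight t_i, which vanishes where an earlier e_j equals 1, so that every point
   is modified finitely often, and equals 1 near the points not yet treated. *)
Section Gluing.
Context {R : realType} {m : nat} {M : smooth_manifold R m}.
Variables (V : Type) (v0 : V) (valid : M -> V -> Prop) (Sm : M -> (M -> V) -> Prop).
Variable F : M -> V -> V -> R -> V.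

Definition good_section (s : M -> V) (p : M) := valid p (s p) /\ Sm p s.

Hypothesis Sm_eq : forall p s t, (\forall q \near p, s q = t q) -> Sm p s -> Sm p t.
Hypothesis F0 : forall p a b, valid p a -> valid p b -> F p a b 0 = a.
Hypothesis F1 : forall p a b, valid p a -> valid p b -> F p a b 1 = b.
Hypothesis Fvalid : forall p a b t, valid p a -> valid p b -> 0 <= t <= 1 ->
  valid p (F p a b t).
Hypothesis FSm : forall p s t (w : M -> R),
  (\forall q \near p, [/\ good_section s q, good_section t q, smooth_fun q w & 0 <= w q <= 1]) ->
  Sm p (fun q => F q (s q) (t q) (w q)).
Hypothesis local : forall p : M, exists s, \forall q \near p, good_section s q.

Theorem glue_sections : exists s, forall p, good_section s p.
Proof.
have [e [f [s [sef ief fP eP cov]]]] := cover_bumps (fun=> v0) local.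
pose w i q := f i q * \prod_(j < i) (1 - e j q).
(* The weights 0 and 1 are separated out because there only one of the two sections need be valid,
   and the hypotheses on [F] concern valid arguments. *)
pose step i (g : M -> V) q :=
  if w i q == 0 then g q else if w i q == 1 then s i q else F q (g q) (s i q) (w i q).
pose g := fix g i := if i is i'.+1 then step i' (g i') else fun=> v0.
have ws i q : smooth_fun q (w i).
  apply: smooth_funM; first by have [] := sef i q.
  apply: smooth_fun_prod => j.
  by apply: smooth_funD; [exact: smooth_fun_cst|apply: smooth_funN; have [] := sef j q].
have wi i q : 0 <= w i q <= 1.
  have P : 0 <= \prod_(j < i) (1 - e j q) <= 1.
    elim: i => [|i /andP[P0 P1]]; first by rewrite big_ord0 ler01 lexx.
    rewrite big_ord_recr/=; have [/andP[e0 e1] _] := ief i q.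
    have h0 : 0 <= 1 - e i q by rewrite subr_ge0.
    have h1 : 1 - e i q <= 1 by rewrite gerBl.
    by rewrite mulr_ge0//= mulr_ile1.
  have [_ /andP[f0 f1]] := ief i q; have /andP[P0 P1] := P.
  by rewrite /w mulr_ge0//= mulr_ile1.
have good_eq a b (p : M) : (\forall q \near p, a q = b q) ->
    (\forall q \near p, good_section a q) -> \forall q \near p, good_section b q.
  move=> /nbhs_interior ab ga; near=> q.
  have abq : \forall z \near q, a z = b z by near: q.
  have [va sa] : good_section a q by near: q.
  by split; [rewrite -(nbhs_singleton abq)|exact: Sm_eq abq sa].
have step_good i (p : M) : (\forall q \near p, good_section (g i) q) ->
    (\forall q \near p, good_section (s i) q) -> \forall q \near p, good_section (g i.+1) q.
  move=> gi si.
  apply: (good_eq (fun q => F q (g i q) (s i q) (w i q))).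
    near=> q; rewrite /= /step.
    have [vg _] : good_section (g i) q by near: q.
    have [vs _] : good_section (s i) q by near: q.
    case: eqP => [->|_]; first by rewrite F0.
    by case: eqP => [->|//]; rewrite F1.
  have gi' := nbhs_interior gi; have si' := nbhs_interior si.
  near=> q.
  have [vg _] : good_section (g i) q by near: q.
  have [vs _] : good_section (s i) q by near: q.
  split; first exact: Fvalid.
  apply: FSm; near=> z; split=> //; near: z; near: q; assumption.
(* Invariant: [g i] is good near every point around which some [f j] with j < i equals 1. *)
have G i (p : M) : (exists2 j, (j < i)%N & \forall q \near p, f j q = 1) ->
    \forall q \near p, good_section (g i) q.
  elim: i p => [|i IHi] p; first by case.
  move=> [j ji fj].
  have [fi0|si] := fP i p.
    have wi0 : \forall q \near p, g i q = g i.+1 q.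
      by apply: filterS fi0 => q fq; rewrite /= /step /w fq mul0r eqxx.
    apply: good_eq wi0 _; apply: IHi; exists j => //.
    rewrite -ltnS ltn_neqAle eqSS ltnS -ltnS ji andbT.
    apply/eqP => ji'; have := nbhs_singleton fi0; have := nbhs_singleton fj.
    by rewrite ji' => -> /eqP; rewrite oner_eq0.
  have [[k ki fk]|nf] := pselect (exists2 k, (k < i)%N & \forall q \near p, f k q = 1).
    by apply: step_good => //; apply: IHi; exists k.
  (* Here no earlier [f k] is 1 near [p], so every earlier [e k] vanishes there; the weight is then
     [f i], which is 1, and the new local section is taken over unchanged. *)
  have e0 (k : 'I_i) : \forall q \near p, e k q = 0.
    by have [fk|//] := eP k p; exfalso; apply: nf; exists k.
  have ij : j = i.
    apply/eqP; rewrite eqn_leq -ltnS ji leqNgt; apply/negP => ji'.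
    by apply: nf; exists j.
  subst j.
  apply: (good_eq (s i)) => //.
  have e0' : \forall q \near p, forall k : 'I_i, e k q = 0 by exact: filter_forall.
  near=> q; rewrite /= /step.
  have -> : w i q = 1.
    rewrite /w (near fj q)// mul1r big1// => k _.
    have -> : e k q = 0 by move: k; near: q.
    by rewrite subr0.
  by rewrite oner_eq0 eqxx.
(* Once [e i] equals 1 at [q], all later weights contain the factor 1 - 1. *)
have stab i j q : e i q = 1 -> (i < j)%N -> g j q = g i.+1 q.
  move=> ei; elim: j => // j IHj; rewrite ltnS leq_eqVlt => /orP[/eqP -> //|ij].
  rewrite -IHj//= /step.
  have -> : w j q = 0.
    by rewrite /w (bigD1 (Ordinal ij))//= ei subrr mul0r mulr0.
  by rewrite eqxx.
pose N p := projT1 (cid (cov p)).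
have eN p : \forall q \near p, e (N p) q = 1 by exact: (projT2 (cid (cov p))).
exists (fun p => g (N p).+1 p) => p.
have gN : \forall q \near p, good_section (g (N p).+1) q.
  apply: G; exists (N p) => //.
  have [//|e0] := eP (N p) p; exfalso.
  have := nbhs_singleton e0; rewrite (nbhs_singleton (eN p)) => /eqP.
  by rewrite oner_eq0.
apply: nbhs_singleton; apply: good_eq gN.
near=> q; pose j := (maxn (N p) (N q)).+1.
rewrite -(@stab (N p) j) ?ltnS ?leq_maxl//; last by near: q; exact: eN.
by rewrite (@stab (N q) j) ?ltnS ?leq_maxr//; exact: nbhs_singleton (eN q).
Unshelve. all: by end_near. Qed.

End Gluing.

(** * Tensor fields in coordinates *)

Section Algebra.
Context {R : realType} {m : nat}.

Definition mxform (A : 'M[R]_m) (u v : 'rV[R]_m) : R := (u *m A *m v^T) 0 0.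

Lemma mxform_tr (A : 'M[R]_m) u v : mxform A^T u v = mxform A v u.
Proof.
rewrite /mxform -[in RHS](trmxK (v *m A *m u^T)) [RHS]mxE.
by rewrite !trmx_mul trmxK mulmxA.
Qed.

Lemma mxformDl A u u' v : mxform A (u + u') v = mxform A u v + mxform A u' v.
Proof. by rewrite /mxform !mulmxDl mxE. Qed.

Lemma mxformZl A a u v : mxform A (a *: u) v = a * mxform A u v.
Proof. by rewrite /mxform -!scalemxAl mxE. Qed.

Lemma mxformDr A u v v' : mxform A u (v + v') = mxform A u v + mxform A u v'.
Proof. by rewrite /mxform linearD/= mulmxDr mxE. Qed.

Lemma mxformZr A a u v : mxform A u (a *: v) = a * mxform A u v.
Proof. by rewrite /mxform linearZ/= -scalemxAr mxE. Qed.

Lemma mxform_delta A i j : mxform A (delta_mx 0 i) (delta_mx 0 j) = A i j.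
Proof. by rewrite /mxform trmx_delta -rowE -colE !mxE. Qed.

Lemma mxform_inj A B : (forall u v, mxform A u v = mxform B u v) -> A = B.
Proof. by move=> AB; apply/matrixP => i j; rewrite -!mxform_delta. Qed.

Lemma scalar_linear_row (f : 'rV[R]_m -> R) :
  (forall a x y, f (a *: x + y) = a * f x + f y) ->
  forall u, f u = \sum_j u 0 j * f (delta_mx 0 j).
Proof.
move=> fl u; rewrite [in LHS](row_sum_delta u).
have f0 : f 0 = 0.
  by have := fl (-1) 0 0; rewrite scaler0 addr0 mulN1r addNr.
elim: (index_enum _) => [|k r IHr]; first by rewrite !big_nil.
by rewrite !big_cons fl IHr.
Qed.

Lemma bilinear_mxform (B : 'rV[R]_m -> 'rV[R]_m -> R) :
  (forall a x y v, B (a *: x + y) v = a * B x v + B y v) ->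
  (forall a x y v, B v (a *: x + y) = a * B v x + B v y) ->
  forall u v, B u v = mxform (\matrix_(i, j) B (delta_mx 0 i) (delta_mx 0 j)) u v.
Proof.
move=> Bl Br u v.
rewrite (scalar_linear_row (fun a x y => Bl a x y v)) /mxform -mulmxA mxE.
apply: eq_bigr => i _; congr (_ * _).
rewrite (scalar_linear_row (fun a x y => Br a x y (delta_mx 0 i))) mxE.
by apply: eq_bigr => j _; rewrite !mxE mulrC.
Qed.

Lemma mxform_conj (P A : 'M[R]_m) u v : mxform (P *m A *m P^T) u v = mxform A (u *m P) (v *m P).
Proof. by rewrite /mxform trmx_mul !mulmxA. Qed.

End Algebra.

Section Tensors.
Context {R : realType} {m : nat} {M : smooth_manifold R m}.
Implicit Types (c : chart R m M) (p q : M).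

Lemma smooth_on_eq (V W : normedModType R) (U : set V) (f g : V -> W) : open U ->
  (forall x, U x -> f x = g x) -> smooth_on U f -> smooth_on U g.
Proof. by move=> oU fg fs k; exact: class_C_eq oU fg (fs k). Qed.

Lemma smooth_on_chart c (f : 'rV[R]_m -> R) (F : M -> R) : atlas M c ->
  (forall q, chart_dom c q -> f (c q) = F q) ->
  smooth_on (c @` chart_dom c) (f : _ -> R^o) <-> forall p, chart_dom c p -> smooth_fun p F.
Proof.
move=> Mc fF; have ac := admissible_atlas Mc; have oc : open (c @` chart_dom c) by exact: chart_cod_open.
have fE x : (c @` chart_dom c) x -> f x = F (chart_inv c x).
  by move=> [q cq <-]; rewrite fF// chart_mapK.
split=> [fs p cp|Fs].
- apply/(smooth_funE _ ac cp); apply: ((smooth_onP _ oc).1 _ (c p)); last by exists p.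
  exact: smooth_on_eq fE fs.
- apply: (@smooth_on_eq _ R^o _ (F \o chart_inv c)) => // [x cx|].
    by rewrite fE.
  apply/(smooth_onP _ oc) => _ [p cp <-]; apply/(smooth_funE _ ac cp); exact: Fs.
Qed.

Lemma smooth_on_chart_mx a b c (f : 'rV[R]_m -> 'M[R]_(a, b)) (F : M -> 'M[R]_(a, b)) : atlas M c ->
  (forall q, chart_dom c q -> f (c q) = F q) ->
  smooth_on (c @` chart_dom c) f <-> forall p, chart_dom c p -> smooth_mx p F.
Proof.
move=> Mc fF; have oc : open (c @` chart_dom c) by exact: chart_cod_open.
have H i j := @smooth_on_chart c (fun x => f x i j) (fun q => F q i j) Mc.
have {}H i j := H i j (fun q cq => congr1 (fun A : 'M[R]_(a, b) => A i j) (fF q cq)).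
split=> [fs p cp|Fs].
  split=> i j; apply: (H i j).1 => // k; apply: class_C_coord => //; exact: fs.
move=> k; apply: class_C_mx => // i j; apply: (H i j).2 => p cp.
exact/smooth_mx_entry/Fs.
Qed.

(* Tensor fields are given at q by matrices in the coordinates of chart_at q, acting
   on row vectors; these are their components in the frame of the chart c. *)
Definition cov2 c (A : M -> 'M[R]_m) q := frame_mx c q *m A q *m (frame_mx c q)^T.
Definition cov1 c (a : M -> 'rV[R]_m) q := a q *m (frame_mx c q)^T.
Definition end11 c (T : M -> 'M[R]_m) q := frame_mx c q *m T q *m invmx (frame_mx c q).
Definition vec c (X : M -> 'rV[R]_m) q := X q *m invmx (frame_mx c q).

Section Change.
Variables (c c' : chart R m M) (p : M).
Hypotheses (ac : admissible c) (ac' : admissible c') (cp : chart_dom c p) (c'p : chart_dom c' p).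

Let near_dom : \forall q \near p, chart_dom c q /\ chart_dom c' q.
Proof.
near=> q; split; near: q; exact: chart_dom_near.
Unshelve. all: by end_near. Qed.

Lemma cov2_change A q : chart_dom c q -> chart_dom c' q ->
  cov2 c' A q = jac c' c q *m cov2 c A q *m (jac c' c q)^T.
Proof.
by move=> cq c'q; rewrite /cov2 -(frame_mx_jac ac' ac)// trmx_mul !mulmxA.
Qed.

Lemma cov1_change a q : chart_dom c q -> chart_dom c' q ->
  cov1 c' a q = cov1 c a q *m (jac c' c q)^T.
Proof. by move=> cq c'q; rewrite /cov1 -(frame_mx_jac ac' ac)// trmx_mul !mulmxA. Qed.

Lemma invmx_frame q : chart_dom c q -> chart_dom c' q ->
  invmx (frame_mx c' q) = invmx (frame_mx c q) *m jac c c' q.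
Proof. by move=> cq c'q; rewrite -(frame_mx_ratio ac ac')// mulKmx// frame_mx_unit. Qed.

Lemma end11_change T q : chart_dom c q -> chart_dom c' q ->
  end11 c' T q = jac c' c q *m end11 c T q *m jac c c' q.
Proof.
by move=> cq c'q; rewrite /end11 invmx_frame// -(frame_mx_jac ac' ac)// !mulmxA.
Qed.

Lemma vec_change X q : chart_dom c q -> chart_dom c' q ->
  vec c' X q = vec c X q *m jac c c' q.
Proof. by move=> cq c'q; rewrite /vec invmx_frame// mulmxA. Qed.

Let js : smooth_mx p (jac c' c). Proof. exact: smooth_mx_jac. Qed.
Let js' : smooth_mx p (jac c c'). Proof. exact: smooth_mx_jac. Qed.

Lemma smooth_cov2_change A : smooth_mx p (cov2 c A) -> smooth_mx p (cov2 c' A).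
Proof.
move=> As; apply: smooth_mx_eq (smooth_mxM (smooth_mxM js As) (smooth_mxT js)).
by apply: filterS near_dom => q [cq c'q]; rewrite cov2_change.
Qed.

Lemma smooth_cov1_change a : smooth_mx p (cov1 c a) -> smooth_mx p (cov1 c' a).
Proof.
move=> As; apply: smooth_mx_eq (smooth_mxM As (smooth_mxT js)).
by apply: filterS near_dom => q [cq c'q]; rewrite cov1_change.
Qed.

Lemma smooth_end11_change T : smooth_mx p (end11 c T) -> smooth_mx p (end11 c' T).
Proof.
move=> As; apply: smooth_mx_eq (smooth_mxM (smooth_mxM js As) js').
by apply: filterS near_dom => q [cq c'q]; rewrite end11_change.
Qed.

Lemma smooth_vec_change X : smooth_mx p (vec c X) -> smooth_mx p (vec c' X).
Proof.
move=> As; apply: smooth_mx_eq (smooth_mxM As js').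
by apply: filterS near_dom => q [cq c'q]; rewrite vec_change.
Qed.

End Change.

Definition smooth_cov2 p A := smooth_mx p (cov2 (chart_at p) A).
Definition smooth_cov1 p a := smooth_mx p (cov1 (chart_at p) a).
Definition smooth_end11 p T := smooth_mx p (end11 (chart_at p) T).
Definition smooth_vec p X := smooth_mx p (vec (chart_at p) X).

Let at_adm := @chart_at_adm R m M.
Let at_dom := @chart_at_dom R m M.

Lemma smooth_cov2E c p A : admissible c -> chart_dom c p -> smooth_cov2 p A <-> smooth_mx p (cov2 c A).
Proof. by move=> ac cp; split; apply: smooth_cov2_change. Qed.
Lemma smooth_cov1E c p A : admissible c -> chart_dom c p -> smooth_cov1 p A <-> smooth_mx p (cov1 c A).
Proof. by move=> ac cp; split; apply: smooth_cov1_change. Qed.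
Lemma smooth_end11E c p A : admissible c -> chart_dom c p -> smooth_end11 p A <-> smooth_mx p (end11 c A).
Proof. by move=> ac cp; split; apply: smooth_end11_change. Qed.
Lemma smooth_vecE c p A : admissible c -> chart_dom c p -> smooth_vec p A <-> smooth_mx p (vec c A).
Proof. by move=> ac cp; split; apply: smooth_vec_change. Qed.

Lemma smooth_cov2_eq p A B : (\forall q \near p, A q = B q) -> smooth_cov2 p A -> smooth_cov2 p B.
Proof. by move=> AB; apply: smooth_mx_eq; apply: filterS AB => q; rewrite /cov2 => ->. Qed.
Lemma smooth_cov1_eq p A B : (\forall q \near p, A q = B q) -> smooth_cov1 p A -> smooth_cov1 p B.
Proof. by move=> AB; apply: smooth_mx_eq; apply: filterS AB => q; rewrite /cov1 => ->. Qed.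
Lemma smooth_end11_eq p A B : (\forall q \near p, A q = B q) -> smooth_end11 p A -> smooth_end11 p B.
Proof. by move=> AB; apply: smooth_mx_eq; apply: filterS AB => q; rewrite /end11 => ->. Qed.
Lemma smooth_vec_eq p A B : (\forall q \near p, A q = B q) -> smooth_vec p A -> smooth_vec p B.
Proof. by move=> AB; apply: smooth_mx_eq; apply: filterS AB => q; rewrite /vec => ->. Qed.

Lemma smooth_vector_fieldP (X : vector_field M) :
  smooth_vector_field X <-> forall p, smooth_vec p X.
Proof.
split=> [Xs p|Xs c Mc].
- have [Mc cp] := chart_atP p; have ac := admissible_atlas Mc.
  have E q : chart_dom (chart_at p) q -> tcoord (chart_at p) (X (chart_inv (chart_at p) (chart_at p q))) = vec (chart_at p) X q.
    by move=> cq; rewrite chart_mapK// tcoordE.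
  exact: ((smooth_on_chart_mx Mc E).1 (Xs _ Mc) p cp).
- have ac := admissible_atlas Mc.
  have E q : chart_dom c q -> tcoord c (X (chart_inv c (c q))) = vec c X q.
    by move=> cq; rewrite chart_mapK// tcoordE.
  by apply: ((smooth_on_chart_mx Mc E).2) => p cp; apply/smooth_vecE.
Qed.

Lemma smooth_mapP (f : M -> R) :
  smooth_map (f : M -> R^o) <-> forall p, smooth_fun p f.
Proof.
split=> [fs p|fs c Mc].
- have [Mc cp] := chart_atP p.
  have E q : chart_dom (chart_at p) q -> (f \o chart_inv (chart_at p)) (chart_at p q) = f q.
    by move=> cq; rewrite /= chart_mapK.
  exact: ((smooth_on_chart Mc E).1 (fs _ Mc) p cp).
- have E q : chart_dom c q -> (f \o chart_inv c) (c q) = f q.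
    by move=> cq; rewrite /= chart_mapK.
  by apply: ((smooth_on_chart Mc E).2).
Qed.

Definition endo_mx (theta : endo_field M) p : 'M[R]_m :=
  lin1_mx (theta p : 'rV[R]_m -> 'rV[R]_m).

Lemma endo_mxE (theta : endo_field M) p (u : tangent p) : theta p u = (u : 'rV[R]_m) *m endo_mx theta p.
Proof. by rewrite /endo_mx mul_rV_lin1. Qed.

Lemma smooth_endo_fieldP (theta : endo_field M) :
  smooth_endo_field theta <-> forall p, smooth_end11 p (endo_mx theta).
Proof.
have E c i q : atlas M c -> chart_dom c q ->
    tcoord c (theta (chart_inv c (c q)) (frame c i (chart_inv c (c q)))) =
    row i (end11 c (endo_mx theta) q).
  move=> Mc cq; have ac := admissible_atlas Mc.
  by rewrite chart_mapK// tcoordE// endo_mxE frameE /end11 -!row_mul.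
split=> [ts p|ts c i Mc].
- have [Mc cp] := chart_atP p; split=> i j.
  have H := (smooth_on_chart_mx Mc (fun q => E _ i q Mc)).1 (ts _ i Mc) p cp.
  apply: (smooth_fun_eq _ (smooth_mx_entry 0 j H)).
  by near=> q; rewrite [LHS]mxE.
- apply: ((smooth_on_chart_mx Mc (fun q => E _ i q Mc)).2) => p cp.
  have ac := admissible_atlas Mc.
  have [ts'] := (smooth_end11E _ ac cp).1 (ts p); split=> k j.
  apply: (smooth_fun_eq _ (ts' i j)).
  by near=> q; rewrite [RHS]mxE.
Unshelve. all: by end_near. Qed.

Definition endo_of_mx (T : M -> 'M[R]_m) : endo_field M :=
  fun p => (mulmxr (T p) : {linear 'rV[R]_m -> 'rV[R]_m}).

Lemma endo_of_mxK T p : endo_mx (endo_of_mx T) p = T p.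
Proof. by apply/row_matrixP => i; rewrite !rowE mul_rV_lin1. Qed.

End Tensors.

Section FormsMetrics.
Context {R : realType} {m : nat} {M : smooth_manifold R m}.
Implicit Types (c : chart R m M) (p q : M).

Lemma mxform_frame (A F : 'M[R]_m) i j : mxform A (row i F) (row j F) = (F *m A *m F^T) i j.
Proof. by rewrite -mxform_delta mxform_conj -!rowE. Qed.

Lemma ord2P (i : 'I_2) : i = ord0 \/ i = ord_max.
Proof. by case: i => [[|[|//]] ?]; [left|right]; exact: val_inj. Qed.

Lemma form2E (A : 'M[R]_m) v : form2 A v = mxform A (v ord0) (v ord_max).
Proof. by []. Qed.

Definition metric_of_mx (G : M -> 'M[R]_m) : metric_field M :=
  fun p u v => mxform (G p) u v.

Lemma metric_of_mxP (G : M -> 'M[R]_m) : (forall p, (G p)^T = G p) ->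
  (forall p u, u != 0 -> 0 < mxform (G p) u u) ->
  (forall p, smooth_cov2 p G) -> riemannian_metric (metric_of_mx G).
Proof.
move=> Gs Gp Gsm; split.
- by move=> p a u v w; rewrite /metric_of_mx mxformDl mxformZl.
- by move=> p u v; rewrite /metric_of_mx -{1}(Gs p) mxform_tr.
- by move=> p u u0; exact: Gp.
move=> c i j Mc; have ac := admissible_atlas Mc.
apply: (smooth_on_chart Mc (F := fun q => cov2 c G q i j) _).2 => [q cq|p cp].
  by rewrite /= chart_mapK// !frameE /metric_of_mx mxform_frame.
by apply: smooth_mx_entry; exact: ((smooth_cov2E _ ac cp).1 (Gsm p)).
Qed.

Lemma riemannian_mx (g : metric_field M) : riemannian_metric g ->
  exists G : M -> 'M[R]_m, [/\ forall p u v, g p u v = mxform (G p) u v,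
    forall p, (G p)^T = G p, forall p u, u != 0 -> 0 < mxform (G p) u u &
    forall p, smooth_cov2 p G].
Proof.
move=> [gl gs gp gsm].
pose G p : 'M[R]_m := \matrix_(i, j) g p (delta_mx 0 i) (delta_mx 0 j).
have gE p u v : g p u v = mxform (G p) u v.
  apply: (@bilinear_mxform R m (g p)) => a x y w; first exact: gl.
  by rewrite gs gl !(gs p w).
exists G; split=> // [p|p u u0|p].
- by apply/matrixP => i j; rewrite !mxE gs.
- by rewrite -gE; exact: gp.
have [Mc cp] := chart_atP p; split=> i j.
apply: (smooth_on_chart Mc (F := fun q => cov2 (chart_at p) G q i j) _).1 (gsm _ i j Mc) _ cp.
by move=> q cq; rewrite /= chart_mapK// gE !frameE mxform_frame.
Qed.

Definition form2_of_mx (A : M -> 'M[R]_m) : kform M 2 := fun p v => form2 (A p) v.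

Lemma form2_of_mxP (A : M -> 'M[R]_m) : (forall p, (A p)^T = - A p) ->
  (forall p, smooth_cov2 p A) -> differential_form (form2_of_mx A).
Proof.
move=> As Asm; split.
- move=> p v i a x y; rewrite /form2_of_mx !form2E.
  by case: (ord2P i) => ->; rewrite /= ?mxformDl ?mxformZl ?mxformDr ?mxformZr.
- move=> p v i j ij vij; rewrite /form2_of_mx form2E.
  have -> : v ord_max = v ord0.
    by case: (ord2P i) (ord2P j) ij vij => -> [] ->.
  by rewrite /mxform skew_quad ?mxE.
- move=> c i Mc; have ac := admissible_atlas Mc.
  apply: (smooth_on_chart Mc (F := fun q => cov2 c A q (i ord0) (i ord_max)) _).2 => [q cq|p cp].
    by rewrite /= chart_mapK// /form2_of_mx form2E !frameE mxform_frame.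
  by apply: smooth_mx_entry; exact: ((smooth_cov2E _ ac cp).1 (Asm p)).
Qed.

Lemma differential_form2_mx (w : kform M 2) : differential_form w ->
  exists A : M -> 'M[R]_m, [/\ forall p, w p = form2 (A p),
    forall p, (A p)^T = - A p & forall p, smooth_cov2 p A].
Proof.
move=> [wl wa wsm].
pose pr (u v : 'rV[R]_m) : 'I_2 -> 'rV[R]_m := fun k => if k == ord0 then u else v.
have prE (v : 'I_2 -> 'rV[R]_m) : v = pr (v ord0) (v ord_max).
  by apply/funext => k; case: (ord2P k) => ->.
pose B p u v : R := w p (pr u v).
have Bl p a x y v : B p (a *: x + y) v = a * B p x v + B p y v.
  have E z : pr z v = [eta pr 0 v with ord0 |-> z].
    by apply/funext => k; case: (ord2P k) => ->.
  by rewrite /B (E (_ + _)) wl -!E.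
have Br p a x y v : B p v (a *: x + y) = a * B p v x + B p v y.
  have E z : pr v z = [eta pr v 0 with ord_max |-> z].
    by apply/funext => k; case: (ord2P k) => ->.
  by rewrite /B (E (_ + _)) wl -!E.
have B0 p u : B p u u = 0 by exact: (wa p (pr u u) ord0 ord_max).
pose A p : 'M[R]_m := \matrix_(i, j) B p (delta_mx 0 i) (delta_mx 0 j).
have wE p : w p = form2 (A p).
  apply/funext => v; rewrite form2E -(bilinear_mxform (Bl p) (Br p)).
  by rewrite /B -prE.
exists A; split=> // [p|p].
- apply/matrixP => i j; rewrite !mxE; set x := delta_mx 0 j; set y := delta_mx 0 i.
  have := B0 p (1 *: x + y); rewrite Bl Br (Br p 1 x y y) !B0 !mul1r add0r addr0 => /eqP.
  by rewrite addr_eq0 => /eqP.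
have [Mc cp] := chart_atP p; split=> i j.
apply: (smooth_on_chart Mc (F := fun q => cov2 (chart_at p) A q i j) _).1
  (wsm _ (fun k => if k == ord0 then i else j) Mc) _ cp.
by move=> q cq; rewrite /= chart_mapK// wE form2E !frameE mxform_frame.
Qed.

Definition form1_of_mx (a : M -> 'rV[R]_m) : kform M 1 := fun p v => form1 (a p) v.

Lemma form1E (a : 'rV[R]_m) v : form1 a v = \sum_j v ord0 0 j * a 0 j.
Proof. by rewrite /form1 mxE; apply: eq_bigr => j _; rewrite !mxE. Qed.

Lemma form1_of_mxP (a : M -> 'rV[R]_m) : (forall p, smooth_cov1 p a) ->
  differential_form (form1_of_mx a).
Proof.
move=> asm; split.
- move=> p v i t x y; rewrite /form1_of_mx /form1 ord1/=.
  by rewrite mulmxDl -scalemxAl !mxE.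
- by move=> p v i j; rewrite !ord1 eqxx.
- move=> c i Mc; have ac := admissible_atlas Mc.
  apply: (smooth_on_chart Mc (F := fun q => cov1 c a q 0 (i ord0)) _).2 => [q cq|p cp].
    rewrite /= chart_mapK// /form1_of_mx form1E frameE /cov1 mxE.
    by apply: eq_bigr => j _; rewrite !mxE mulrC.
  by apply: smooth_mx_entry; exact: ((smooth_cov1E _ ac cp).1 (asm p)).
Qed.

Lemma differential_form1_mx (w : kform M 1) : differential_form w ->
  exists a : M -> 'rV[R]_m, (forall p, w p = form1 (a p)) /\ (forall p, smooth_cov1 p a).
Proof.
move=> [wl _ wsm].
pose a p : 'rV[R]_m := \row_j w p (fun=> delta_mx 0 j).
have wE p : w p = form1 (a p).
  apply/funext => v; rewrite form1E.
  have -> : v = fun=> v ord0 by apply/funext => k; rewrite ord1.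
  have L t x y : w p (fun=> t *: x + y) = t * w p (fun=> x) + w p (fun=> y).
    have E z : (fun=> z) = [eta (fun _ : 'I_1 => 0 : tangent p) with ord0 |-> z].
      by apply/funext => k; rewrite /= ord1 eqxx.
    by rewrite (E (_ + _)) wl -!E.
  rewrite (@scalar_linear_row R m (fun x => w p (fun=> x)) L).
  by apply: eq_bigr => j _; rewrite mxE.
exists a; split=> // p.
have [Mc cp] := chart_atP p; split=> i j; rewrite ord1.
apply: (smooth_on_chart Mc (F := fun q => cov1 (chart_at p) a q 0 j) _).1
  (wsm _ (fun=> j) Mc) _ cp.
move=> q cq; rewrite /= chart_mapK// wE form1E frameE /cov1 mxE.
by apply: eq_bigr => k _; rewrite !mxE mulrC.
Qed.

End FormsMetrics.

(** * Existence of metrics *)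

Section TensorClosure.
Context {R : realType} {m : nat} {M : smooth_manifold R m}.
Implicit Types (c : chart R m M) (p q : M).

Lemma frame_unit_near c p : admissible c -> chart_dom c p ->
  \forall q \near p, frame_mx c q \in unitmx.
Proof.
move=> ac cp; have := chart_dom_near cp; apply: filterS => q; exact: frame_mx_unit.
Qed.

Let fu p := frame_unit_near (@chart_at_adm R m M p) (chart_at_dom p).

Lemma smooth_end11M p S T : smooth_end11 p S -> smooth_end11 p T ->
  smooth_end11 p (fun q => S q *m T q).
Proof.
move=> Ss Ts; apply: smooth_mx_eq (smooth_mxM Ss Ts).
apply: filterS (fu p) => q Fq; rewrite /end11 !mulmxA.
by rewrite mulmxKV.
Qed.

Lemma smooth_end11D p S T : smooth_end11 p S -> smooth_end11 p T ->
  smooth_end11 p (fun q => S q + T q).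
Proof.
move=> Ss Ts; apply: smooth_mx_eq (smooth_mxD Ss Ts).
by near=> q; rewrite /end11 mulmxDr mulmxDl.
Unshelve. all: by end_near. Qed.

Lemma smooth_end11Z p w T : smooth_fun p w -> smooth_end11 p T ->
  smooth_end11 p (fun q => w q *: T q).
Proof.
move=> ws Ts; apply: smooth_mx_eq (smooth_mxZ ws Ts).
by near=> q; rewrite /end11 -scalemxAr -scalemxAl.
Unshelve. all: by end_near. Qed.

Lemma smooth_end11N p T : smooth_end11 p T -> smooth_end11 p (fun q => - T q).
Proof.
move=> Ts; apply: smooth_mx_eq (smooth_mxN Ts).
by near=> q; rewrite /end11 mulmxN mulNmx.
Unshelve. all: by end_near. Qed.

Lemma smooth_end11_1 p : smooth_end11 p (fun=> 1%:M).
Proof.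
apply: smooth_mx_eq (smooth_mx_cst p 1%:M).
by apply: filterS (fu p) => q Fq; rewrite /end11 mulmx1 mulmxV.
Qed.

Lemma invmxM n (P Q : 'M[R]_n) : P \in unitmx -> Q \in unitmx ->
  invmx (P *m Q) = invmx Q *m invmx P.
Proof.
move=> Pu Qu; have PQu : P *m Q \in unitmx by rewrite unitmx_mul Pu.
by apply: (row_free_inj (_ : row_free (P *m Q))); rewrite ?row_free_unit// mulVmx// mulmxA mulmxKV// mulVmx.
Qed.

Lemma smooth_end11V p T : (\forall q \near p, T q \in unitmx) -> smooth_end11 p T ->
  smooth_end11 p (fun q => invmx (T q)).
Proof.
move=> Tu Ts; have Eu : \forall q \near p, frame_mx (chart_at p) q \in unitmx /\ T q \in unitmx.
  near=> q; split; near: q; [exact: fu|exact: Tu].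
have Vu : \forall q \near p, end11 (chart_at p) T q \in unitmx.
  by apply: filterS Eu => q [Fq Tq]; rewrite /end11 !unitmx_mul Fq Tq unitmx_inv.
apply: smooth_mx_eq (smooth_mxV Vu Ts).
apply: filterS Eu => q [Fq Tq]; rewrite /end11.
by rewrite invmxM ?unitmx_inv// ?unitmx_mul ?Fq// invmxM// invmxK mulmxA.
Unshelve. all: by end_near. Qed.

Lemma smooth_cov2D p S T : smooth_cov2 p S -> smooth_cov2 p T ->
  smooth_cov2 p (fun q => S q + T q).
Proof.
move=> Ss Ts; apply: smooth_mx_eq (smooth_mxD Ss Ts).
by near=> q; rewrite /cov2 mulmxDr mulmxDl.
Unshelve. all: by end_near. Qed.

Lemma smooth_cov2Z p w T : smooth_fun p w -> smooth_cov2 p T ->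
  smooth_cov2 p (fun q => w q *: T q).
Proof.
move=> ws Ts; apply: smooth_mx_eq (smooth_mxZ ws Ts).
by near=> q; rewrite /cov2 -scalemxAr -scalemxAl.
Unshelve. all: by end_near. Qed.

Lemma smooth_cov2T p T : smooth_cov2 p T -> smooth_cov2 p (fun q => (T q)^T).
Proof.
move=> Ts; apply: smooth_mx_eq (smooth_mxT Ts).
by near=> q; rewrite /cov2 !trmx_mul trmxK mulmxA.
Unshelve. all: by end_near. Qed.

Lemma smooth_cov1D p S T : smooth_cov1 p S -> smooth_cov1 p T ->
  smooth_cov1 p (fun q => S q + T q).
Proof.
move=> Ss Ts; apply: smooth_mx_eq (smooth_mxD Ss Ts).
by near=> q; rewrite /cov1 mulmxDl.
Unshelve. all: by end_near. Qed.

Lemma smooth_cov1Z p w T : smooth_fun p w -> smooth_cov1 p T ->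
  smooth_cov1 p (fun q => w q *: T q).
Proof.
move=> ws Ts; apply: smooth_mx_eq (smooth_mxZ ws Ts).
by near=> q; rewrite /cov1 -scalemxAl.
Unshelve. all: by end_near. Qed.

Lemma smooth_vecD p S T : smooth_vec p S -> smooth_vec p T ->
  smooth_vec p (fun q => S q + T q).
Proof.
move=> Ss Ts; apply: smooth_mx_eq (smooth_mxD Ss Ts).
by near=> q; rewrite /vec mulmxDl.
Unshelve. all: by end_near. Qed.

Lemma smooth_vecZ p w T : smooth_fun p w -> smooth_vec p T ->
  smooth_vec p (fun q => w q *: T q).
Proof.
move=> ws Ts; apply: smooth_mx_eq (smooth_mxZ ws Ts).
by near=> q; rewrite /vec -scalemxAl.
Unshelve. all: by end_near. Qed.

Lemma smooth_end11_cov2 p T G : smooth_end11 p T -> smooth_cov2 p G ->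
  smooth_cov2 p (fun q => T q *m G q).
Proof.
move=> Ts Gs; apply: smooth_mx_eq (smooth_mxM Ts Gs).
by apply: filterS (fu p) => q Fq; rewrite /end11 /cov2 !mulmxA mulmxKV.
Qed.

Lemma smooth_tensor11 p a X : smooth_cov1 p a -> smooth_vec p X ->
  smooth_end11 p (fun q => (a q)^T *m X q).
Proof.
move=> Ts Gs; apply: smooth_mx_eq (smooth_mxM (smooth_mxT Ts) Gs).
by near=> q; rewrite /end11 /vec /cov1 trmx_mul trmxK !mulmxA.
Unshelve. all: by end_near. Qed.

Lemma cov2_unit c (G : M -> 'M[R]_m) q : frame_mx c q \in unitmx -> G q \in unitmx ->
  cov2 c G q \in unitmx.
Proof. by move=> Fq Gq; rewrite /cov2 !unitmx_mul unitmx_tr Fq Gq. Qed.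

(** Raising an index: the frame factors of the two tensors combine into the conjugation proper to
    endomorphisms. *)
Lemma smooth_cov2_div p A G : (forall q, G q \in unitmx) -> smooth_cov2 p A ->
  smooth_cov2 p G -> smooth_end11 p (fun q => A q *m invmx (G q)).
Proof.
move=> Gu As Gs.
have Vu : \forall q \near p, cov2 (chart_at p) G q \in unitmx.
  by apply: filterS (fu p) => q Fq; exact: cov2_unit.
apply: smooth_mx_eq (smooth_mxM As (smooth_mxV Vu Gs)).
apply: filterS (fu p) => q Fq; rewrite /end11 /cov2.
have FTu : (frame_mx (chart_at p) q)^T \in unitmx by rewrite unitmx_tr.
by rewrite invmxM// ?unitmx_mul ?Fq ?Gu// (invmxM Fq (Gu q)) !mulmxA mulmxK.
Qed.

Lemma posdef_unit n (G : 'M[R]_n) : (forall u, u != 0 -> 0 < mxform G u u) -> G \in unitmx.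
Proof.
move=> Gp; apply: unit_of_inj => u uG; have [//|u0] := eqVneq u 0.
by have := Gp u u0; rewrite /mxform uG mul0mx mxE ltxx.
Qed.

Lemma metric_exists : exists G : M -> 'M[R]_m, forall p,
  [/\ (G p)^T = G p, forall u, u != 0 -> 0 < mxform (G p) u u & smooth_cov2 p G].
Proof.
pose valid (p : M) (G : 'M[R]_m) := G^T = G /\ forall u, u != 0 -> 0 < mxform G u u.
have [] := @glue_sections R m M 'M[R]_m 0 valid (fun p => smooth_cov2 p)
  (fun p a b t => (1 - t) *: a + t *: b); first last.
- by move=> G HG; exists G => p; have [[]] := HG p; split.
- move=> p; have ac := chart_at_adm p; have cp := chart_at_dom p; set c := chart_at p in ac cp.
  (* The metric for which the coordinate frame of [c] is orthonormal. *)
  pose s q := invmx (frame_mx c q) *m (invmx (frame_mx c q))^T.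
  exists s; have := chart_dom_near cp; apply: filterS => q cq.
  have Fq := frame_mx_unit ac cq.
  split; last first.
    apply/(smooth_cov2E _ ac cq); apply: smooth_mx_eq (smooth_mx_cst q 1%:M).
    apply: filterS (frame_unit_near ac cq) => z Fz.
    by rewrite /cov2 /s mulmxA mulmxV// mul1mx -trmx_mul mulmxV// trmx1.
  split=> [|u u0]; first by rewrite /s trmx_mul trmxK.
  rewrite /mxform /s mulmxA -mulmxA -trmx_mul; set w := u *m _.
  have w0 : w != 0.
    by apply: contra u0 => /eqP w0; rewrite -[u](mulmxKV Fq) -/w w0 mul0mx.
  move: w w0 => {u0} w w0.
  have [i wi] : exists i, w 0 i != 0.
    apply/existsP; apply: contraNT w0; rewrite negb_exists => /forallP wi.
    by apply/eqP/rowP => j; have := wi j; rewrite negbK => /eqP ->; rewrite mxE.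
  rewrite mxE (bigD1 i)//= mxE ltr_pwDl//.
    by rewrite -expr2 exprn_even_gt0//= wi orbT.
  by apply: sumr_ge0 => j _; rewrite mxE -expr2 sqr_ge0.
- move=> p s t w H; have [[_ ss] [_ ts] ws _] := nbhs_singleton H.
  apply: smooth_cov2D; apply: smooth_cov2Z => //.
  by apply: smooth_funD; [exact: smooth_fun_cst|exact: smooth_funN].
- move=> p a b t [as_ ap] [bs bp] /andP[t0 t1]; split=> [|u u0].
    by rewrite linearD/= !linearZ/= as_ bs.
  have E : mxform ((1 - t) *: a + t *: b) u u = (1 - t) * mxform a u u + t * mxform b u u.
    by rewrite /mxform mulmxDr mulmxDl -!scalemxAr -!scalemxAl !mxE.
  rewrite E; have := ap u u0; have := bp u u0; nra.
- by move=> p a b _ _; rewrite subrr scale0r add0r scale1r.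
- by move=> p a b _ _; rewrite subr0 scale0r addr0 scale1r.
- by move=> p s t; exact: smooth_cov2_eq.
Qed.

End TensorClosure.

(** * Almost cosymplectic structures *)

Section Volume.
Context {R : realType}.

Lemma wedge_pow_pull n m (A F : 'M[R]_m) v :
  wedge_pow (form2 A) n (fun i => v i *m F) = wedge_pow (form2 (F *m A *m F^T)) n v.
Proof.
elim: n v => [//|n IHn] v /=; rewrite /wedge; congr (_ * _).
apply: eq_bigr => s _; congr (_ * _ * _); last exact: (IHn (fun j => v (s (rshift 2 j)))).
by rewrite !form2E mxform_conj.
Qed.

Lemma volume_pull n m (A F : 'M[R]_m) a v :
  volume (n := n) A a (fun i => v i *m F) = volume (n := n) (F *m A *m F^T) (a *m F^T) v.
Proof.
rewrite /volume /wedge; congr (_ * _); apply: eq_bigr => s _; congr (_ * _ * _).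
  exact: (wedge_pow_pull A F (fun i => v (s (lshift 1 i)))).
by rewrite /form1 trmx_mul trmxK mulmxA.
Qed.

Lemma volume_linear n m (A : 'M[R]_m) s t a b v :
  volume (n := n) A (s *: a + t *: b) v = s * volume A a v + t * volume A b v.
Proof.
rewrite /volume /wedge [X in _ = X + _]mulrCA [X in _ = _ + X]mulrCA -mulrDr; congr (_ * _).
rewrite !mulr_sumr -big_split/=; apply: eq_bigr => q _.
have -> w : form1 (s *: a + t *: b) w = s * form1 a w + t * form1 b w.
  by rewrite /form1 linearD/= !linearZ/= mulmxDr -!scalemxAr !mxE.
move: (_ ^+ _) (wedge_pow _ _ _) (form1 _ _) (form1 _ _) => w x y z.
by ring.
Qed.

Context {m : nat} {M : smooth_manifold R m}.

Lemma smooth_wedge_pow n p (A : M -> 'M[R]_m) v : smooth_mx p A ->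
  smooth_fun p (fun q => wedge_pow (form2 (A q)) n v).
Proof.
move=> As; elim: n v => [|n IHn] v; first exact: smooth_fun_cst.
apply: (smooth_funM (smooth_fun_cst _ _)); apply: smooth_fun_sum => s.
apply: smooth_funM; last exact: (IHn (fun j => v (s (rshift 2 j)))).
apply: (smooth_funM (smooth_fun_cst _ _)).
apply: (smooth_mx_entry 0 0 (smooth_mxM (smooth_mxM (smooth_mx_cst p _) As) (smooth_mx_cst p _))).
Qed.

Lemma smooth_volume n p (A : M -> 'M[R]_m) a v : smooth_mx p A ->
  smooth_fun p (fun q => volume (n := n) (A q) a v).
Proof.
move=> As; apply: (smooth_funM (smooth_fun_cst _ _)); apply: smooth_fun_sum => s.
apply: smooth_funM; last exact: smooth_fun_cst.
apply: (smooth_funM (smooth_fun_cst _ _)).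
exact: (smooth_wedge_pow (fun i => v (s (lshift 1 i))) As).
Qed.

End Volume.

Section Cosymplectic.
Context {R : realType} {n : nat} {M : smooth_manifold R (2 * n).+1}.
Local Notation m := (2 * n).+1.

Lemma odd_dim : (n * 2 + 1)%N = m. Proof. by rewrite mulnC addn1. Qed.

Lemma almost_cosymplecticP :
  (exists (omega : kform M 2) (eta : kform M 1), almost_cosymplectic omega eta) <->
  (exists (A : M -> 'M[R]_m) (a : M -> 'rV[R]_m), forall p,
    [/\ (A p)^T = - A p, nondeg (A p) (a p), smooth_cov2 p A & smooth_cov1 p a]).
Proof.
split=> [[w [h [fw fh vol]]]|[A [a H]]].
- have [A [wA As Asm]] := differential_form2_mx fw.
  have [a [ha asm]] := differential_form1_mx fh.
  exists A, a => p; split=> //.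
  apply/(volume_nondeg odd_dim (As p)); have [v] := vol p.
  by rewrite wA ha; exists v.
- exists (form2_of_mx A), (form1_of_mx a); split.
  + by apply: form2_of_mxP => p; have [] := H p.
  + by apply: form1_of_mxP => p; have [] := H p.
  + move=> p; have [As nd _ _] := H p.
    exact: ((volume_nondeg odd_dim As (a p)).2 nd).
Qed.

(** For [u] in both kernels phi^2 u = - u, so evaluating the 2-form at (u, phi u) gives - g(u, u) -
    g(phi u, phi u); this must be 0, hence u = 0. *)
Lemma cosymplectic_of_contact (phi : endo_field M) (xi : vector_field M) (eta : kform M 1) :
  almost_contact phi xi eta ->
  exists (omega : kform M 2) (eta : kform M 1), almost_cosymplectic omega eta.
Proof.
have aux (x y : R) : 0 < x -> 0 <= y -> - x - y = 0 -> False by move=> *; lra.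
move=> [phis xis etas reeb1 sqr].
have [a [ha asm]] := differential_form1_mx etas.
have [G HG] := @metric_exists R m M.
pose T := endo_mx phi.
have Ts := (smooth_endo_fieldP phi).1 phis.
apply/almost_cosymplecticP; exists (fun p => G p *m (T p)^T - T p *m G p), a => p.
have [Gs Gp Gsm] := HG p; split=> //.
- by rewrite linearB/= !trmx_mul trmxK Gs opprB.
- move=> u uA ua; have [//|u0] := eqVneq u 0.
  have TT : u *m T p *m T p = - u.
    have := sqr p u; rewrite !endo_mxE ha -/T => ->.
    rewrite /form1 ua mxE scale0r addr0//.
  have : mxform (G p *m (T p)^T - T p *m G p) u (u *m T p) = 0.
    by rewrite /mxform uA mul0mx mxE.
  have -> : mxform (G p *m (T p)^T - T p *m G p) u (u *m T p) =
      - mxform (G p) u u - mxform (G p) (u *m T p) (u *m T p).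
    rewrite /mxform mulmxBr mulmxBl.
    have -> : u *m (G p *m (T p)^T) *m (u *m T p)^T = - (u *m G p *m u^T).
      by rewrite mulmxA -(mulmxA (u *m G p)) -trmx_mul TT linearN mulmxN.
    by rewrite (mulmxA u (T p)) !mxE.
  have := Gp u u0; have : 0 <= mxform (G p) (u *m T p) (u *m T p).
    have [->|w0] := eqVneq (u *m T p) 0; last exact/ltW/Gp.
    by rewrite /mxform !mul0mx mxE.
  by move=> h1 h2 /(aux _ _ h2 h1).
- have H := smooth_end11_cov2 (Ts p) Gsm.
  apply: smooth_cov2_eq (smooth_cov2D (smooth_cov2T H) (smooth_cov2Z (smooth_fun_cst p (-1)) H)).
  near=> q; have [Gsq _ _] := HG q.
  by rewrite trmx_mul Gsq scaleN1r.
Unshelve. all: by end_near. Qed.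

(* eta is glued among the covectors making omega^n /\ eta positive on the
   oriented frames, which is a convex condition. *)
Lemma cosymplectic_of_rank (A : M -> 'M[R]_m) : orientable M ->
  (forall p, [/\ (A p)^T = - A p, \rank (A p) = (2 * n)%N & smooth_cov2 p A]) ->
  exists (omega : kform M 2) (eta : kform M 1), almost_cosymplectic omega eta.
Proof.
move=> [B [Bcov Bcomp Bor]] HA.
have Badm b : B b -> admissible b by move=> Bb c Mc; exact: Bcomp.
pose valid (p : M) (a : 'rV[R]_m) := forall b, B b -> chart_dom b p ->
  0 < volume (n := n) (A p) a (row_cast odd_dim (frame_mx b p)).
have [] := @glue_sections R m M 'rV[R]_m 0 valid (fun p => smooth_cov1 p)
  (fun p a b t => (1 - t) *: a + t *: b); first last.
- move=> a Ha; apply/almost_cosymplecticP; exists A, a => p.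
  have [va asm] := Ha p; have [As rA Asm] := HA p; split=> //.
  have [b [Bb bp]] := Bcov p.
  apply/(volume_nondeg odd_dim As); exists (row_cast odd_dim (frame_mx b p)).
  by rewrite gt_eqF// va.
- move=> p; have [b [Bb bp]] := Bcov p; have ab := Badm b Bb.
  have [As rA Asm] := HA p.
  have Fp := frame_mx_unit ab bp.
  have [a0 a0p] : exists a, 0 < volume (n := n) (A p) a (row_cast odd_dim (frame_mx b p)).
    by apply: volume_pos => //; rewrite rA mulnC.
  (* [a0] is extended with constant components in the chart [b]. *)
  pose a1 := a0 *m (frame_mx b p)^T.
  pose s q := a1 *m (invmx (frame_mx b q))^T.
  have row_castM (F : 'M[R]_m) : row_cast odd_dim F = fun i => row_cast odd_dim 1%:M i *m F.
    by apply/funext => i; rewrite /row_cast -row_mul mul1mx.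
  have sb q : frame_mx b q \in unitmx -> cov1 b s q = a1.
    by move=> Fq; rewrite /cov1 /s -mulmxA -trmx_mul mulmxV// trmx1 mulmx1.
  (* Rewritten in components of [b], the volume of the coordinate frame is continuous at [p], so
     positivity persists nearby. *)
  pose f q := volume (n := n) (cov2 b A q) a1 (row_cast odd_dim 1%:M).
  have fE q : frame_mx b q \in unitmx ->
      volume (n := n) (A q) (s q) (row_cast odd_dim (frame_mx b q)) = f q.
    by move=> Fq; rewrite row_castM volume_pull -/(cov1 b s q) sb.
  have f0 : nbhs p [set q | 0 < f q].
    have fc : {for p, continuous f}.
      apply: smooth_fun_continuous; apply: smooth_volume.
      exact: ((smooth_cov2E _ ab bp).1 Asm).
    have := fc [set r | 0 < r]; apply; apply: open_nbhs_nbhs; split; first exact: open_gt.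
    rewrite /= -fE// (_ : s p = a0)//.
    by rewrite /s /a1 -mulmxA -trmx_mul mulVmx// trmx1 mulmx1.
  exists s; have dn := chart_dom_near bp.
  near=> q; have bq : chart_dom b q by near: q.
  have fq : 0 < f q by near: q.
  have Fq := frame_mx_unit ab bq; split.
  + move=> b' Bb' b'q; have ab' := Badm b' Bb'.
    (* Passing to another oriented chart multiplies the volume by a positive Jacobian
       determinant. *)
    rewrite -(frame_mx_jac ab' ab b'q bq) volume_frame; last by have [] := HA q.
    by rewrite fE// mulr_gt0// -jacobian_jac; exact: Bor.
  + apply/(smooth_cov1E _ ab bq); apply: smooth_mx_eq (smooth_mx_cst q a1).
    by apply: filterS (frame_unit_near ab bq) => z Fz; rewrite sb.
- move=> p s t w H; have [[_ ss] [_ ts] ws _] := nbhs_singleton H.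
  apply: smooth_cov1D; apply: smooth_cov1Z => //.
  by apply: smooth_funD; [exact: smooth_fun_cst|exact: smooth_funN].
- move=> p a b t va vb /andP[t0 t1] c Bc cp.
  rewrite volume_linear; have := va c Bc cp; have := vb c Bc cp; nra.
- by move=> p a b _ _; rewrite subrr scale0r add0r scale1r.
- by move=> p a b _ _; rewrite subr0 scale0r addr0 scale1r.
- by move=> p s t; exact: smooth_cov1_eq.
Unshelve. all: by end_near. Qed.

End Cosymplectic.

(** * Almost contact structures *)

Section TameConj.
Context {R : realType} {m : nat}.
Variables (F : 'M[R]_m).
Hypothesis Fu : F \in unitmx.

Let FTu : F^T \in unitmx. Proof. by rewrite unitmx_tr. Qed.

Lemma nondeg_conj (A : 'M[R]_m) a : nondeg A a -> nondeg (F *m A *m F^T) (a *m F^T).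
Proof.
move=> nd u uA ua.
have uF : u *m F = 0.
  apply: nd; first by move: uA; rewrite !mulmxA => uA; rewrite -(mulmxK FTu (u *m F *m A)) uA mul0mx.
  by move: ua; rewrite trmx_mul trmxK mulmxA.
by rewrite -(mulmxK Fu u) uF mul0mx.
Qed.

Lemma reeb_conj (A : 'M[R]_m) a : reeb_mx A a \in unitmx ->
  reeb (F *m A *m F^T) (a *m F^T) = reeb A a *m invmx F.
Proof.
move=> Su; have E : reeb_mx (F *m A *m F^T) (a *m F^T) = F *m reeb_mx A a *m F^T.
  by rewrite /reeb_mx trmx_mul trmxK mulmxDr mulmxDl !mulmxA.
by rewrite /reeb E invmxM ?unitmx_mul ?Fu// (invmxM Fu Su) !mulmxA mulmxK.
Qed.

Lemma tame_conj (A : 'M[R]_m) a x g :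
  tame (F *m A *m F^T) (a *m F^T) (x *m invmx F) g -> tame A a x (invmx F *m g *m F).
Proof.
rewrite /tame trmx_mul trmxK => -[gg ga xg pos]; split.
- rewrite !mulmxA mulmxK// -(mulmxA _ g g) gg mulmxDr mulmxDl mulmxN mulmx1 mulNmx mulVmx//.
  by rewrite !mulmxA mulVmx// mul1mx mulmxKV.
- by rewrite -!mulmxA ga mulmx0.
- by rewrite !mulmxA xg mul0mx.
- move=> u u0 ua; set w := u *m invmx F.
  have uE : u = w *m F by rewrite /w mulmxKV.
  have w0 : w != 0 by apply: contra u0 => /eqP w0; rewrite uE w0 mul0mx.
  have wa : w *m (F *m a^T) = 0 by rewrite mulmxA -uE.
  have := pos w w0 wa; rewrite !mulmxA -uE.
  suff -> : u *m invmx F *m g *m F = w *m g *m F by rewrite (trmx_mul (w *m g)) mulmxA.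
  by [].
Qed.

End TameConj.

Section LocalTame.
Context {R : realType} {m : nat}.
Variables (A K f0 : 'M[R]_m) (a0 x0 a x : 'rV[R]_m).
Hypotheses (xa0 : x0 *m a0^T = 1%:M) (xa : x *m a^T = 1%:M).
Hypotheses (ff0 : f0 *m f0 = - 1%:M + a0^T *m x0) (fa0 : f0 *m a0^T = 0) (xf0 : x0 *m f0 = 0).

(* Conjugates the projection Pi0 to Pi as soon as it is invertible, hence for Pi near Pi0. *)
Definition proj_conj (Pi0 Pi : 'M[R]_m) : 'M[R]_m := Pi0 *m Pi + (1%:M - Pi0) *m (1%:M - Pi).

Let Pi0 := a0^T *m x0.
Let Pi := a^T *m x.
Let L := proj_conj Pi0 Pi.

Lemma reeb_proj_idem (b y : 'rV[R]_m) : y *m b^T = 1%:M -> (b^T *m y) *m (b^T *m y) = b^T *m y.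
Proof. by move=> yb; rewrite mulmxA -(mulmxA _ y) yb mulmx1. Qed.

Lemma proj_conj_id (P : 'M[R]_m) : P *m P = P -> proj_conj P P = 1%:M.
Proof.
by move=> PP; rewrite /proj_conj mulmxBr mulmx1 mulmxBl mul1mx PP subrr subr0 addrC subrK.
Qed.

Hypothesis Lu : L \in unitmx.
Hypothesis near1 : forall i j,
  `|(invmx K *m (A *m (invmx L *m f0 *m L)^T + a^T *m a) *m (invmx K)^T) i j - (i == j)%:R| * m%:R < 1.
Hypothesis Ku : K \in unitmx.

Let PiL : Pi0 *m L = L *m Pi.
Proof.
move: (reeb_proj_idem xa0) (reeb_proj_idem xa); rewrite -/Pi0 -/Pi /L /proj_conj.
move: Pi0 Pi => P Q PP QQ; rewrite [LHS]mulmxDr [RHS]mulmxDl !(mulmxA P) PP -(mulmxA P Q Q) QQ.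
by rewrite (mulmxBr P) mulmx1 PP subrr mul0mx -(mulmxA _ _ Q) (mulmxBl _ _ Q) mul1mx QQ subrr mulmx0.
Qed.

(** [L] carries the splitting given by (a0, x0) to that of (a, x), so conjugation by it transports
    the algebraic identities. Positivity holds because omega(., g .) + eta^2 is close to the
    identity in the basis given by [K], and eta^2 is zero on ker eta. *)
Lemma local_tame : tame A a x (invmx L *m f0 *m L).
Proof.
have VL : Pi *m invmx L = invmx L *m Pi0.
  by rewrite -[LHS](mulKmx Lu) (mulmxA L) -PiL -!mulmxA mulmxV// mulmx1.
have Pa : Pi *m a^T = a^T by rewrite /Pi -mulmxA xa mulmx1.
have xP : x *m Pi = x by rewrite /Pi mulmxA xa mul1mx.
have ga : invmx L *m f0 *m L *m a^T = 0.
  by rewrite -Pa mulmxA -(mulmxA _ L) -PiL !mulmxA -(mulmxA _ f0) fa0 mulmx0 !mul0mx.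
split=> //.
- rewrite !mulmxA mulmxK// -(mulmxA _ f0 f0) ff0 (mulmxDr (invmx L)) (mulmxDl _ _ L).
  by rewrite mulmxN mulmx1 mulNmx mulVmx// -/Pi0 -mulmxA PiL mulKmx.
- have xV : x *m invmx L = x *m (invmx L *m Pi0) by rewrite -VL (mulmxA x Pi) xP.
  have Pf : Pi0 *m f0 = 0 by rewrite /Pi0 -mulmxA xf0 mulmx0.
  rewrite (mulmxA x (invmx L *m f0)) (mulmxA x (invmx L)) xV.
  by rewrite -(mulmxA x) -(mulmxA (invmx L)) Pf !mulmx0 mul0mx.
- move=> u u0 ua; set g := invmx L *m f0 *m L.
  have w0 : u *m K != 0.
    by apply: contra u0 => /eqP w0; rewrite -[u](mulmxK Ku) w0 mul0mx.
  have KT : (invmx K)^T *m K^T = 1%:M by rewrite -trmx_mul mulmxV// trmx1.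
  have E (S : 'M[R]_m) : u *m K *m (invmx K *m S *m (invmx K)^T) *m (u *m K)^T = u *m S *m u^T.
    by rewrite (trmx_mul u K) !mulmxA mulmxK// -(mulmxA _ (invmx K)^T) KT mulmx1.
  have := near1_posdef near1 w0; rewrite -/g E (mulmxDr u) (mulmxDl _ _ u^T).
  by rewrite (mulmxA u a^T) ua !mul0mx addr0 (trmx_mul u g) !mulmxA.
Qed.

End LocalTame.

Section ContactOfCosymplectic.
Context {R : realType} {n : nat} {M : smooth_manifold R (2 * n).+1}.
Local Notation m := (2 * n).+1.
Variables (A : M -> 'M[R]_m) (a : M -> 'rV[R]_m).
Hypothesis HA : forall p,
  [/\ (A p)^T = - A p, nondeg (A p) (a p), smooth_cov2 p A & smooth_cov1 p a].

Definition reeb_field (p : M) : 'rV[R]_m := reeb (A p) (a p).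

Lemma cov2_skew c q : (cov2 c A q)^T = - cov2 c A q.
Proof. by have [As _ _ _] := HA q; rewrite /cov2 !trmx_mul trmxK As mulNmx mulmxN mulmxA. Qed.

Lemma cov_nondeg c q : frame_mx c q \in unitmx -> nondeg (cov2 c A q) (cov1 c a q).
Proof. by have [_ nd _ _] := HA q; move=> Fq; exact: nondeg_conj. Qed.

Lemma vec_reeb c q : frame_mx c q \in unitmx ->
  vec c reeb_field q = reeb (cov2 c A q) (cov1 c a q).
Proof.
have [As nd _ _] := HA q; move=> Fq.
by rewrite /vec /cov2 /cov1 reeb_conj// (reeb_mx_unit As nd).
Qed.

Lemma smooth_reeb_mx c p : admissible c -> chart_dom c p ->
  smooth_mx p (fun q => reeb_mx (cov2 c A q) (cov1 c a q)) /\
  smooth_mx p (fun q => invmx (reeb_mx (cov2 c A q) (cov1 c a q))).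
Proof.
move=> ac cp; have [_ _ As as_] := HA p.
have As' := (smooth_cov2E _ ac cp).1 As; have as' := (smooth_cov1E _ ac cp).1 as_.
have S := smooth_mxD As' (smooth_mxM (smooth_mxT as') as').
split; first exact: S.
apply: smooth_mxV S; apply: filterS (frame_unit_near ac cp) => q Fq.
by apply: reeb_mx_unit; [exact: cov2_skew|exact: cov_nondeg].
Qed.

Lemma smooth_reeb p : smooth_vec p reeb_field.
Proof.
have ac := @chart_at_adm R m M p; have cp := @chart_at_dom R m M p.
have [_ _ _ as_] := HA p.
have [_ S] := smooth_reeb_mx ac cp.
apply: smooth_mx_eq (smooth_mxM as_ S).
by apply: filterS (frame_unit_near ac cp) => q Fq; rewrite vec_reeb.
Qed.

Lemma reeb_field_a p : reeb_field p *m (a p)^T = 1%:M.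
Proof.
have [As nd _ _] := HA p; have [ar _ _ _ _] := reeb_spec (@odd_dim n) As nd.
by rewrite -[LHS]trmxK trmx_mul trmxK ar trmx1.
Qed.

(** At [p] linear algebra provides [f0]. Nearby, its components in the chart are corrected by
    conjugation with [L q], which is the identity at [p]; tameness persists because the test matrix
    [N] is continuous and equals 1 at [p]. *)
Lemma local_tame_field (p : M) : exists s, \forall q \near p,
  tame (A q) (a q) (reeb_field q) (s q) /\ smooth_end11 q s.
Proof.
have ac := @chart_at_adm R m M p; have cp := @chart_at_dom R m M p.
set c := chart_at p in ac cp *.
pose Ac := cov2 c A; pose al := cov1 c a; pose x q := reeb (Ac q) (al q).
have Fp := frame_mx_unit ac cp.
have xal q : frame_mx c q \in unitmx -> x q *m (al q)^T = 1%:M.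
  move=> Fq; have [ar _ _ _ _] := reeb_spec (@odd_dim n) (cov2_skew c q) (cov_nondeg Fq).
  by rewrite -[LHS]trmxK trmx_mul trmxK ar trmx1.
have [f0 [K [Ku ff0 fa0 xf0 AK]]] := tame_exists (@odd_dim n) (cov2_skew c p) (cov_nondeg Fp).
pose Pi q := (al q)^T *m x q.
pose L q := proj_conj (Pi p) (Pi q).
have Lp : L p = 1%:M by apply: proj_conj_id; exact/reeb_proj_idem/xal.
pose g q := invmx (L q) *m f0 *m L q.
pose s q := invmx (frame_mx c q) *m g q *m frame_mx c q.
have [_ _ As as_] := HA p.
have As' : smooth_mx p Ac := (smooth_cov2E _ ac cp).1 As.
have as' : smooth_mx p al := (smooth_cov1E _ ac cp).1 as_.
have [_ Ss] := smooth_reeb_mx ac cp.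
have xs : smooth_mx p x by exact: smooth_mxM as' Ss.
have Pis : smooth_mx p Pi by exact: smooth_mxM (smooth_mxT as') xs.
have cst (B : 'M[R]_m) := smooth_mx_cst p B.
have Ls : smooth_mx p L.
  by apply: smooth_mxD; apply: smooth_mxM => //; apply: smooth_mxB.
have Ln : \forall q \near p, L q \in unitmx.
  by apply: smooth_mx_unit_near; rewrite // Lp unitmx1.
have gs : smooth_mx p g.
  by apply: smooth_mxM => //; apply: smooth_mxM => //; exact: smooth_mxV.
pose N q := invmx K *m (Ac q *m (g q)^T + (al q)^T *m al q) *m (invmx K)^T.
have Ns : smooth_mx p N.
  apply: smooth_mxM => //; apply: smooth_mxM => //; apply: smooth_mxD.
    exact: smooth_mxM (smooth_mxT gs).
  exact: smooth_mxM (smooth_mxT as') as'.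
have Np : N p = 1%:M.
  rewrite /N /g Lp invmx1 mul1mx mulmx1 AK mulmxA mulVmx// mul1mx.
  by rewrite -trmx_mul mulVmx// trmx1.
have Nn : \forall q \near p, forall i j, `|N q i j - (i == j)%:R| * m%:R < 1.
  apply: filter_forall => i; apply: filter_forall => j.
  have Nc : N q i j @[q --> p] --> N p i j := smooth_fun_continuous (smooth_mx_entry i j Ns).
  have e0 : 0 < m%:R^-1 :> R by rewrite invr_gt0 ltr0n.
  move/cvgrPdist_lt : Nc => /(_ _ e0); apply: filterS => q.
  rewrite Np mxE distrC => h; rewrite -ltr_pdivlMr ?ltr0n// mul1r.
  exact: h.
exists s.
have sE q : frame_mx c q \in unitmx -> end11 c s q = g q.
  by move=> Fq; rewrite /end11 /s !mulmxA mulmxV// mul1mx mulmxK.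
have gn : \forall q \near p, smooth_mx q g.
  have : \forall q \near p, forall i j, smooth_fun q (fun q => g q i j).
    apply: filter_forall => i; apply: filter_forall => j.
    exact: (smooth_fun_near (smooth_mx_entry i j gs)).
  by apply: filterS => q; split.
have dn := chart_dom_near cp.
near=> q; have cq : chart_dom c q by near: q.
have Fq := frame_mx_unit ac cq.
split.
- apply: (tame_conj Fq); rewrite -[_ *m invmx _]/(vec c reeb_field q) vec_reeb//.
  apply: (@local_tame _ _ (Ac q) K f0 (al p) (x p) (al q) (x q)) => //.
  + exact: xal.
  + exact: xal.
  + by near: q.
  + by near: q.
- apply/(smooth_end11E _ ac cq).
  have gq : smooth_mx q g by near: q.
  apply: smooth_mx_eq gq; apply: filterS (frame_unit_near ac cq) => z Fz.
  by rewrite sE.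
Unshelve. all: by end_near. Qed.

(** [xi] and [eta] are already global, so only [phi] is glued; along the Cayley path the projection
    on the Reeb line stays fixed, and the path depends smoothly on its ends through matrix
    inversion. *)
Lemma contact_of_cosymplectic :
  exists (phi : endo_field M) (xi : vector_field M) (eta : kform M 1),
  almost_contact phi xi eta.
Proof.
pose valid (p : M) f := tame (A p) (a p) (reeb_field p) f.
pose P p := (a p)^T *m reeb_field p.
have [] := @glue_sections R m M 'M[R]_m 0 valid (fun p => smooth_end11 p)
  (fun p f g t => cayley (P p) f g t); first last.
- move=> f Hf; exists (endo_of_mx f), (reeb_field : vector_field M), (form1_of_mx a).
  split.
  + apply/smooth_endo_fieldP => p; have [_ fs] := Hf p.
    apply: smooth_end11_eq fs; near=> q; by rewrite endo_of_mxK.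
  + by apply/smooth_vector_fieldP; exact: smooth_reeb.
  + by apply: form1_of_mxP => p; have [] := HA p.
  + by move=> p; rewrite /form1_of_mx /form1 reeb_field_a mxE.
  + move=> p u; have [[ff _ _ _] _] := Hf p.
    rewrite !endo_mxE endo_of_mxK -mulmxA ff mulmxDr mulmxN mulmx1 mulmxA; congr (_ + _).
    by rewrite [X in X *m _]mx11_scalar mul_scalar_mx.
- exact: local_tame_field.
- move=> p s t w H; have [[vs ss] [vt ts] ws _] := nbhs_singleton H.
  have [_ _ _ as_] := HA p.
  have Ps : smooth_end11 p P by apply: smooth_tensor11 => //; exact: smooth_reeb.
  have Ws : smooth_end11 p (fun q => 1%:M - w q *: cayley_mx (P q) (s q) (t q)).
    apply: smooth_end11D; first exact: smooth_end11_1.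
    apply: smooth_end11N; apply: smooth_end11Z => //.
    apply: smooth_end11M; first by apply: smooth_end11D => //; exact: smooth_end11N.
    apply: smooth_end11V; last by do 2?apply: smooth_end11D.
    apply: filterS H => q [[vsq _] [vtq _] _ _].
    have [As _ _ _] := HA q.
    exact: (cayley_det_half As (reeb_field_a q)).
  apply: smooth_end11M => //; apply: smooth_end11M => //.
  apply: smooth_end11V => //.
  apply: filterS H => q [[vsq _] [vtq _] _ wq].
  have [As _ _ _] := HA q.
  exact: (cayley_unit As (reeb_field_a q)).
- move=> p f g t vf vg t01; have [As _ _ _] := HA p.
  exact: (cayley_tame As (reeb_field_a p)).
- move=> p f g vf vg; have [As _ _ _] := HA p.
  exact: (cayley1 As (reeb_field_a p)).
- by move=> p f g _ _; exact: cayley0.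
- by move=> p s t; exact: smooth_end11_eq.
Unshelve. all: by end_near. Qed.

End ContactOfCosymplectic.

(** * Local solutions of the gauge equation *)

Section LieChart.
Context {R : realType} {m : nat} {M : smooth_manifold R m}.
Implicit Types (c : chart R m M) (p q : M) (X Y : vector_field M).

(** [lie_derivative] is computed in the reference chart at [p]; the chain rule moves it to a chart
    that can be kept fixed near [p]. *)
Lemma lie_chart c p X (f : M -> R) : admissible c -> chart_dom c p -> smooth_fun p f ->
  lie_derivative X f p = chart_derive c (vec c X p) f p.
Proof.
move=> ac cp fs.
have c0p := chart_at_dom p; have ac0 := @chart_at_adm R m M p.
have vE : vec c X p = 'D_(X p) (transition (chart_at p) c) (chart_at p p).
  have d := smooth_at_differentiable (smooth_at_transition_adm ac0 ac c0p cp).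
  rewrite deriveE// -mul_jac /vec -[X in _ *m X = _]mul1mx.
  rewrite -(jac_id c0p) -(jac_comp ac0 ac ac0 c0p cp c0p) -/(frame_mx c p).
  by rewrite mulmxK// frame_mx_unit.
have d1 := smooth_at_differentiable (smooth_at_transition_adm ac0 ac c0p cp).
have d2 : differentiable (f \o chart_inv c : _ -> R^o) (c p).
  exact: smooth_at_differentiable ((smooth_funE _ ac cp).1 fs).
have d0 : differentiable (f \o chart_inv (chart_at p) : _ -> R^o) (chart_at p p).
  exact: smooth_at_differentiable ((smooth_funE _ ac0 c0p).1 fs).
have tp : transition (chart_at p) c (chart_at p p) = c p by rewrite /transition /= chart_mapK.
have d2' : differentiable (f \o chart_inv c : _ -> R^o) (transition (chart_at p) c (chart_at p p)).
  by rewrite tp.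
rewrite /lie_derivative /chart_derive -(deriveE _ d0) vE (deriveE _ d2) (deriveE _ d1) -tp.
apply: (etrans (y := 'd ((f \o chart_inv c : _ -> R^o) \o transition (chart_at p) c) (chart_at p p) (X p))); last first.
  exact: (congr1 (fun h : 'rV[R]_m -> R => h (X p)) (diff_comp d1 d2')).
rewrite -deriveE; last exact: differentiable_comp.
apply: near_eq_derive; have := chart_near_inv c0p (chart_dom_near cp).
by apply: filterS => x cx; rewrite /transition /= chart_mapK.
Qed.

End LieChart.

Section LocalConnection.
Context {R : realType} {m : nat} {M : smooth_manifold R m}.
Variables (c : chart R m M) (Ga : 'rV[R]_m -> M -> 'M[R]_m).
Hypothesis ac : admissible c.
Implicit Types X Y : vector_field M.

(** In components of [c] this is dY(X) + Y Ga(X), with [Ga] the connection matrix; the last factor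
    returns to the reference chart at [q]. *)
Definition local_conn X Y (q : M) : 'rV[R]_m :=
  (mx_derive c (vec c X q) (vec c Y) q + vec c Y q *m Ga (vec c X q) q) *m frame_mx c q.

Variable p : M.
Hypothesis cp : chart_dom c p.
Hypothesis GaL : forall t u v, Ga (t *: u + v) p = t *: Ga u p + Ga v p.

Let Fp : frame_mx c p \in unitmx. Proof. exact: frame_mx_unit. Qed.

Let sv X : smooth_vector_field X -> smooth_mx p (vec c X).
Proof. by move=> /smooth_vector_fieldP Xs; apply/smooth_vecE. Qed.

Lemma local_conn_linear (f : M -> R) X X' Y : smooth_vector_field Y ->
  local_conn (fun q => f q *: X q + X' q : tangent q) Y p = f p *: local_conn X Y p + local_conn X' Y p.
Proof.
move=> Ys; have YS := sv Ys.
have E : vec c (fun q => f q *: X q + X' q) p = f p *: vec c X p + vec c X' p.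
  by rewrite /vec mulmxDl -scalemxAl.
rewrite /local_conn E mx_derive_linear// GaL scalemxAl -mulmxDl; congr (_ *m _).
by rewrite mulmxDr -scalemxAr scalerDr addrACA.
Qed.

Lemma local_conn_additive X Y Y' : smooth_vector_field Y -> smooth_vector_field Y' ->
  local_conn X (fun q => Y q + Y' q : tangent q) p = local_conn X Y p + local_conn X Y' p.
Proof.
move=> Ys Y's; rewrite /local_conn -mulmxDl; congr (_ *m _).
have E q : vec c (fun q => Y q + Y' q) q = vec c Y q + vec c Y' q by rewrite /vec mulmxDl.
have -> : vec c (fun q => Y q + Y' q) = fun q => vec c Y q + vec c Y' q by apply/funext.
rewrite mx_deriveD//; [|exact: sv|exact: sv].
by rewrite mulmxDl addrACA.
Qed.

Lemma local_conn_leibniz (f : M -> R) X Y : smooth_fun p f -> smooth_vector_field Y ->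
  local_conn X (fun q => f q *: Y q : tangent q) p =
  lie_derivative X f p *: (Y p : 'rV[R]_m) + f p *: local_conn X Y p.
Proof.
move=> fs Ys; rewrite /local_conn.
have -> : vec c (fun q => f q *: Y q) = fun q => f q *: vec c Y q.
  by apply/funext => q; rewrite /vec -scalemxAl.
rewrite mx_deriveZ//; last exact: sv.
rewrite (lie_chart X ac cp fs) -scalemxAl -addrA mulmxDl -scalerDr -!scalemxAl; congr (_ *: _ + _).
by rewrite /vec mulmxKV.
Qed.

Lemma local_conn_smooth X Y :
  (forall U, smooth_mx p U -> smooth_mx p (fun q => Ga (U q) q)) ->
  smooth_vector_field X -> smooth_vector_field Y -> smooth_vec p (local_conn X Y).
Proof.
move=> Gs Xs Ys; apply/(smooth_vecE _ ac cp).
apply: smooth_mx_eq (smooth_mxD (smooth_mx_derive_var ac cp (sv Xs) (sv Ys))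
  (smooth_mxM (sv Ys) (Gs _ (sv Xs)))).
apply: filterS (frame_unit_near ac cp) => q Fq.
by rewrite /vec /local_conn mulmxK.
Qed.

End LocalConnection.

Section GaugeSolution.
Context {R : realType} {n : nat} {M : smooth_manifold R (2 * n).+1}.
Local Notation m := (2 * n).+1.
Variables (A G : M -> 'M[R]_m) (a : M -> 'rV[R]_m).
Hypothesis HA : forall p,
  [/\ (A p)^T = - A p, nondeg (A p) (a p), smooth_cov2 p A & smooth_cov1 p a].
Hypothesis HG : forall p,
  [/\ (G p)^T = G p, forall u, u != 0 -> 0 < mxform (G p) u u & smooth_cov2 p G].

Let Gu p : G p \in unitmx.
Proof. by have [_ Gp _] := HG p; exact: posdef_unit. Qed.

Definition gauge_mx (p : M) : 'M[R]_m := A p *m invmx (G p).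

Lemma smooth_gauge_mx p : smooth_end11 p gauge_mx.
Proof.
by have [_ _ As _] := HA p; have [_ _ Gs] := HG p; exact: smooth_cov2_div.
Qed.

Section Chart.
Variable c : chart R m M.
Hypothesis ac : admissible c.

Let Ac := cov2 c A.
Let al := cov1 c a.
Let rr q := reeb (Ac q) (al q).
Let Gc := cov2 c G.
Let Tc := end11 c gauge_mx.

Definition gamma (u : 'rV[R]_m) (q : M) : 'M[R]_m :=
  parallel_gamma (Ac q) (al q) (mx_derive c u Ac q) (mx_derive c u rr q).

(** Obtained by solving dG = gamma G + G dual_gamma^T, the duality relation for the metric in
    components. *)
Definition dual_gamma (u : 'rV[R]_m) (q : M) : 'M[R]_m :=
  (mx_derive c u Gc q - Gc q *m (gamma u q)^T) *m invmx (Gc q).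

Variable p : M.
Hypothesis cp : chart_dom c p.

Let Fp : frame_mx c p \in unitmx. Proof. exact: frame_mx_unit. Qed.
Let As : smooth_mx p Ac.
Proof. by have [_ _ As _] := HA p; apply/smooth_cov2E. Qed.
Let as_ : smooth_mx p al.
Proof. by have [_ _ _ as_] := HA p; apply/smooth_cov1E. Qed.
Let Gs : smooth_mx p Gc.
Proof. by have [_ _ Gs] := HG p; apply/smooth_cov2E. Qed.
Let Ts : smooth_mx p Tc.
Proof. apply/(smooth_end11E _ ac cp); exact: smooth_gauge_mx. Qed.
Let rs : smooth_mx p rr.
Proof. by have [_ S] := smooth_reeb_mx HA ac cp; exact: smooth_mxM as_ S. Qed.

Let skA q : (Ac q)^T = - Ac q. Proof. exact: (cov2_skew HA c q). Qed.
Let ndA : nondeg (Ac p) (al p). Proof. exact: (cov_nondeg HA Fp). Qed.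
Let Gcu : Gc p \in unitmx. Proof. exact: cov2_unit. Qed.
Let Gcs q : (Gc q)^T = Gc q.
Proof. by have [Gq _ _] := HG q; rewrite /Gc /cov2 !trmx_mul trmxK Gq mulmxA. Qed.

Lemma gamma_linear t u v : gamma (t *: u + v) p = t *: gamma u p + gamma v p.
Proof.
rewrite /gamma /parallel_gamma !mx_derive_linear//.
rewrite scalerA mulrC -scalerA -scalerDr; congr (_ *: _).
move: (skew_pinv _ _) => S.
rewrite mulmxDl mulmxDr -scalemxAl -scalemxAr scalerBr opprD.
by rewrite addrACA.
Qed.

Lemma dual_gamma_linear t u v : dual_gamma (t *: u + v) p = t *: dual_gamma u p + dual_gamma v p.
Proof.
rewrite /dual_gamma gamma_linear mx_derive_linear// scalemxAl -mulmxDl; congr (_ *m _).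
rewrite linearD/= linearZ/= mulmxDr -scalemxAr scalerBr opprD.
by rewrite addrACA.
Qed.

Lemma gamma_smooth U : smooth_mx p U -> smooth_mx p (fun q => gamma (U q) q).
Proof.
move=> Us; have [_ S] := smooth_reeb_mx HA ac cp.
apply: smooth_mxZ; first exact: smooth_fun_cst.
apply: smooth_mxB; apply: smooth_mxM.
- exact: smooth_mx_derive_var.
- apply: smooth_mxB; first exact: S.
  exact: (smooth_mxM (smooth_mxT rs) rs).
- exact: smooth_mxT.
- exact: smooth_mx_derive_var.
Qed.

Lemma dual_gamma_smooth U : smooth_mx p U -> smooth_mx p (fun q => dual_gamma (U q) q).
Proof.
move=> Us; apply: smooth_mxM; last first.
  apply: smooth_mxV Gs; apply: filterS (frame_unit_near ac cp) => q Fq.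
  exact: cov2_unit.
apply: smooth_mxB; first exact: smooth_mx_derive_var.
by apply: smooth_mxM => //; apply: smooth_mxT; exact: gamma_smooth.
Qed.

(* The connection with matrix gamma makes the 2-form A parallel. *)
Lemma gammaP u : gamma u p *m Ac p + Ac p *m (gamma u p)^T = mx_derive c u Ac p.
Proof.
apply: (parallel_gammaP (@odd_dim n)) => //.
- rewrite -mx_deriveT// -[RHS]scaleN1r.
  have -> : -1 *: mx_derive c u Ac p = mx_derive c u (fun q => - Ac q) p.
    apply/matrixP => i j; rewrite !(mxE, mx_deriveE) -[X in _ = X]add0r -(mul0r (- Ac p i j)).
    have E := @chart_deriveM R m M c p ac cp u (fun=> -1) (fun q => Ac q i j)
      (smooth_fun_cst p (-1)) (smooth_mx_entry i j As).
    rewrite chart_derive_cst mul0r add0r in E; rewrite mul0r add0r -E.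
    by apply: chart_derive_eq => //; near=> q; rewrite mulN1r [in RHS]mxE.
  by apply: mx_derive_eq => //; near=> q; rewrite skA.
- have E : mx_derive c u (fun q => rr q *m Ac q) p = 0.
    rewrite -(mx_derive_cst c p u (0 : 'rV[R]_m)); apply: mx_derive_eq => //.
    apply: filterS (frame_unit_near ac cp) => q Fq.
    by have [_ -> _ _ _] := reeb_spec (@odd_dim n) (skA q) (cov_nondeg HA Fq).
  by rewrite -E mx_deriveM.
Unshelve. all: by end_near. Qed.

Lemma dual_gammaP u : gamma u p *m Gc p + Gc p *m (dual_gamma u p)^T = mx_derive c u Gc p.
Proof.
have dG : (mx_derive c u Gc p)^T = mx_derive c u Gc p.
  by rewrite -mx_deriveT//; apply: mx_derive_eq => //; near=> q; rewrite Gcs.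
rewrite /dual_gamma trmx_mul linearB/= trmx_mul trmxK trmx_inv Gcs dG.
by rewrite (mulmxA (Gc p)) (mulmxV Gcu) mul1mx addrC subrK.
Unshelve. all: by end_near. Qed.

(** The gauge equation in components: differentiate T G = A, then express dA by [gammaP] and expand
    [dual_gamma]. *)
Lemma gauge_gammaP u : mx_derive c u Tc p + Tc p *m dual_gamma u p = gamma u p *m Tc p.
Proof.
have TG q : frame_mx c q \in unitmx -> Tc q *m Gc q = Ac q.
  move=> Fq; rewrite /Tc /Gc /end11 /cov2 /gauge_mx !mulmxA mulmxKV//.
  by rewrite -(mulmxA _ (invmx (G q))) mulVmx// mulmx1.
have E : mx_derive c u Tc p *m Gc p + Tc p *m mx_derive c u Gc p = mx_derive c u Ac p.
  rewrite -mx_deriveM//; apply: mx_derive_eq => //.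
  by apply: filterS (frame_unit_near ac cp) => q Fq; rewrite TG.
have AT : Ac p *m invmx (Gc p) = Tc p by rewrite -(TG p Fp) mulmxK.
rewrite /dual_gamma (mulmxA (Tc p)) (mulmxBr (Tc p)) (mulmxA (Tc p) (Gc p)) TG//.
have -> : Tc p *m mx_derive c u Gc p = mx_derive c u Ac p - mx_derive c u Tc p *m Gc p.
  by rewrite -E addrC addKr.
rewrite -gammaP (mulmxBl _ _ (invmx (Gc p))) (mulmxBl _ _ (invmx (Gc p))) (mulmxK Gcu).
rewrite (mulmxDl _ _ (invmx (Gc p))) -(mulmxA _ (Ac p)) AT.
move: (gamma u p *m Tc p) (_ *m invmx _) (mx_derive _ _ _ _) => P Q S.
by apply/matrixP => i j; rewrite !mxE; ring.
Qed.

Let sv X : smooth_vector_field X -> smooth_mx p (vec c X).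
Proof. by move=> /smooth_vector_fieldP Xs; apply/smooth_vecE. Qed.

Lemma local_conn_dual (X Y Z : vector_field M) : smooth_vector_field X -> smooth_vector_field Y ->
  lie_derivative Z (fun q => mxform (G q) (X q) (Y q)) p =
  mxform (G p) (local_conn c gamma Z X p) (Y p) + mxform (G p) (X p) (local_conn c dual_gamma Z Y p).
Proof.
move=> Xs Ys; have XS := sv Xs; have YS := sv Ys.
pose x := vec c X; pose y := vec c Y; set u := vec c Z p.
have FE q v w : frame_mx c q \in unitmx ->
    mxform (G q) v w = mxform (Gc q) (v *m invmx (frame_mx c q)) (w *m invmx (frame_mx c q)).
  by move=> Fq; rewrite /Gc /cov2 mxform_conj !mulmxKV.
have fs : smooth_mx p (fun q => x q *m Gc q *m (y q)^T).
  exact: (smooth_mxM (smooth_mxM XS Gs) (smooth_mxT YS)).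
have fE : \forall q \near p, (x q *m Gc q *m (y q)^T) 0 0 = mxform (G q) (X q) (Y q).
  by apply: filterS (frame_unit_near ac cp) => q Fq; rewrite FE.
rewrite (@lie_chart R m M c p Z)//; last exact: smooth_fun_eq fE (smooth_mx_entry 0 0 fs).
rewrite -(chart_derive_eq cp u fE).
transitivity (mx_derive c u (fun q => x q *m Gc q *m (y q)^T) p 0 0); first by rewrite mx_deriveE.
rewrite mx_deriveM//; [|exact: (smooth_mxM XS Gs)|exact: smooth_mxT].
rewrite mx_deriveM// mx_deriveT// -dual_gammaP.
rewrite !(FE p)// /local_conn !mulmxK// -/u -/x -/y -/(vec c X p) -/(vec c Y p) /mxform -/x -/y.
move: (mx_derive c u x p) (mx_derive c u y p) (x p) (y p) (gamma u p) (dual_gamma u p) (Gc p).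
move=> dx dy x0 y0 g g' G0.
have -> : (dy + y0 *m g')^T = dy^T + g'^T *m y0^T by rewrite linearD/= trmx_mul.
rewrite !(mulmxDl, mulmxDr) !mulmxA.
move: (_ *m g'^T *m _) (_ *m dy^T) (dx *m _ *m _) (_ *m g *m _ *m _) => P1 P2 P3 P4.
by rewrite !mxE; ring.
Qed.

Lemma local_conn_gauge (X Y : vector_field M) : smooth_vector_field X -> smooth_vector_field Y ->
  local_conn c dual_gamma X (fun q => Y q *m gauge_mx q : tangent q) p =
  local_conn c gamma X Y p *m gauge_mx p.
Proof.
move=> Xs Ys; have YS := sv Ys; set u := vec c X p.
have yE : \forall q \near p, vec c (fun q => Y q *m gauge_mx q) q = vec c Y q *m Tc q.
  apply: filterS (frame_unit_near ac cp) => q Fq.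
  by rewrite /vec /Tc /end11 !mulmxA mulmxKV.
rewrite /local_conn (mx_derive_eq cp _ yE) (nbhs_singleton yE) mx_deriveM// -/u.
rewrite -addrA -mulmxA -mulmxDr gauge_gammaP mulmxA -mulmxDl.
by rewrite -!(mulmxA (_ + _)) /Tc /end11 mulmxKV.
Qed.

End Chart.
End GaugeSolution.

(** * Gluing the connections *)

Section GlueConnections.
Context {R : realType} {n : nat} {M : smooth_manifold R (2 * n).+1}.
Local Notation m := (2 * n).+1.
Variables (A G : M -> 'M[R]_m) (a : M -> 'rV[R]_m).
Hypothesis HA : forall p,
  [/\ (A p)^T = - A p, nondeg (A p) (a p), smooth_cov2 p A & smooth_cov1 p a].
Hypothesis HG : forall p,
  [/\ (G p)^T = G p, forall u, u != 0 -> 0 < mxform (G p) u u & smooth_cov2 p G].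

Local Notation VF := (vector_field M).

(** A connection is treated as a section: its value at [p] is the map sending two global fields to a
    vector at [p], subject to the axioms read at [p]. Connections can then be glued like tensors. *)
Definition conn_at (p : M) (D : VF -> VF -> 'rV[R]_m) :=
  [/\ forall (f : M -> R) X X' Y, smooth_map (f : M -> R^o) -> smooth_vector_field X ->
        smooth_vector_field X' -> smooth_vector_field Y ->
        D (fun q => f q *: X q + X' q) Y = f p *: D X Y + D X' Y,
      forall X Y Y', smooth_vector_field X -> smooth_vector_field Y -> smooth_vector_field Y' ->
        D X (fun q => Y q + Y' q) = D X Y + D X Y' &
      forall (f : M -> R) X Y, smooth_map (f : M -> R^o) -> smooth_vector_field X ->
        smooth_vector_field Y ->
        D X (fun q => f q *: Y q) = lie_derivative X f p *: (Y p : 'rV[R]_m) + f p *: D X Y].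

Definition gauge_pair_at (p : M) (D : (VF -> VF -> 'rV[R]_m) * (VF -> VF -> 'rV[R]_m)) :=
  [/\ conn_at p D.1, conn_at p D.2,
      forall X Y Z, smooth_vector_field X -> smooth_vector_field Y -> smooth_vector_field Z ->
        lie_derivative Z (fun q => mxform (G q) (X q) (Y q)) p =
        mxform (G p) (D.1 Z X) (Y p) + mxform (G p) (X p) (D.2 Z Y) &
      forall X Y, smooth_vector_field X -> smooth_vector_field Y ->
        D.2 X (fun q => (Y q : 'rV[R]_m) *m gauge_mx A G q) = D.1 X Y *m gauge_mx A G p].

Definition smooth_pair_at (p : M) (s : M -> (VF -> VF -> 'rV[R]_m) * (VF -> VF -> 'rV[R]_m)) :=
  forall X Y, smooth_vector_field X -> smooth_vector_field Y ->
    smooth_vec p (fun q => (s q).1 X Y) /\ smooth_vec p (fun q => (s q).2 X Y).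

Definition convex_pair (D D' : (VF -> VF -> 'rV[R]_m) * (VF -> VF -> 'rV[R]_m)) (t : R) :
    (VF -> VF -> 'rV[R]_m) * (VF -> VF -> 'rV[R]_m) :=
  (fun X Y => (1 - t) *: D.1 X Y + t *: D'.1 X Y, fun X Y => (1 - t) *: D.2 X Y + t *: D'.2 X Y).

(** The axioms are affine: in the Leibniz rule the derivative terms carry the weights 1 - t and t,
    which add up to 1. *)
Lemma conn_at_convex p D D' (t : R) : conn_at p D -> conn_at p D' ->
  conn_at p (fun X Y => (1 - t) *: D X Y + t *: D' X Y).
Proof.
move=> [l1 a1 z1] [l2 a2 z2]; split.
- move=> f X X' Y fs Xs X's Ys; rewrite l1// l2//.
  by apply/rowP => j; rewrite !mxE; ring.
- move=> X Y Y' Xs Ys Y's; rewrite a1// a2//.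
  by apply/rowP => j; rewrite !mxE; ring.
- move=> f X Y fs Xs Ys; rewrite z1// z2//.
  by apply/rowP => j; rewrite !mxE; ring.
Qed.

Lemma gauge_pair_convex p D D' t : gauge_pair_at p D -> gauge_pair_at p D' ->
  gauge_pair_at p (convex_pair D D' t).
Proof.
move=> [c1 c1' d1 g1] [c2 c2' d2 g2]; split.
- exact: conn_at_convex.
- exact: conn_at_convex.
- move=> X Y Z Xs Ys Zs /=; rewrite mxformDl !mxformZl mxformDr !mxformZr.
  have E1 := d1 X Y Z Xs Ys Zs; have E2 := d2 X Y Z Xs Ys Zs.
  rewrite -[LHS]mul1r -(subrK t 1) mulrDl {1}E1 E2.
  by ring.
- move=> X Y Xs Ys /=; rewrite g1// g2//.
  by rewrite mulmxDl -!scalemxAl.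
Qed.

Lemma local_gauge_pair (p : M) :
  exists s, \forall q \near p, gauge_pair_at q (s q) /\ smooth_pair_at q s.
Proof.
have ac := @chart_at_adm R m M p; have cp := @chart_at_dom R m M p.
set c := chart_at p in ac cp *.
exists (fun q => (fun X Y => local_conn c (gamma A a c) X Y q,
                  fun X Y => local_conn c (dual_gamma A G a c) X Y q)).
have := chart_dom_near cp; apply: filterS => q cq.
have gl := @gamma_linear _ _ _ A a HA c ac q cq.
have gl' := @dual_gamma_linear _ _ _ A G a HA HG c ac q cq.
split; [split|move=> X Y Xs Ys; split] => /=.
- split.
  + by move=> f X X' Y fs Xs X's Ys; exact: local_conn_linear.
  + by move=> X Y Y' Xs Ys Y's; exact: local_conn_additive.
  + by move=> f X Y /smooth_mapP fs Xs Ys; exact: local_conn_leibniz.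
- split.
  + by move=> f X X' Y fs Xs X's Ys; exact: local_conn_linear.
  + by move=> X Y Y' Xs Ys Y's; exact: local_conn_additive.
  + by move=> f X Y /smooth_mapP fs Xs Ys; exact: local_conn_leibniz.
- by move=> X Y Z Xs Ys Zs; exact: local_conn_dual.
- by move=> X Y Xs Ys; exact: local_conn_gauge.
- by apply: local_conn_smooth => // U; exact: gamma_smooth.
- by apply: local_conn_smooth => // U; exact: dual_gamma_smooth.
Qed.

Lemma gauge_pair_exists : exists s, forall p, gauge_pair_at p (s p) /\ smooth_pair_at p s.
Proof.
apply: (@glue_sections R m M _ (fun _ _ => 0, fun _ _ => 0) gauge_pair_at smooth_pair_at
  (fun _ => convex_pair)).
- move=> p s t st ss X Y Xs Ys; have [s1 s2] := ss X Y Xs Ys; split.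
  + by apply: smooth_vec_eq s1; apply: filterS st => q ->.
  + by apply: smooth_vec_eq s2; apply: filterS st => q ->.
- move=> p [D1 D2] D' _ _; rewrite /convex_pair /=; congr pair;
    by apply/funext => X; apply/funext => Y; rewrite subr0 scale0r addr0 scale1r.
- move=> p D [D1 D2] _ _; rewrite /convex_pair /=; congr pair;
    by apply/funext => X; apply/funext => Y; rewrite subrr scale0r add0r scale1r.
- by move=> p D D' t vD vD' _; exact: gauge_pair_convex.
- move=> p s t w H X Y Xs Ys; have [[_ ss] [_ ts] ws _] := nbhs_singleton H.
  have [s1 s2] := ss X Y Xs Ys; have [t1 t2] := ts X Y Xs Ys.
  have w1 : smooth_fun p (fun q => 1 - w q).
    by apply: smooth_funD; [exact: smooth_fun_cst|exact: smooth_funN].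
  by split; apply: smooth_vecD; exact: smooth_vecZ.
- exact: local_gauge_pair.
Qed.

Lemma gauge_solution : exists (g : metric_field M)
    (nabla nabla' : vector_field M -> vector_field M -> vector_field M)
    (theta : endo_field M),
  riemannian_metric g /\ affine_connection nabla /\ affine_connection nabla' /\
  dual_connections g nabla nabla' /\ smooth_endo_field theta /\
  skew_symmetric g theta /\ (forall p : M, rank_at theta p = (2 * n)%N) /\
  gauge_equation nabla nabla' theta.
Proof.
have [s Hs] := gauge_pair_exists.
pose nabla X Y : VF := fun p => (s p).1 X Y.
pose nabla' X Y : VF := fun p => (s p).2 X Y.
have conn (k : (VF -> VF -> 'rV[R]_m) * (VF -> VF -> 'rV[R]_m) -> (VF -> VF -> 'rV[R]_m)) :
    (forall p, conn_at p (k (s p))) ->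
    (forall p X Y, smooth_vector_field X -> smooth_vector_field Y ->
       smooth_vec p (fun q => k (s q) X Y)) ->
    affine_connection (fun X Y p => k (s p) X Y : tangent p).
  move=> kc ks; split.
  - by move=> X Y Xs Ys; apply/smooth_vector_fieldP => p; exact: ks.
  - by move=> f X X' Y fs Xs X's Ys p; have [l _ _] := kc p; exact: l.
  - by move=> X Y Y' Xs Ys Y's p; have [_ l _] := kc p; exact: l.
  - by move=> f X Y fs Xs Ys p; have [_ _ l] := kc p; exact: l.
have Gu p : G p \in unitmx by have [_ Gp _] := HG p; exact: posdef_unit.
exists (metric_of_mx G), nabla, nabla', (endo_of_mx (gauge_mx A G)).
split; [|split; [|split; [|split; [|split; [|split; [|split]]]]]].
- by apply: metric_of_mxP => p; have [] := HG p.
- apply: (conn fst) => p; first by have [[]] := Hs p.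
  by move=> X Y Xs Ys; have [_ /(_ X Y Xs Ys)[]] := Hs p.
- apply: (conn snd) => p; first by have [[]] := Hs p.
  by move=> X Y Xs Ys; have [_ /(_ X Y Xs Ys)[]] := Hs p.
- by move=> X Y Z Xs Ys Zs p; have [[_ _ d _] _] := Hs p; exact: d.
- apply/smooth_endo_fieldP => p.
  apply: (smooth_end11_eq _ (smooth_gauge_mx HA HG p)).
  by near=> q; rewrite endo_of_mxK.
- move=> p u v; have [As _ _ _] := HA p; have [Gs _ _] := HG p.
  rewrite /metric_of_mx !endo_mxE !endo_of_mxK /mxform /gauge_mx !trmx_mul trmx_inv As Gs.
  rewrite !mulmxA mulmxKV// -(mulmxA _ (G p)) mulmxV// mulmx1 !mulmxN mulNmx.
  by rewrite [in RHS]mxE opprK.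
- move=> p; have [As nd _ _] := HA p.
  rewrite /rank_at -/(endo_mx _ p) endo_of_mxK /gauge_mx mxrankMfree.
    by rewrite (nondeg_rank (@odd_dim n) As nd) mulnC.
  by rewrite row_free_unit unitmx_inv.
- move=> X Y Xs Ys p; have [[_ _ _ ge] _] := Hs p.
  by rewrite endo_mxE endo_of_mxK -[RHS]ge.
Unshelve. all: by end_near. Qed.

End GlueConnections.

Theorem theorem3p1 (R : realType) (n : nat)
    (M : smooth_manifold R (2 * n).+1) (orientM : orientable M) :
  ((exists (omega : kform M 2) (eta : kform M 1), almost_cosymplectic omega eta)
   <->
   (exists (g : metric_field M)
           (nabla nabla' : vector_field M -> vector_field M -> vector_field M)
           (theta : endo_field M),
     riemannian_metric g /\
     affine_connection nabla /\
     affine_connection nabla' /\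
     dual_connections g nabla nabla' /\
     smooth_endo_field theta /\
     skew_symmetric g theta /\
     (forall p : M, rank_at theta p = (2 * n)%N) /\
     gauge_equation nabla nabla' theta))
  /\
  ((exists (omega : kform M 2) (eta : kform M 1), almost_cosymplectic omega eta)
   <->
   (exists (phi : endo_field M) (xi : vector_field M) (eta : kform M 1),
     almost_contact phi xi eta)).
Proof.
split; split.
- move=> /almost_cosymplecticP[A [a HA]]; have [G HG] := @metric_exists R _ M.
  exact: (gauge_solution HA HG).
- move=> [g [_ [_ [theta [gm [_ [_ [_ [ts [sk [rk _]]]]]]]]]]].
  have [G [gE Gs Gp Gsm]] := riemannian_mx gm.
  pose T := endo_mx theta.
  have Tsm := (smooth_endo_fieldP theta).1 ts.
  (* [T p *m G p] is the matrix of g(theta u, v): skew because theta is, and of the same rank as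
     theta since [G p] is invertible. *)
  apply: (cosymplectic_of_rank (A := fun p => T p *m G p) orientM) => p.
  have Gu : G p \in unitmx by apply: posdef_unit; exact: Gp.
  split.
  + apply: mxform_inj => u v; rewrite mxform_tr.
    have := sk p v u; rewrite !gE !endo_mxE -/(T p) => E.
    have -> : mxform (T p *m G p) v u = mxform (G p) (v *m T p) u.
      by rewrite /mxform !mulmxA.
    rewrite E -(mxform_tr (G p)) Gs /mxform mulmxN mulNmx mulmxA [RHS]mxE.
    by [].
  + rewrite mxrankMfree; last by rewrite row_free_unit.
    exact: rk.
  + exact: smooth_end11_cov2.
- by move=> /almost_cosymplecticP[A [a HA]]; exact: (contact_of_cosymplectic HA).
- by move=> [phi [xi [eta ce]]]; exact: cosymplectic_of_contact ce.
Qed.
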